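(* Let $f:\mathbb{R}^d\to\mathbb{R}$ be differentiable with $L$-Lipschitz continuous gradient for some $L>0$, and suppose $f_*:=\inf f>-\infty$. Suppose the positive parameters $\rho,\alpha,\beta$ of the Algorithm (described in the context) satisfy $\rho\in(0,\tfrac12)$, $2\rho+\alpha>1$ and $\tfrac\rho2+\beta>1$. Assume that there exist $\theta>0$, $\mu_1>0$ and $\mu_2>0$ such that $$f(x)\ge\mu_1\|x\|^\theta-\mu_2\qquad\forall x\in\mathbb{R}^d.$$ Then the sequence $\{x^k\}$ generated by the Algorithm satisfies, for all integers $T\ge1$, $$\mathbb{E}[\|x^{k_*}\|^\theta]\le\widetilde M_D,$$ where $k_*:=\max\big\{l:\ l\in\operatorname*{arg\,min}_{\lfloor T/2\rfloor\le k\le T}\sigma_k^{-1}\mathbb{E}[\|x^{k+1}-x^k\|^3]\big\}$, $$\widetilde M_D:=\max\{2^{\theta-1},1\}\,\mu_1^{-1}\big[\mu_1(\theta+d)^{\theta/2}+\mu_2+f_\gamma(x^0)+D_6\big]<\infty,$$ and $D_6$ is the constant defined in the context.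
   Context: $\|\cdot\|$ is the Euclidean norm. For $\sigma>0$, the Gaussian smoothing of $f$ is $f_\sigma(x):=\mathbb{E}_{u\sim\mathcal{N}(0,I)}[f(x+\sigma u)]$, with $\mathcal N(0,I)$ the $d$-dimensional standard Gaussian. Algorithm. Input: $x^0\in\mathbb{R}^d$, real numbers $\alpha>0$, $\beta>0$, $\rho>0$, $\gamma\in(0,1)$. Set $\sigma_0=\gamma$ and $\sigma_k=\gamma k^{-\rho}$ for $k\ge1$. For $k=0,1,2,\dots$: let $N_k=\lceil(k+1)^{\frac43\beta}\rceil$ and $J_k=\lceil(k+1)^{\frac23\alpha}\rceil$; generate $\max\{N_k,J_k\}$ i.i.d. samples $u_i^k\sim\mathcal{N}(0,I)$, independent of the past; set $$v^k=\frac{1}{N_k\sigma_k}\sum_{i=1}^{N_k}\big(f(x^k+\sigma_ku_i^k)-f(x^k)\big)u_i^k,$$ $$H^k=\frac{1}{2J_k\sigma_k^2}\sum_{i=1}^{J_k}\big(f(x^k+\sigma_ku_i^k)+f(x^k-\sigma_ku_i^k)-2f(x^k)\big)\big(u_i^k(u_i^k)^T-I\big);$$ and let $x^{k+1}$ be a global minimizer over $x\in\mathbb{R}^d$ of $$h_k(x):=\langle v^k,x-x^k\rangle+\tfrac12\langle H^k(x-x^k),x-x^k\rangle+\frac{L\sqrt d}{6\sigma_k}(1+\|x^k\|)^3\|x-x^k\|^3 .$$ The iterates $x^k$ are thus random vectors and $\mathbb{E}$ denotes expectation over all randomness. Constants: $D_0:=\max\{\|\nabla f(0)\|^2,L^2\}$,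 $D_1:=\frac{L^2(d+6)^3}{2}\gamma^2+4(d+4)D_0$, $D_3:=6dL^3(d+9)^2(d+16)^4$, $$D_4:=\frac{2^{\frac\rho2+1}\gamma^{1/2}D_1^{3/4}}{L^{1/2}d^{1/4}}\cdot\frac{\beta+\frac\rho2}{\beta+\frac\rho2-1},\quad D_5:=\frac{384\gamma^2D_3}{L^2d}\cdot\frac{\alpha+2\rho}{\alpha+2\rho-1},\quad D_6:=D_4+D_5+\frac{\gamma^2Ld}{2}.$$ *)

(* Defs.v *)
From HB Require Import structures.
From mathcomp Require Import all_boot all_order all_algebra.
From mathcomp Require Import all_classical all_reals all_analysis.

Set Implicit Arguments.
Unset Strict Implicit.
Unset Printing Implicit Defensive.

Import Order.TTheory GRing.Theory Num.Theory.
Import numFieldNormedType.Exports.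

Local Open Scope classical_set_scope.
Local Open Scope ring_scope.

Definition matrix_display : measure_display.
Proof. exact: default_measure_display. Qed.

(* R^d is 'cV[R]_d with the product sigma-algebra (equivalently, the Borel one):
   the smallest one making the entries measurable, as the library does for
   tuples. *)
Section matrix_measurable.
Context {R : realType}.
Variables m n : nat.

Definition matrix_entry_sets : set_system 'M[R]_(m, n) :=
  \bigcup_(ij in [set: 'I_m * 'I_n])
    preimage_set_system setT (fun A : 'M[R]_(m, n) => A ij.1 ij.2) measurable.

HB.instance Definition _ := @isMeasurable.Build matrix_display 'M[R]_(m, n)
  <<s matrix_entry_sets >>
  (@sigma_algebra0 _ setT matrix_entry_sets)
  (@sigma_algebraC _ matrix_entry_sets)
  (@sigma_algebra_bigcup _ setT matrix_entry_sets).

Lemma measurable_matrix_entry i j :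
  measurable_fun setT (fun A : 'M[R]_(m, n) => A i j).
Proof.
move=> _ Y mY; apply: sub_sigma_algebra; exists (i, j) => //.
by exists Y.
Qed.

Lemma measurable_fun_matrixP d (T : measurableType d) (f : T -> 'M[R]_(m, n)) :
  measurable_fun setT f <->
  forall i j, measurable_fun setT (fun t => f t i j).
Proof.
split=> [mf i j|mf].
  exact: measurableT_comp (measurable_matrix_entry i j) mf.
apply: (measurability matrix_entry_sets) => //.
move=> _ [_ [[i j] _ [Y mY <-]] <-].
rewrite !setTI; have := mf i j measurableT Y mY; by rewrite setTI.
Qed.

End matrix_measurable.

Section std_gaussian.
Context {R : realType}.

Definition cons_cV n (p : measurableTypeR R * 'cV[R]_n) : 'cV[R]_n.+1 := col_mx p.1%:M p.2.

Lemma cons_cV0 n p : @cons_cV n p ord0 ord0 = p.1.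
Proof.
have -> : ord0 = lshift n (ord0 : 'I_1) :> 'I_(1 + n) by apply/val_inj.
by rewrite /cons_cV (@col_mxEu _ 1 n) mxE eqxx mulr1n.
Qed.

Lemma cons_cVS n p k : @cons_cV n p (lift ord0 k) ord0 = p.2 k ord0.
Proof.
have -> : lift ord0 k = rshift 1 k :> 'I_(1 + n) by apply/val_inj.
by rewrite /cons_cV (@col_mxEd _ 1 n).
Qed.

Lemma measurable_cons_cV n : measurable_fun setT (@cons_cV n).
Proof.
apply/measurable_fun_matrixP => i j; rewrite (ord1 j) {j}.
case: (unliftP ord0 i) => [k|] ->.
- under eq_fun do rewrite cons_cVS.
  apply: (measurableT_comp (measurable_matrix_entry (m := n) k ord0)).
  exact: measurable_snd.
- under eq_fun do rewrite cons_cV0.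
  exact: measurable_fst.
Qed.

HB.instance Definition _ n := isMeasurableFun.Build _ _ _ _ (@cons_cV n)
  (@measurable_cons_cV n).

(* N(0, I_n) as the n-fold product of N(0, 1) *)
Fixpoint std_gaussian (n : nat) : probability 'cV[R]_n R :=
  match n with
  | 0 => @dirac _ 'cV[R]_0 0 R
  | m.+1 => distribution (normal_prob 0 1 \x std_gaussian m)%E (@cons_cV m)
  end.

Lemma std_gaussian_box n (A : 'I_n -> set R) : (forall i, measurable (A i)) ->
  std_gaussian n [set v | forall i, A i (v i ord0)]
  = (\prod_(i < n) normal_prob 0 1 (A i))%E.
Proof.
elim: n A => [|n IHn] A mA /=.
  by rewrite big_ord0 diracE mem_set// => -[].
pose B : set 'cV[R]_n := [set v | forall i, A (lift ord0 i) (v i ord0)].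
have mB : measurable B.
  rewrite (_ : B = \bigcap_(i in [set: 'I_n])
      ((fun v : 'cV[R]_n => v i ord0) @^-1` A (lift ord0 i))); last first.
    by apply/seteqP; split=> [v Av i _|v Av i]; [exact: Av|exact: (Av i)].
  apply: fin_bigcap_measurable => // i _.
  rewrite -[X in measurable X]setTI.
  exact: (measurable_matrix_entry (m := n)).
rewrite /distribution/pushforward big_ord_recl -IHn//.
rewrite -[X in (_ * X)%E]/(std_gaussian n B) -product_measure1E//; last exact: mA.
congr (_ _); apply/seteqP; split=> -[a v] /=.
  move=> Aav; split=> [|i]; first by have := Aav ord0; rewrite cons_cV0.
  by have := Aav (lift ord0 i); rewrite cons_cVS.
move=> [Aa Av] i; case: (unliftP ord0 i) => [k|] ->.
  by rewrite cons_cVS; exact: Av.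
by rewrite cons_cV0.
Qed.

End std_gaussian.

Section euclidean.
Context {R : realType} {d : nat}.
Implicit Types (x y : 'cV[R]_d) (f : 'cV[R]_d -> R).

Definition dotcv x y : R := \sum_(i < d) x i ord0 * y i ord0.

(* The library's norm `|x| on 'cV[R]_d is the sup norm. *)
Definition enorm x : R := Num.sqrt (dotcv x x).

Definition gradient f x : 'cV[R]_d := \col_i 'D_(delta_mx i ord0) f x.

(* Extended-real valued, so that no integrability is presupposed. *)
Definition gauss_smooth f (sigma : R) x : \bar R :=
  'E_(std_gaussian d)[fun u => f (x + sigma *: u)].

End euclidean.

Section independence.
Context {R : realType} {disp : measure_display} {Omega : measurableType disp}.
Variable P : probability Omega R.
Context {disp' : measure_display} {T : measurableType disp'}.

(* Mutual independence of X_0, ..., X_(n-1). The product rule for the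
   subfamilies is the case where some of the A i are setT. *)
Definition mutually_independent (n : nat) (X : nat -> {RV P >-> T}) : Prop :=
  forall A : nat -> set T, (forall i, measurable (A i)) ->
    P (\bigcap_(i in [set i | (i < n)%N]) (X i @^-1` A i))
    = (\prod_(i < n) P (X i @^-1` A i))%E.

Definition independent_systems (F G : set_system Omega) : Prop :=
  forall A B, F A -> G B -> P (A `&` B) = (P A * P B)%E.

Definition rv_events (X : {RV P >-> T}) : set_system Omega :=
  preimage_set_system setT X measurable.

End independence.

Section algorithm.
Context {R : realType} {d : nat}.
Variables (f : 'cV[R]_d -> R) (L alpha beta rho gamma : R).

Definition smoothing (k : nat) : R :=
  if k == 0%N then gamma else gamma * k%:R `^ (- rho).

Definition n_grad (k : nat) : nat :=
  `|Num.ceil (k.+1%:R `^ (4 / 3 * beta) : R)|%N.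

Definition n_hess (k : nat) : nat :=
  `|Num.ceil (k.+1%:R `^ (2 / 3 * alpha) : R)|%N.

Definition n_samples (k : nat) : nat := maxn (n_grad k) (n_hess k).

Definition grad_estimate (sigma : R) (n : nat) (u : nat -> 'cV[R]_d)
    (x : 'cV[R]_d) : 'cV[R]_d :=
  (n%:R * sigma)^-1 *: \sum_(i < n) (f (x + sigma *: u i) - f x) *: u i.

Definition hess_estimate (sigma : R) (n : nat) (u : nat -> 'cV[R]_d)
    (x : 'cV[R]_d) : 'M[R]_d :=
  (2 * n%:R * sigma ^+ 2)^-1 *: \sum_(i < n)
    (f (x + sigma *: u i) + f (x - sigma *: u i) - 2 * f x)
      *: (u i *m (u i)^T - 1%:M).

Definition cubic_model (sigma : R) (v : 'cV[R]_d) (H : 'M[R]_d)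
    (xk x : 'cV[R]_d) : R :=
  dotcv v (x - xk) + 1 / 2 * dotcv (H *m (x - xk)) (x - xk)
  + L * Num.sqrt d%:R / (6 * sigma) * (1 + enorm xk) ^+ 3
    * enorm (x - xk) ^+ 3.

Context {disp : measure_display} {Omega : measurableType disp}.
Variable P : probability Omega R.
Implicit Types (x : nat -> {RV P >-> 'cV[R]_d})
  (u : nat -> nat -> {RV P >-> 'cV[R]_d}).

(* The sigma-algebra of what is known before the samples of step k are drawn. *)
Definition past_events x u (k : nat) : set_system Omega :=
  <<s \bigcup_(j in [set j | (j <= k)%N]) rv_events (x j) `|`
      \bigcup_(j in [set j | (j < k)%N])
        \bigcup_(i in [set i | (i < n_samples j)%N]) rv_events (u j i) >>.

Definition batch_events u (k : nat) : set_system Omega :=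
  <<s \bigcup_(i in [set i | (i < n_samples k)%N]) rv_events (u k i) >>.

(* x k is the k-th iterate and u k i, for i < n_samples k, is the i-th sample of
   step k (samples are numbered from 0; the others are not used). Any
   measurable choice of the global minimizers is allowed. *)
Record zo_cubic_newton (x0 : 'cV[R]_d) x u : Prop := ZoCubicNewton {
  zo_init : forall w, x 0%N w = x0 ;
  zo_gaussian : forall k i, (i < n_samples k)%N ->
    forall A : set 'cV[R]_d, measurable A ->
      distribution P (u k i) A = std_gaussian d A ;
  zo_iid : forall k, mutually_independent (n_samples k) (u k) ;
  zo_indep_past : forall k,
    independent_systems P (past_events x u k) (batch_events u k) ;
  zo_step : forall k w (y : 'cV[R]_d),
    let v := grad_estimate (smoothing k) (n_grad k) (fun i => u k i w) (x k w) in
    let H := hess_estimate (smoothing k) (n_hess k) (fun i => u k i w) (x k w) in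
    cubic_model (smoothing k) v H (x k w) (x k.+1 w)
    <= cubic_model (smoothing k) v H (x k w) y
}.

(* sigma_k^-1 * E[|x^(k+1) - x^k|^3] *)
Definition scaled_step x (k : nat) : \bar R :=
  ((smoothing k)^-1)%:E * 'E_P[fun w => (enorm (x k.+1 w - x k w) ^+ 3)%R].

End algorithm.

(* The largest minimizer of phi over the integers a <= k <= b. *)
Definition last_argmin {R : realType} (phi : nat -> \bar R) (a b : nat) : nat :=
  \max_(k < b.+1 | (a <= k)%N &&
      [forall l : 'I_b.+1, (a <= l)%N ==> (phi k <= phi l)%E]) k.

Section constants.
Context {R : realType} {d : nat}.
Variables (f : 'cV[R]_d -> R) (L alpha beta rho gamma : R).

Definition D0 : R := Num.max (enorm (gradient f 0) ^+ 2) (L ^+ 2).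

Definition D1 : R :=
  L ^+ 2 * (d%:R + 6) ^+ 3 / 2 * gamma ^+ 2 + 4 * (d%:R + 4) * D0.

Definition D3 : R :=
  6 * d%:R * L ^+ 3 * (d%:R + 9) ^+ 2 * (d%:R + 16) ^+ 4.

Definition D4 : R :=
  2 `^ (rho / 2 + 1) * gamma `^ (1 / 2) * D1 `^ (3 / 4)
    / (L `^ (1 / 2) * d%:R `^ (1 / 4))
  * ((beta + rho / 2) / (beta + rho / 2 - 1)).

Definition D5 : R :=
  384 * gamma ^+ 2 * D3 / (L ^+ 2 * d%:R)
  * ((alpha + 2 * rho) / (alpha + 2 * rho - 1)).

Definition D6 : R := D4 + D5 + gamma ^+ 2 * L * d%:R / 2.

Definition MD (x0 : 'cV[R]_d) (theta mu1 mu2 : R) : \bar R :=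
  (Num.max (2 `^ (theta - 1)) 1 * mu1^-1)%:E
  * ((mu1 * (theta + d%:R) `^ (theta / 2) + mu2)%:E
     + gauss_smooth f gamma x0 + D6%:E).

End constants.

Arguments D3 {R} d L.
Arguments D5 {R} d L alpha rho gamma.

(* Main.v *)
(** The smoothings [f_s(y) = E f(y + s u)] serve as a Lyapunov function. Stein's
    identity, i.e. Gaussian integration by parts, shows that [v^k] and [H^k] are
    unbiased estimators of the gradient and Hessian of [f_(sigma_k)] and that
    this Hessian is Lipschitz with constant [L / sigma_k]. Global minimality of
    [x^(k+1)] makes the cubic model decrease by at least half of its
    cubic term, which by Young's inequality absorbs the estimation
    errors up to [|v^k - E v^k|^(3/2)] and [|H^k - E H^k|^3]; the factor
    [(1 + |x^k|)^3] makes the first one bounded in [x^k]. Averaging over the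
    i.i.d. samples turns these into summable powers of [k + 1], and lowering
    [sigma] costs at most [L d (sigma_k^2 - sigma_(k+1)^2) / 2], which telescopes.
    Hence [E f_(sigma_k)(x^k) <= f_gamma(x^0) + D6] for every [k], in particular
    for [k = k_*], and the growth of [f] turns this into the moment bound. *)

(* No integrability of the iterates is known in advance. Adding [mu2] makes all smoothed values
   nonnegative, so every expectation over the run is an extended-real integral of a nonnegative
   function, for which Tonelli and monotonicity suffice. Conditioning on the past is replaced by
   independence and Tonelli: the moment bounds of one centred sample are uniform in the base point,
   so each sample can be integrated out with everything earlier frozen. The powers 3/2 and 3 of the
   errors are never integrated. Weighted AM-GM bounds [y^(3/2)] and [z^3] by affine functions of
   [y^2] and [z^4], with equality at [y = a^2] and [z = c], so only a second moment of the gradient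
   error and a fourth moment of the Hessian error enter; [a] and [c] are deterministic and decay
   with the batch sizes. Since [f] may lack second derivatives, the Hessian of a smoothing is
   written with the gradient of [f] and one factor [u], and the Taylor bound for the smoothing is
   proved directly along the step. Errors of Hessians are measured in the Frobenius norm. *)
Require Import Defs.
From HB Require Import structures.
From mathcomp Require Import all_boot all_order all_algebra.
From mathcomp Require Import all_classical all_reals all_analysis.
From mathcomp Require Import ring lra.
Set Implicit Arguments.
Unset Strict Implicit.
Unset Printing Implicit Defensive.
Import Order.TTheory GRing.Theory Num.Theory.
Import numFieldNormedType.Exports measurable_realfun.
Local Open Scope classical_set_scope.
Local Open Scope ring_scope.

(** * Gaussian integrals in one and several variables *)

Section normal_density_integral.
Context {R : realType}.
Notation mu := (@lebesgue_measure R).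
Notation nu := (@normal_prob R 0 1).
Notation p := (@normal_pdf R 0 1).
Local Open Scope ereal_scope.

(** The Radon-Nikodym derivative of [nu] is determined only up to null sets; it agrees almost
    everywhere with [p] because both have the same integral over every measurable set. *)
Lemma ge0_integral_normal_prob (f : R -> \bar R) :
  measurable_fun setT f -> (forall x, 0 <= f x) ->
  \int[nu]_x f x = \int[mu]_x (f x * (p x)%:E).
Proof.
move=> mf f0.
have dom := @normal_prob_dominates R 0 1.
rewrite -(@Radon_Nikodym_SigmaFinite.change_of_variables _ _ _ nu mu dom f setT)//.
have intRN := @Radon_Nikodym_SigmaFinite.f_integrable _ _ _ nu mu dom.
apply: ae_eq_integral => //.
- by apply: emeasurable_funM => //; exact: measurable_int intRN.
- apply: emeasurable_funM => //; apply/measurable_EFinP.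
  exact: measurable_normal_pdf.
- apply: ae_eqe_mul2l; apply: integral_ae_eq => //.
  + by apply/measurable_EFinP; exact: measurable_normal_pdf.
  + by move=> E _ mE; rewrite -Radon_Nikodym_SigmaFinite.f_integral.
Qed.

Lemma integral_normal_prob (f : R -> \bar R) : measurable_fun setT f ->
  \int[nu]_x f x = \int[mu]_x (f x * (p x)%:E).
Proof.
move=> mf; rewrite integralE [RHS]integralE.
rewrite !ge0_integral_normal_prob//; [|exact: measurable_funeneg|exact: measurable_funepos].
have p0 x : (0 <= p x)%R := normal_pdf_ge0 0 1 x.
congr (_ - _); apply: eq_integral => x _; rewrite ?funeposE ?funenegE.
  by rewrite maxe_pMl ?lee_fin ?p0// mul0e.
by rewrite maxe_pMl ?lee_fin ?p0// mul0e mulNe.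
Qed.

End normal_density_integral.

Section gauss1.
Context {R : realType}.
Notation mu := (@lebesgue_measure R).
Notation nu := (@normal_prob R 0 1).
Notation p := (@normal_pdf R 0 1).
Implicit Types (h g : R -> R) (C a : R) (m : nat).

(** It suffices to bound [1 + |a|] by a multiple of the exponential of [a^2 / (4 (m + 1))] and to
    take the power [m]. Dividing by [m.+1] instead of [m] covers [m = 0]. *)
Lemma growth_le_expR m : exists2 C, 0 <= C &
  forall a : R, (1 + `|a|) ^+ m <= C * expR (a ^+ 2 / 4).
Proof.
exists ((2 + 4 * m.+1%:R) ^+ m) => [|a].
  by rewrite exprn_ge0// addr_ge0// mulr_ge0.
have h1 : 1 + `|a| <= (2 + 4 * m.+1%:R) * expR (a ^+ 2 / (4 * m.+1%:R)).
  have := expR_ge1Dx (a ^+ 2 / (4 * m.+1%:R)).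
  set e := expR _ => he.
  have m1 : 0 < (m.+1%:R : R) by [].
  have : a ^+ 2 / (4 * m.+1%:R) * (4 * m.+1%:R) = a ^+ 2.
    by rewrite divfK// mulf_neq0// gt_eqF.
  set q := a ^+ 2 / _ in he *; move=> hq.
  have : `|a| <= 1 + a ^+ 2.
    by rewrite -real_normK ?num_real//; have := sqr_ge0 (`|a| - 1); nra.
  have q0 : 0 <= q by rewrite /q divr_ge0 ?sqr_ge0// mulr_ge0.
  nra.
apply: le_trans (_ : ((2 + 4 * m.+1%:R) * expR (a ^+ 2 / (4 * m.+1%:R))) ^+ m <= _).
  by rewrite lerXn2r// nnegrE ?addr_ge0// mulr_ge0 ?expR_ge0// addr_ge0// mulr_ge0.
rewrite exprMn -expRM_natr ler_wpM2l ?exprn_ge0 ?addr_ge0 ?mulr_ge0//.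
rewrite ler_expR -mulrA ler_wpM2l ?sqr_ge0// invfM -mulrA ler_piMr//.
by rewrite mulrC ler_pdivrMr// mul1r ler_nat.
Qed.

Lemma normal_pdf0E (s x : R) : s != 0 ->
  normal_pdf 0 s x = normal_peak s * expR (- x ^+ 2 / (s ^+ 2 *+ 2)).
Proof. by move=> s0; rewrite /normal_pdf /normal_fun subr0 ifN. Qed.

Lemma normal_pdf01E : p = fun x => normal_peak 1 * expR (- x ^+ 2 / 2).
Proof.
by apply/funext => x; rewrite normal_pdf0E ?oner_eq0// expr1n.
Qed.

(** Half of the exponent [a^2 / 2] of the density pays for the polynomial factor; the other half is
    left for integrability and for the decay of boundary terms. *)
Lemma growth_pdf_le m : exists2 C, 0 <= C &
  forall a : R, (1 + `|a|) ^+ m * p a <= C * expR (- a ^+ 2 / 4).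
Proof.
have [C C0 hC] := growth_le_expR m.
exists (C * normal_peak 1) => [|a]; first by rewrite mulr_ge0// normal_peak_ge0.
rewrite normal_pdf01E mulrCA -mulrA [leRHS]mulrCA.
rewrite ler_wpM2l ?normal_peak_ge0//.
apply: le_trans (ler_wpM2r (expR_ge0 _) (hC a)) _.
by rewrite -mulrA ler_wpM2l// -expRD ler_expR; lra.
Qed.

Lemma integrable_growth_pdf m :
  mu.-integrable setT (fun x : R => ((1 + `|x|) ^+ m * p x)%:E).
Proof.
have [C C0 hC] := growth_pdf_le m.
(* The normal density with standard deviation [sqrt 2] has exponent [- x^2 / 4], so a multiple of it
   is the bound of [growth_pdf_le]. *)
have s0 : Num.sqrt 2 != 0 :> R by rewrite gt_eqF// sqrtr_gt0.
have H := integrableZl measurableT (C / normal_peak (Num.sqrt 2))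
  (integrable_normal_pdf 0 (Num.sqrt 2)).
apply: (le_integrable measurableT _ _ H).
  apply/measurable_EFinP; apply: measurable_funM; last exact: measurable_normal_pdf.
  apply: measurable_funX; apply: measurable_funD => //; exact: measurableT_comp.
have pk0 : 0 < normal_peak (Num.sqrt 2 : R) by exact: normal_peak_gt0.
move=> x _ /=; rewrite lee_fin ger0_norm; last first.
  by rewrite mulr_ge0 ?normal_pdf_ge0// exprn_ge0// addr_ge0.
apply: le_trans (hC x) _; apply: le_trans (ler_norm _).
rewrite normal_pdf0E// sqr_sqrtr// mulrA divfK ?gt_eqF//.
by rewrite (_ : 2 *+ 2 = 4 :> R)// -mulr_natr; lra.
Qed.

Lemma integrable_growth1 m :
  nu.-integrable setT (fun x : R => ((1 + `|x|) ^+ m)%:E).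
Proof.
have mf : measurable_fun [set: R] (fun x : R => (1 + `|x|) ^+ m).
  apply: measurable_funX; apply: measurable_funD => //; exact: measurableT_comp.
apply/integrableP; split; first exact/measurable_EFinP.
rewrite ge0_integral_normal_prob//; last first.
  by apply: measurableT_comp => //; exact/measurable_EFinP.
have /integrableP[_] := integrable_growth_pdf m; apply: le_lt_trans.
apply: ge0_le_integral => //.
- by move=> x _; rewrite mule_ge0// lee_fin normal_pdf_ge0.
- apply: emeasurable_funM; last by apply/measurable_EFinP; exact: measurable_normal_pdf.
  by apply: measurableT_comp => //; exact/measurable_EFinP.
- apply: measurableT_comp => //; apply/measurable_EFinP.
  by apply: measurable_funM => //; exact: measurable_normal_pdf.
- by move=> x _ /=; rewrite -EFinM lee_fin normrM (ger0_norm (normal_pdf_ge0 _ _ _)).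
Qed.

(** Leads from compact intervals, where the fundamental theorem of calculus and substitution are
    applied, to the whole line. With [n.+1] the interval is nondegenerate from the start. *)
Lemma cvg_integral_symm_itv (k : R -> R) : mu.-integrable setT (EFin \o k) ->
  (\int[mu]_(x in `[(- n.+1%:R)%R, n.+1%:R%R]) (k x)%:E @[n --> \oo] -->
    \int[mu]_x (k x)%:E)%E.
Proof.
move=> ik.
have E n : (\int[mu]_(x in `[(- n.+1%:R)%R, n.+1%:R%R]) (k x)%:E =
   \int[mu]_x (((EFin \o k) \_ `[(- n.+1%:R)%R, n.+1%:R%R]) x))%E.
  by rewrite integral_mkcond.
under eq_fun do rewrite E.
apply: (@dominated_cvg _ _ _ mu setT measurableT _ _ (abse \o (EFin \o k))) => //.
- move=> n; apply/(measurable_restrictT _ _).1 => //.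
  by apply: measurable_funTS; exact: measurable_int ik.
- move=> x _; apply: cvg_near_cst.
  exists (Num.truncn `|x|) => // n /= hn.
  rewrite patchE mem_set//= in_itv/=.
  have : `|x| < n.+1%:R.
    by apply: lt_le_trans (truncnS_gt _) _; rewrite ler_nat ltnS.
  by rewrite -ler_norml => /ltW.
- exact: integrable_abse.
- by move=> n x _; rewrite patchE; case: ifP; rewrite //= ?normr0 ?lee_fin ?normr_ge0.
Qed.

(** Since [p' = - x p], the function [h p] has derivative [(g - x h) p], whose integral over the
    line vanishes because [h p] tends to 0 at both ends. *)
Lemma gauss_stein1 h g C m :
  (forall x : R, is_derive x (1 : R) h (g x)) -> continuous g ->
  (forall x : R, `|h x| <= C * (1 + `|x|) ^+ m) ->
  (forall x : R, `|g x| <= C * (1 + `|x|) ^+ m) ->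
  (\int[nu]_x (h x * x)%:E = \int[nu]_x (g x)%:E)%E.
Proof.
move=> dh cg hh hg.
have C0 : 0 <= C.
  by have := hh 0; rewrite normr0 addr0 expr1n mulr1; apply: le_trans.
have ch : continuous h.
  by move=> x; apply/differentiable_continuous/derivable1_diffP; case: (dh x).
have mh : measurable_fun [set: R] h by exact: continuous_measurable_fun.
have mg : measurable_fun [set: R] g by exact: continuous_measurable_fun.
have mp : measurable_fun [set: R] p by exact: measurable_normal_pdf.
have p0 x : 0 <= p x by exact: normal_pdf_ge0.
have cp : continuous p by apply: continuous_normal_pdf; rewrite oner_eq0.
have dp (x : R) : is_derive x (1 : R) p (- x * p x).
  have e1 : is_derive x (1 : R) (fun y : R => (- 1 / 2) * y ^+ 2) (- x).
    have e0 := is_deriveZ (- 1 / 2) (is_deriveX 2 (is_derive_id x (1 : R))).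
    apply: (is_derive_eq e0); rewrite /GRing.scale/= expr1; lra.
  have e2 := @is_derive1_comp _ expR (fun y : R => (- 1 / 2) * y ^+ 2) x _ _
    (is_derive_expR ((- 1 / 2) * x ^+ 2)) e1.
  have -> : p = normal_peak 1 \*: (expR \o (fun y : R => (- 1 / 2) * y ^+ 2)).
    rewrite normal_pdf01E; apply/funext => y /=.
    by rewrite /GRing.scale/= mulrAC mulN1r.
  apply: (is_derive_eq (is_deriveZ (normal_peak 1) e2)).
  rewrite /GRing.scale/=.
  rewrite -[normal_peak 1 *: expR (- 1 / 2 * x ^+ 2)]/(normal_peak 1 * expR (- 1 / 2 * x ^+ 2)).
  by ring.
pose F x := h x * p x.
pose k x := g x * p x - h x * x * p x.
have dF (x : R) : is_derive x (1 : R) F (k x).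
  apply: (is_derive_eq (is_deriveM (dh x) (dp x))).
  by rewrite /GRing.scale/= /k; ring.
have ck : continuous k.
  move=> x; apply: cvgB; first by apply: cvgM; [exact: cg|exact: cp].
  by apply: cvgM; [apply: cvgM; [exact: ch|]|exact: cp].
have ig : mu.-integrable setT (fun x => (g x * p x)%:E).
  have H := integrableZl measurableT C (integrable_growth_pdf m).
  apply: (le_integrable measurableT _ _ H).
    by apply/measurable_EFinP; exact: measurable_funM.
  move=> x _ /=; rewrite lee_fin normrM (ger0_norm (p0 x)).
  apply: le_trans (ler_norm _); rewrite mulrA ler_wpM2r//; exact: hg.
have ih : mu.-integrable setT (fun x => (h x * x * p x)%:E).
  have H := integrableZl measurableT C (integrable_growth_pdf m.+1).
  apply: (le_integrable measurableT _ _ H).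
    by apply/measurable_EFinP; apply: measurable_funM => //; exact: measurable_funM.
  move=> x _ /=; rewrite lee_fin normrM (ger0_norm (p0 x)).
  apply: le_trans (ler_norm _); rewrite mulrA ler_wpM2r// normrM exprS mulrCA mulrC.
  by rewrite ler_pM// lerDr.
have ik : mu.-integrable setT (EFin \o k).
  have -> : EFin \o k = ((fun x => (g x * p x)%:E) \- (fun x => (h x * x * p x)%:E))%E.
    by apply/funext => x /=; rewrite EFinB.
  exact: integrableB.
have lim1 := cvg_integral_symm_itv ik.
have lim2 : (\int[mu]_(x in `[(- n.+1%:R)%R, n.+1%:R%R]) (k x)%:E @[n --> \oo] --> 0)%E.
  have [C' C'0 hC'] := growth_pdf_le m.
  have hF x : `|F x| <= C * C' * expR (- x ^+ 2 / 4).
    rewrite normrM (ger0_norm (p0 x)).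
    apply: le_trans (ler_wpM2r (p0 x) (hh x)) _.
    by rewrite -!mulrA ler_wpM2l.
  have -> : (fun n => \int[mu]_(x in `[(- n.+1%:R)%R, n.+1%:R%R]) (k x)%:E)%E =
      (fun n => (F n.+1%:R - F (- n.+1%:R))%:E).
    apply/funext => n; rewrite (@continuous_FTC2 _ k F).
    - by rewrite EFinB.
    - by rewrite (@lt_trans _ _ 0)// oppr_lt0.
    - exact: continuous_subspaceT.
    - have cF : continuous F.
        by move=> x; apply/differentiable_continuous/derivable1_diffP; case: (dF x).
      split.
      + by move=> x _; case: (dF x).
      + exact/cvg_at_right_filter/cF.
      + exact/cvg_at_left_filter/cF.
    - by move=> x _; rewrite derive1E; apply: derive_val.
  apply/fine_cvgP; split; first exact: nearW.
  have c0 : (2 * C * C' * expR 1 * expR (- n.+1%:R) @[n --> \oo] --> (0:R))%R.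
    rewrite -[X in _ --> X](mulr0 (2 * C * C' * expR 1)); apply: cvgMr.
    by have := @cvgn_expR R; rewrite -cvg_shiftS.
  have c0' : (- (2 * C * C' * expR 1 * expR (- n.+1%:R)) @[n --> \oo] --> (0:R))%R.
    by rewrite -oppr0; exact: cvgN.
  apply: (squeeze_cvgr _ c0' c0); apply: nearW => n /=.
  rewrite -ler_norml; apply: le_trans (ler_normB _ _) _.
  (* From [(x / 2 - 1)^2 >= 0]: the Gaussian tail is replaced by the geometric sequence
     [exp (- (n + 1))]. *)
  have b (x : R) : expR (- x ^+ 2 / 4) <= expR 1 * expR (- x).
    by rewrite -expRD ler_expR; have := sqr_ge0 (x / 2 - 1); nra.
  have CC : 0 <= C * C' by rewrite mulr_ge0.
  have := hF n.+1%:R; have := hF (- n.+1%:R); rewrite sqrrN.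
  have := ler_wpM2l CC (b n.+1%:R).
  lra.
have k0 : (\int[mu]_x (k x)%:E = 0)%E by exact: cvg_unique lim1 lim2.
rewrite !integral_normal_prob; last 2 first.
- exact/measurable_EFinP.
- by apply/measurable_EFinP; exact: measurable_funM.
move: k0; under eq_integral do rewrite /k EFinB.
rewrite integralB// => /eqP.
rewrite sube_eq ?add0e; last 2 first.
- exact: integrable_fin_num.
- by rewrite fin_num_adde_defl//; exact: integrable_fin_num.
move=> /eqP; under eq_integral do rewrite EFinM.
by move=> ->; apply: eq_integral => x _; rewrite EFinM.
Qed.

(** The substitution [x -> - x] on symmetric compact intervals preserves the density; then pass to
    the limit. *)
Lemma integral_normal_prob_sym h C m : continuous h ->
  (forall x : R, `|h x| <= C * (1 + `|x|) ^+ m) ->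
  (\int[nu]_x (h (- x)%R)%:E = \int[nu]_x (h x)%:E)%E.
Proof.
move=> ch hh.
have mp : measurable_fun [set: R] p by exact: measurable_normal_pdf.
have p0 x : 0 <= p x by exact: normal_pdf_ge0.
have cp : continuous p by apply: continuous_normal_pdf; rewrite oner_eq0.
have chN : continuous (fun x : R => h (- x)).
  by move=> x; apply: continuous_comp; [exact: oppr_continuous|exact: ch].
have key (g : R -> R) : continuous g -> (forall x : R, `|g x| <= C * (1 + `|x|) ^+ m) ->
    measurable_fun [set: R] g /\ mu.-integrable setT (EFin \o (fun x => g x * p x)).
  move=> cg hg; have mg : measurable_fun [set: R] g by exact: continuous_measurable_fun.
  split=> //; have H := integrableZl measurableT C (integrable_growth_pdf m).
  apply: (le_integrable measurableT _ _ H).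
    by apply/measurable_EFinP; exact: measurable_funM.
  move=> x _ /=; rewrite lee_fin normrM (ger0_norm (p0 x)).
  apply: le_trans (ler_norm _); rewrite mulrA ler_wpM2r//; exact: hg.
have [mh ih] := key h ch hh.
have [mhN ihN] : measurable_fun [set: R] (fun x : R => h (- x)) /\
    mu.-integrable setT (EFin \o (fun x : R => h (- x) * p x)).
  by apply: key => // x; apply: le_trans (hh _) _; rewrite normrN.
rewrite !integral_normal_prob; [|exact/measurable_EFinP..].
under eq_integral do rewrite -EFinM.
under [RHS]eq_integral do rewrite -EFinM.
have l1 := cvg_integral_symm_itv ihN; have l2 := cvg_integral_symm_itv ih.
apply: cvg_unique l1 _ => //; apply: cvg_trans l2; apply: near_eq_cvg; apply: nearW => n /=.
rewrite -[in LHS](opprK n.+1%:R) integration_by_substitution_oppr.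
- by rewrite opprK; apply: eq_integral => x _ /=; rewrite normal_pdf01E sqrrN.
- by rewrite opprK (@le_trans _ _ 0)// oppr_le0.
- apply: continuous_subspaceT => x; apply: cvgM; [exact: ch|exact: cp].
Qed.

End gauss1.

(** * Functions of polynomial growth and their Gaussian means *)

Section poly_growth.
Context {R : realType}.

(** A product over coordinates rather than a function of a norm: it splits along [cons_cV], so
    Gaussian integrals of its powers factor by Tonelli. *)
Definition weight n (v : 'cV[R]_n) : R := \prod_(i < n) (1 + `|v i ord0|).

(** The class is closed under ring operations, affine substitutions and freezing of the first
    coordinate, and its members are Gaussian-integrable; membership stands in for integrability
    checks. [C] carries no sign condition because evaluation at 0 yields one. *)
Definition poly_growth n (F : 'cV[R]_n -> R) : Prop :=
  measurable_fun setT F /\ exists C m, forall v, `|F v| <= C * weight v ^+ m.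

Lemma weight_ge1 n (v : 'cV[R]_n) : 1 <= weight v.
Proof.
by rewrite /weight; elim/big_rec: _ => // i x _ x1; rewrite mulr_ege1// lerDl.
Qed.

Lemma weight_gt0 n (v : 'cV[R]_n) : 0 < weight v.
Proof. exact: lt_le_trans ltr01 (weight_ge1 v). Qed.

Lemma weight0 n : weight (0 : 'cV[R]_n) = 1.
Proof. by rewrite /weight big1// => i _; rewrite mxE normr0 addr0. Qed.

Lemma weight_cons n (p : R * 'cV[R]_n) :
  weight (cons_cV p) = (1 + `|p.1|) * weight p.2.
Proof.
rewrite /weight big_ord_recl cons_cV0; congr (_ * _).
by apply: eq_bigr => i _; rewrite cons_cVS.
Qed.

Lemma normr_coord_le_weight n (v : 'cV[R]_n) i : `|v i ord0| <= weight v.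
Proof.
rewrite /weight (bigD1 i)//=; apply: le_trans (_ : 1 + `|v i ord0| <= _).
  by rewrite lerDr.
rewrite ler_peMr ?addr_ge0//.
by elim/big_rec: _ => // j x _ x1; rewrite mulr_ege1// lerDl.
Qed.

Lemma weightD n (u v : 'cV[R]_n) : weight (u + v) <= weight u * weight v.
Proof.
rewrite /weight -big_split/=; apply: ler_prod => i _; rewrite addr_ge0//= mxE.
have := ler_normD (u i ord0) (v i ord0).
by have := normr_ge0 (u i ord0); have := normr_ge0 (v i ord0); nra.
Qed.

Lemma weightZ n (a : R) (v : 'cV[R]_n) : weight (a *: v) <= (1 + `|a|) ^+ n * weight v.
Proof.
rewrite /weight -[X in _ ^+ X]card_ord -prodr_const -big_split/=.
apply: ler_prod => i _; rewrite addr_ge0//= mxE normrM.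
by have := normr_ge0 (v i ord0); have := normr_ge0 a; nra.
Qed.

Lemma measurable_weight n : measurable_fun setT (@weight n).
Proof.
apply: measurable_prod => i _; apply: measurable_funD => //.
by apply: measurableT_comp => //; exact: measurable_matrix_entry.
Qed.

Section closure.
Context {n : nat}.
Implicit Types F G : 'cV[R]_n -> R.

(** The exponent can be enlarged freely, so that two bounds can be brought to a common power of
    [weight]. *)
Lemma poly_growthW F : poly_growth F -> measurable_fun setT F /\
  exists C m, 0 <= C /\ forall v k, (m <= k)%N -> `|F v| <= C * weight v ^+ k.
Proof.
move=> [mF [C [m h]]]; split=> //; exists C, m.
have C0 : 0 <= C.
  by have := h 0; rewrite weight0 expr1n mulr1; apply: le_trans.
split=> // v k mk; apply: le_trans (h v) _; rewrite ler_wpM2l//.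
by rewrite ler_weXn2l// weight_ge1.
Qed.

Lemma poly_growth_cst (c : R) : poly_growth (fun _ : 'cV[R]_n => c).
Proof. by split=> //; exists `|c|, 0%N => v; rewrite expr0 mulr1. Qed.

Lemma poly_growth_coord i : poly_growth (fun v : 'cV[R]_n => v i ord0).
Proof.
split; first exact: measurable_matrix_entry.
by exists 1, 1%N => v; rewrite mul1r expr1 normr_coord_le_weight.
Qed.

Lemma poly_growthD F G : poly_growth F -> poly_growth G ->
  poly_growth (fun v => F v + G v).
Proof.
move=> /poly_growthW[mF [C [m [C0 hF]]]] /poly_growthW[mG [D [k [D0 hG]]]].
split; first exact: measurable_funD.
exists (C + D), (m + k)%N => v; apply: le_trans (ler_normD _ _) _.
by rewrite mulrDl lerD// ?hF ?hG// ?leq_addr ?leq_addl.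
Qed.

Lemma poly_growthM F G : poly_growth F -> poly_growth G ->
  poly_growth (fun v => F v * G v).
Proof.
move=> [mF [C [m hF]]] [mG [D [k hG]]]; split; first exact: measurable_funM.
exists (C * D), (m + k)%N => v; rewrite normrM exprD mulrACA.
by rewrite ler_pM ?hF ?hG.
Qed.

Lemma poly_growthZ (c : R) F : poly_growth F -> poly_growth (fun v => c * F v).
Proof. exact/poly_growthM/poly_growth_cst. Qed.

Lemma poly_growthN F : poly_growth F -> poly_growth (fun v => - F v).
Proof.
by move=> /(poly_growthZ (-1)); under eq_fun do rewrite mulN1r.
Qed.

Lemma poly_growthB F G : poly_growth F -> poly_growth G ->
  poly_growth (fun v => F v - G v).
Proof. by move=> pF pG; apply: poly_growthD => //; exact: poly_growthN. Qed.

Lemma poly_growthX F m : poly_growth F -> poly_growth (fun v => F v ^+ m).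
Proof.
move=> pF; elim: m => [|m IH]; first exact: poly_growth_cst.
by under eq_fun do rewrite exprS; exact: poly_growthM.
Qed.

Lemma poly_growth_sum (I : Type) (r : seq I) (P : pred I) (F : I -> 'cV[R]_n -> R) :
  (forall i, P i -> poly_growth (F i)) -> poly_growth (fun v => \sum_(i <- r | P i) F i v).
Proof.
move=> pF; elim: r => [|a r IH].
  by under eq_fun do rewrite big_nil; exact: poly_growth_cst.
under eq_fun do rewrite big_cons.
case: (boolP (P a)) => // Pa.
by apply: poly_growthD => //; exact: pF.
Qed.

Lemma poly_growth_norm F : poly_growth F -> poly_growth (fun v => `|F v|).
Proof.
move=> [mF [C [m hF]]]; split; first exact: measurableT_comp.
by exists C, m => v; rewrite normr_id.
Qed.

Lemma poly_growth_affine F (x : 'cV[R]_n) (a : R) :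
  poly_growth F -> poly_growth (fun v => F (x + a *: v)).
Proof.
move=> [mF [C [m hF]]]; split.
  apply: measurableT_comp => //; apply/measurable_fun_matrixP => i j.
  under eq_fun do rewrite !mxE; apply: measurable_funD => //.
  by apply: measurable_funM => //; exact: measurable_matrix_entry.
have C0 : 0 <= C.
  by have := hF 0; rewrite weight0 expr1n mulr1; apply: le_trans.
exists (C * (weight x * (1 + `|a|) ^+ n) ^+ m), m => v.
apply: le_trans (hF _) _; rewrite -mulrA -exprMn ler_wpM2l// lerXn2r//.
- by rewrite nnegrE ltW// weight_gt0.
- by rewrite nnegrE !mulr_ge0// ?exprn_ge0 ?addr_ge0// ltW// weight_gt0.
- apply: le_trans (weightD _ _) _; rewrite -mulrA ler_wpM2l//.
    by rewrite ltW// weight_gt0.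
  exact: weightZ.
Qed.

Lemma poly_growth_le F G : measurable_fun setT F -> poly_growth G ->
  (forall v, `|F v| <= G v) -> poly_growth F.
Proof.
move=> mF [_ [C [m hG]]] FG; split=> //; exists C, m => v.
by apply: le_trans (FG v) _; apply: le_trans (hG v); exact: ler_norm.
Qed.

End closure.

Lemma poly_growth_tail n (F : 'cV[R]_n.+1 -> R) a :
  poly_growth F -> poly_growth (fun v => F (cons_cV (a, v))).
Proof.
move=> [mF [C [m hF]]]; split.
  apply: measurableT_comp => //.
  exact: (measurableT_comp (@measurable_cons_cV R n) (pair1_measurable (a : measurableTypeR R))).
exists (C * (1 + `|a|) ^+ m), m => v.
by apply: le_trans (hF _) _; rewrite weight_cons exprMn mulrA.
Qed.

End poly_growth.

Section gauss_integral.
Context {R : realType}.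
Notation nu := (@normal_prob R 0 1).

Lemma integral_weight_lty n m :
  (\int[std_gaussian n]_v ((weight v : R) ^+ m)%:E < +oo)%E.
Proof.
have mw k : measurable_fun [set: 'cV[R]_k] (fun v => (weight v ^+ m)%:E).
  by apply/measurable_EFinP; apply: measurable_funX; exact: measurable_weight.
have w0 k (v : 'cV[R]_k) : (0 <= (weight v ^+ m)%:E)%E.
  by rewrite lee_fin exprn_ge0// ltW// weight_gt0.
elim: n => [|n IHn].
  rewrite [std_gaussian 0]/= integral_dirac//; last exact: mw.
  by rewrite diracE mem_set// mul1e ltry.
rewrite [std_gaussian _]/= ge0_integral_distribution//; last exact: mw.
have mwn := mw n; have mwS := mw n.+1.
rewrite fubini_tonelli1; [|exact: (measurableT_comp mwS (@measurable_cons_cV R n))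
  |by move=> x; exact: w0].
rewrite /fubini_F/=.
under eq_integral => a _.
  under eq_integral do rewrite weight_cons exprMn/= EFinM.
  rewrite ge0_integralZl; [|by []|exact: mwn|by move=> v _; exact: w0|
    by rewrite lee_fin exprn_ge0// addr_ge0].
  over.
have /integrableP[mg ig] := @integrable_growth1 R m.
have g0 (a : R) : (0 <= ((1 + `|a|) ^+ m)%:E)%E by rewrite lee_fin exprn_ge0// addr_ge0.
have I0 : (0 <= \int[std_gaussian n]_v ((weight v : R) ^+ m)%:E)%E.
  by apply: integral_ge0 => v _; exact: w0.
rewrite ge0_integralZr//=.
apply: lte_mul_pinfty => //.
- exact: integral_ge0.
- rewrite ge0_fin_numE.
    apply: le_lt_trans ig; apply: ge0_le_integral => //.
    + by apply: measurableT_comp.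
    + by move=> a _ /=; rewrite lee_fin ler_norm.
  exact: integral_ge0.
Qed.

Lemma poly_growth_integrable n (F : 'cV[R]_n -> R) :
  poly_growth F -> (std_gaussian n).-integrable setT (EFin \o F).
Proof.
move=> /poly_growthW[mF [C [m [C0 hF]]]]; apply/integrableP; split.
  exact/measurable_EFinP.
apply: (@le_lt_trans _ _ (\int[std_gaussian n]_v (C%:E * (weight v ^+ m)%:E))%E).
  apply: ge0_le_integral => //.
  - by apply: measurableT_comp => //; exact/measurable_EFinP.
  - apply: emeasurable_funM => //; apply/measurable_EFinP.
    by apply: measurable_funX; exact: measurable_weight.
  - by move=> v _; rewrite /= lee_fin hF.
rewrite ge0_integralZl//.
- by rewrite lte_mul_pinfty ?lee_fin// integral_weight_lty.
- by apply/measurable_EFinP; apply: measurable_funX; exact: measurable_weight.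
- by move=> v _; rewrite lee_fin exprn_ge0// ltW// weight_gt0.
Qed.

End gauss_integral.

Section gauss_expectation.
Context {R : realType}.
Notation nu := (@normal_prob R 0 1).

(** Real-valued, so that ordinary field arithmetic applies; by [gauss_meanE] nothing is lost on
    functions of polynomial growth. *)
Definition gauss_mean n (F : 'cV[R]_n -> R) : R := (\int[std_gaussian n]_v F v)%R.

Section linear.
Context {n : nat}.
Implicit Types F G : 'cV[R]_n -> R.

Lemma gauss_meanE F : poly_growth F ->
  (\int[std_gaussian n]_v (F v)%:E)%E = (gauss_mean F)%:E.
Proof.
move=> /poly_growth_integrable iF; rewrite /gauss_mean /Rintegral fineK//.
exact: integrable_fin_num.
Qed.

Lemma eq_gauss_mean F G : F =1 G -> gauss_mean F = gauss_mean G.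
Proof. by move=> FG; congr gauss_mean; apply/funext. Qed.

Lemma gauss_mean_cst (c : R) : gauss_mean (fun _ : 'cV[R]_n => c) = c.
Proof.
rewrite /gauss_mean Rintegral_cst// [X in fine X](_ : _ = 1%E) ?mulr1//.
exact: (@probability_setT _ _ _ (std_gaussian n)).
Qed.

Lemma gauss_meanD F G : poly_growth F -> poly_growth G ->
  gauss_mean (fun v => F v + G v) = gauss_mean F + gauss_mean G.
Proof. by move=> pF pG; apply: RintegralD => //; exact: poly_growth_integrable. Qed.

Lemma gauss_meanB F G : poly_growth F -> poly_growth G ->
  gauss_mean (fun v => F v - G v) = gauss_mean F - gauss_mean G.
Proof. by move=> pF pG; apply: RintegralB => //; exact: poly_growth_integrable. Qed.

Lemma gauss_meanZ (c : R) F : poly_growth F ->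
  gauss_mean (fun v => c * F v) = c * gauss_mean F.
Proof. by move=> pF; apply: RintegralZl => //; exact: poly_growth_integrable. Qed.

Lemma gauss_mean_sum (I : Type) (r : seq I) (P : pred I) (F : I -> 'cV[R]_n -> R) :
  (forall i, P i -> poly_growth (F i)) ->
  gauss_mean (fun v => \sum_(i <- r | P i) F i v) =
  \sum_(i <- r | P i) gauss_mean (F i).
Proof.
move=> pF; elim: r => [|a r IH].
  by under eq_gauss_mean do rewrite big_nil; rewrite big_nil gauss_mean_cst.
rewrite big_cons -IH; under eq_gauss_mean do rewrite big_cons.
case: (boolP (P a)) => // Pa.
by apply: gauss_meanD; [exact: pF|exact: poly_growth_sum].
Qed.

Lemma le_gauss_mean F G : poly_growth F -> poly_growth G ->
  (forall v, F v <= G v) -> gauss_mean F <= gauss_mean G.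
Proof. by move=> pF pG FG; apply: le_Rintegral => //; exact: poly_growth_integrable. Qed.

Lemma gauss_mean_ge0 F : (forall v, 0 <= F v) -> 0 <= gauss_mean F.
Proof. by move=> F0; apply: Rintegral_ge0. Qed.

Lemma normr_gauss_mean F : poly_growth F ->
  `|gauss_mean F| <= gauss_mean (fun v => `|F v|).
Proof. by move=> pF; apply: le_normr_Rintegral => //; exact: poly_growth_integrable. Qed.

End linear.

Section cons.
Context {n : nat}.
Variable F : 'cV[R]_n.+1 -> R.
Hypothesis pF : poly_growth F.

Let Fc (p : measurableTypeR R * 'cV[R]_n) := (F (cons_cV p))%:E.

Let mFc : measurable_fun setT Fc.
Proof.
have [mF _] := pF; apply/measurable_EFinP.
exact: (measurableT_comp mF (@measurable_cons_cV R n)).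
Qed.

Let iFc : (nu \x std_gaussian n)%E.-integrable setT Fc.
Proof.
apply/integrableP; split=> //.
have /integrableP[mF] := poly_growth_integrable pF.
rewrite [std_gaussian _]/= ge0_integral_distribution//.
exact: measurableT_comp.
Qed.

Lemma integral_std_gaussianS :
  (\int[std_gaussian n.+1]_v (F v)%:E =
   \int[nu]_a \int[std_gaussian n]_v (F (cons_cV (a, v)))%:E)%E.
Proof.
rewrite [std_gaussian n.+1]/= integral_distribution//.
- by rewrite -integral12_prod_meas1.
- by have [mF _] := pF; exact/measurable_EFinP.
Qed.

(** Both orders of integration are provided because Stein's identity needs the differentiated
    coordinate to be in the inner integral. *)
Lemma integral_std_gaussianS_swap :
  (\int[std_gaussian n.+1]_v (F v)%:E =
   \int[std_gaussian n]_v \int[nu]_a (F (cons_cV (a, v)))%:E)%E.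
Proof. by rewrite integral_std_gaussianS (Fubini iFc). Qed.

End cons.

Lemma cons_cV_shift0 n (a : R) (v : 'cV[R]_n) :
  cons_cV (a, v) = cons_cV (0, v) + a *: delta_mx ord0 ord0.
Proof.
apply/matrixP => i j; rewrite (ord1 j) [RHS]mxE [X in _ = _ + X]mxE [X in _ = _ + _ * X]mxE.
case: (unliftP ord0 i) => [k|] ->.
  by rewrite !cons_cVS/= mulr0 addr0.
by rewrite !cons_cV0/= mulr1 add0r.
Qed.

Lemma cons_cV_shiftS n (a t : R) (v : 'cV[R]_n) k :
  cons_cV (a, v + t *: delta_mx k ord0) =
  cons_cV (a, v) + t *: delta_mx (lift ord0 k) ord0.
Proof.
apply/matrixP => i j; rewrite (ord1 j) [RHS]mxE [X in _ = _ + X]mxE [X in _ = _ + _ * X]mxE.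
case: (unliftP ord0 i) => [l|] ->.
  by rewrite !cons_cVS/= !mxE eqxx !andbT -(inj_eq (@lift_inj _ ord0) l k).
by rewrite !cons_cV0/= mulr0 addr0.
Qed.

(** Induction on the dimension. For a later coordinate, freeze the first one and apply the induction
    hypothesis to the slice; for the first coordinate, integrate it innermost and apply
    [gauss_stein1]. *)
Theorem gauss_stein n (F G : 'cV[R]_n -> R) i :
  poly_growth F -> poly_growth G ->
  (forall v (t : R), is_derive t (1 : R) (fun s : R => F (v + s *: delta_mx i ord0))
     (G (v + t *: delta_mx i ord0))) ->
  (forall v, continuous (fun t : R => G (v + t *: delta_mx i ord0))) ->
  gauss_mean (fun v => F v * v i ord0) = gauss_mean G.
Proof.
move=> pF pG dF cG; apply: EFin_inj; rewrite -!gauss_meanE//; last first.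
  by apply: poly_growthM => //; exact: poly_growth_coord.
elim: n F G i pF pG dF cG => [|n IHn] F G i pF pG dF cG; first by case: (i).
have pFi : poly_growth (fun v : 'cV[R]_n.+1 => F v * v i ord0).
  by apply: poly_growthM => //; exact: poly_growth_coord.
move: pFi dF cG; case: (unliftP ord0 i) => [k|] -> pFi dF cG.
  rewrite !integral_std_gaussianS//; apply: eq_integral => a _.
  under eq_integral do rewrite cons_cVS/=.
  apply: (IHn (fun v => F (cons_cV (a, v))) (fun v => G (cons_cV (a, v))) k); try exact: poly_growth_tail.
  - move=> v t; have := dF (cons_cV (a, v)) t.
    by under eq_fun do rewrite -cons_cV_shiftS; rewrite -cons_cV_shiftS.
  - move=> v; have := cG (cons_cV (a, v)).
    by under eq_fun do rewrite -cons_cV_shiftS.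
rewrite !integral_std_gaussianS_swap//; apply: eq_integral => v _.
under eq_integral do rewrite cons_cV0/=.
have [_ [C [m [C0 hF]]]] := poly_growthW pF.
have [_ [D [k [D0 hG]]]] := poly_growthW pG.
(* [gauss_stein1] asks for one constant and one exponent valid for both functions, hence the sums
   [C + D] and [m + k]. *)
pose mk := (m + k)%N.
apply: (@gauss_stein1 _ (fun a => F (cons_cV (a, v))) (fun a => G (cons_cV (a, v)))
   ((C + D) * weight v ^+ mk) mk).
- move=> t; have := dF (cons_cV (0, v)) t; rewrite -cons_cV_shift0.
  by under eq_fun do rewrite -cons_cV_shift0.
- by have := cG (cons_cV (0, v)); under eq_fun do rewrite -cons_cV_shift0.
- move=> a; apply: le_trans (hF _ mk (leq_addr _ _)) _.
  rewrite weight_cons exprMn/= [X in _ * X]mulrC mulrA ler_wpM2r//.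
  by rewrite ler_wpM2r ?lerDl// exprn_ge0// ltW// weight_gt0.
- move=> a; apply: le_trans (hG _ mk (leq_addl _ _)) _.
  rewrite weight_cons exprMn/= [X in _ * X]mulrC mulrA ler_wpM2r//.
  by rewrite ler_wpM2r ?lerDr// exprn_ge0// ltW// weight_gt0.
Qed.

End gauss_expectation.

(** * Norms and Gaussian moments *)

Section frobenius.
Context {R : realType} {m n : nat}.
Implicit Types A B C : 'M[R]_(m, n).

(** The Frobenius product. It also serves for column vectors, so that one set of lemmas on sums of
    samples covers the gradient and the Hessian estimators. *)
Definition mdot A B : R := \sum_i \sum_j A i j * B i j.
Definition mnorm A : R := Num.sqrt (mdot A A).

Lemma mdotC A B : mdot A B = mdot B A.
Proof. by apply: eq_bigr => i _; apply: eq_bigr => j _; rewrite mulrC. Qed.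

Lemma mdotDl A B C : mdot (A + B) C = mdot A C + mdot B C.
Proof.
rewrite -big_split; apply: eq_bigr => i _; rewrite -big_split.
by apply: eq_bigr => j _ /=; rewrite mxE mulrDl.
Qed.

Lemma mdotZl a A B : mdot (a *: A) B = a * mdot A B.
Proof.
rewrite mulr_sumr; apply: eq_bigr => i _; rewrite mulr_sumr.
by apply: eq_bigr => j _; rewrite mxE mulrA.
Qed.

Lemma mdotDr A B C : mdot A (B + C) = mdot A B + mdot A C.
Proof. by rewrite mdotC mdotDl !(mdotC A). Qed.

Lemma mdotZr a A B : mdot A (a *: B) = a * mdot A B.
Proof. by rewrite mdotC mdotZl mdotC. Qed.

Lemma mdotNl A B : mdot (- A) B = - mdot A B.
Proof. by rewrite -scaleN1r mdotZl mulN1r. Qed.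

Lemma mdotNr A B : mdot A (- B) = - mdot A B.
Proof. by rewrite mdotC mdotNl mdotC. Qed.

Lemma mdot0l A : mdot 0 A = 0.
Proof. by rewrite -(scale0r A) mdotZl mul0r. Qed.

Lemma mdot_ge0 A : 0 <= mdot A A.
Proof. by apply: sumr_ge0 => i _; apply: sumr_ge0 => j _; rewrite -expr2 sqr_ge0. Qed.

Lemma mnorm_ge0 A : 0 <= mnorm A.
Proof. exact: sqrtr_ge0. Qed.

Lemma sqr_mnorm A : mnorm A ^+ 2 = mdot A A.
Proof. by rewrite sqr_sqrtr// mdot_ge0. Qed.

Lemma mdot_le A B : mdot A B <= mnorm A * mnorm B.
Proof.
have h (s t : R) : 0 <= s ^+ 2 * mdot A A - 2 * s * t * mdot A B + t ^+ 2 * mdot B B.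
  have := mdot_ge0 (s *: A - t *: B).
  rewrite mdotDl !mdotDr !mdotNl !mdotNr !mdotZl !mdotZr (mdotC B A); lra.
have := mnorm_ge0 A; have := mnorm_ge0 B.
(* These weights turn the square into [2 |A| |B| (|A| |B| - <A, B>)], which settles the claim unless
   a norm vanishes. *)
have := h (mnorm B) (mnorm A); rewrite -!sqr_mnorm.
set a := mnorm A; set b := mnorm B => h1 b0 a0.
have [ab0|ab0] := ltP 0 (a * b).
  have : 0 <= (a * b) * (a * b - mdot A B) by nra.
  by rewrite pmulr_rge0// subr_ge0.
have ab : a * b = 0 by apply/eqP; rewrite eq_le ab0 mulr_ge0.
rewrite ab; move/eqP: ab; rewrite mulf_eq0 => /orP[] /eqP e0.
- have /eqP := sqr_mnorm A; rewrite -/a e0 expr0n /= eq_sym => /eqP Z.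
  (* With [<A, A> = 0] these weights leave [- <A, B>^2 (2 + <B, B>) >= 0], which forces
     [<A, B> = 0]. *)
  have := h (1 + mdot B B) (mdot A B); rewrite Z => H.
  have : mdot A B ^+ 2 * (2 + mdot B B) <= 0 by lra.
  rewrite pmulr_lle0 ?ltr_wpDr ?mdot_ge0// => H2.
  by have := sqr_ge0 (mdot A B - 1); nra.
- have /eqP := sqr_mnorm B; rewrite -/b e0 expr0n /= eq_sym => /eqP Z.
  have := h (mdot A B) (1 + mdot A A); rewrite Z => H.
  have : mdot A B ^+ 2 * (2 + mdot A A) <= 0 by lra.
  rewrite pmulr_lle0 ?ltr_wpDr ?mdot_ge0// => H2.
  by have := sqr_ge0 (mdot A B - 1); nra.
Qed.

Lemma normr_mdot_le A B : `|mdot A B| <= mnorm A * mnorm B.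
Proof.
rewrite ler_norml mdot_le andbT lerNl -mdotNl.
apply: le_trans (mdot_le _ _) _.
by rewrite /mnorm mdotNl mdotNr opprK.
Qed.

Lemma mnormZ a A : mnorm (a *: A) = `|a| * mnorm A.
Proof. by rewrite /mnorm mdotZl mdotZr mulrA -expr2 sqrtrM ?sqr_ge0// sqrtr_sqr. Qed.

Lemma mnormN A : mnorm (- A) = mnorm A.
Proof. by rewrite -scaleN1r mnormZ normrN1 mul1r. Qed.

Lemma mnormD A B : mnorm (A + B) <= mnorm A + mnorm B.
Proof.
rewrite -[leRHS]ger0_norm ?addr_ge0 ?mnorm_ge0// -sqrtr_sqr ler_sqrt ?sqr_ge0//.
rewrite sqrrD !sqr_mnorm mdotDl !mdotDr (mdotC B A).
by have := mdot_le A B; lra.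
Qed.

Lemma mnorm0 : mnorm 0 = 0.
Proof. by rewrite /mnorm mdot0l sqrtr0. Qed.

Lemma normr_entry_le_mnorm A i j : `|A i j| <= mnorm A.
Proof.
rewrite -sqrtr_sqr ler_sqrt ?mdot_ge0// /mdot (bigD1 i)//= (bigD1 j)//= -expr2.
rewrite -addrA lerDl addr_ge0//.
  by apply: sumr_ge0 => k _; rewrite -expr2 sqr_ge0.
by apply: sumr_ge0 => k _; apply: sumr_ge0 => l _; rewrite -expr2 sqr_ge0.
Qed.

End frobenius.

Section euclid.
Context {R : realType} {d : nat}.
Implicit Types x y : 'cV[R]_d.

Lemma dotcvE x y : dotcv x y = mdot x y.
Proof. by apply: eq_bigr => i _; rewrite big_ord1. Qed.

Lemma enormE x : enorm x = mnorm x.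
Proof. by rewrite /enorm dotcvE. Qed.

Lemma mdot_delta x i : mdot x (delta_mx i ord0) = x i ord0.
Proof.
rewrite -dotcvE /dotcv (bigD1 i)//= mxE !eqxx mulr1 big1 ?addr0// => j ji.
by rewrite mxE (negbTE ji) mulr0.
Qed.

Lemma mdot_mulmx (A : 'M[R]_d) x : mdot (A *m x) x = mdot A (x *m x^T).
Proof.
rewrite -dotcvE; apply: eq_bigr => i _; rewrite mxE mulr_suml.
by apply: eq_bigr => j _; rewrite mxE big_ord1 mxE; ring.
Qed.

Lemma mdot_outer x y z t : mdot (x *m y^T) (z *m t^T) = mdot x z * mdot y t.
Proof.
rewrite -!dotcvE /dotcv mulr_suml; apply: eq_bigr => i _.
rewrite mulr_sumr; apply: eq_bigr => j _.
by rewrite !mxE !big_ord1 !mxE; ring.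
Qed.

(** Cauchy-Schwarz for [<A, x x^T>], since [x x^T] has Frobenius norm [|x|^2]. *)
Lemma mdot_mulmx_le (A : 'M[R]_d) x : mdot (A *m x) x <= mnorm A * mnorm x ^+ 2.
Proof.
rewrite mdot_mulmx; apply: le_trans (mdot_le _ _) _.
by rewrite {2}/mnorm mdot_outer -expr2 -sqr_mnorm sqrtr_sqr ger0_norm// sqr_ge0.
Qed.

Lemma measurable_mnorm m n : measurable_fun setT (@mnorm R m n).
Proof.
apply: measurableT_comp; first by apply: continuous_measurable_fun; exact: sqrt_continuous.
apply: measurable_sum => i; apply: measurable_sum => j.
by apply: measurable_funM; exact: measurable_matrix_entry.
Qed.

End euclid.

Section moments.
Context {R : realType} {n : nat}.
Implicit Types (F G : 'cV[R]_n -> R) (a v : 'cV[R]_n).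

Definition pderive i F G := forall v (t : R),
  is_derive t (1 : R) (fun s : R => F (v + s *: delta_mx i ord0))
    (G (v + t *: delta_mx i ord0)).

Lemma pderive_continuous i F G v : pderive i F G ->
  continuous (fun t : R => F (v + t *: delta_mx i ord0)).
Proof.
move=> dF t; apply/differentiable_continuous/derivable1_diffP.
by case: (dF v t).
Qed.

Lemma pderive_cst i (c : R) : pderive i (fun=> c) (fun=> 0).
Proof. by move=> v t; exact: is_derive_cst. Qed.

Lemma pderive_coord i j : pderive i (fun v => v j ord0) (fun=> (j == i)%:R).
Proof.
move=> v t.
have -> : (fun s : R => (v + s *: delta_mx i ord0) j ord0) =
    (fun s : R => v j ord0 + (j == i)%:R *: s).
  by apply/funext => s; rewrite !mxE eqxx andbT mulrC.
apply: is_derive_eq (is_deriveD (is_derive_cst _ _ _) (is_deriveZ _ (is_derive_id _ _))) _.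
by rewrite add0r /GRing.scale/= mulr1.
Qed.

Lemma pderiveM i F F' G G' : pderive i F F' -> pderive i G G' ->
  pderive i (fun v => F v * G v) (fun v => F v * G' v + G v * F' v).
Proof. by move=> dF dG v t; exact: is_deriveM. Qed.

Lemma pderive_sum i (F F' : 'I_n -> 'cV[R]_n -> R) :
  (forall j, pderive i (F j) (F' j)) ->
  pderive i (fun v => \sum_j F j v) (fun v => \sum_j F' j v).
Proof.
move=> dF v t.
have -> : (fun s : R => \sum_j F j (v + s *: delta_mx i ord0)) =
    \sum_j (fun s : R => F j (v + s *: delta_mx i ord0)).
  by apply/funext => s; rewrite fct_sumE.
by apply: is_derive_sum => j; exact: dF.
Qed.

Lemma pderiveX i F F' m : pderive i F F' ->
  pderive i (fun v => F v ^+ m) (fun v => m%:R * F v ^+ m.-1 * F' v).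
Proof.
move=> dF v t.
have -> : (fun s : R => F (v + s *: delta_mx i ord0) ^+ m) =
    (fun s : R => F (v + s *: delta_mx i ord0)) ^+ m.
  by apply/funext => s; rewrite exprfctE.
exact: (is_derive_eq (is_deriveX m (dF v t))).  
Qed.

Lemma pderive_sqnorm i : pderive i (fun v => mdot v v) (fun v => 2 * v i ord0).
Proof.
have -> : (fun v => mdot v v) = (fun v : 'cV[R]_n => \sum_j (v j ord0 * v j ord0)).
  by apply/funext => v; rewrite -dotcvE.
have -> : (fun v : 'cV[R]_n => 2 * v i ord0) =
    (fun v => \sum_j (v j ord0 * (j == i)%:R + v j ord0 * (j == i)%:R)).
  apply/funext => v; rewrite (bigD1 i)//= big1 ?addr0 ?eqxx /= => [|j /negbTE ->]; rewrite ?mulr0 ?mulr1 ?addr0 ?mulr_natl ?mulr2n //.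
by apply: pderive_sum => j; apply: pderiveM; exact: pderive_coord.
Qed.

Lemma pderive_mdot i a : pderive i (mdot a) (fun=> a i ord0).
Proof.
have -> : mdot a = (fun v : 'cV[R]_n => \sum_j (a j ord0 * v j ord0)).
  by apply/funext => v; rewrite -dotcvE.
have -> : (fun v : 'cV[R]_n => a i ord0) =
    (fun v => \sum_j (a j ord0 * (j == i)%:R + v j ord0 * 0)).
  apply/funext => v; rewrite (bigD1 i)//= big1 ?addr0 ?eqxx /= => [|j /negbTE ->]; rewrite ?mulr0 ?mulr1 ?addr0 ?mulr_natl ?mulr2n //.
by apply: pderive_sum => j; apply: pderiveM; [exact: pderive_cst|exact: pderive_coord].
Qed.

Lemma poly_growth_sqnorm : poly_growth (fun v : 'cV[R]_n => mdot v v).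
Proof.
have -> : (fun v => mdot v v) = (fun v : 'cV[R]_n => \sum_j (v j ord0 * v j ord0)).
  by apply/funext => v; rewrite -dotcvE.
by apply: poly_growth_sum => j _; apply: poly_growthM; exact: poly_growth_coord.
Qed.

Lemma poly_growth_mdot a : poly_growth (mdot a).
Proof.
have -> : mdot a = (fun v : 'cV[R]_n => \sum_j (a j ord0 * v j ord0)).
  by apply/funext => v; rewrite -dotcvE.
by apply: poly_growth_sum => j _; apply: poly_growthZ; exact: poly_growth_coord.
Qed.

Lemma poly_growth_mnorm : poly_growth (@mnorm R n 1).
Proof.
apply: (@poly_growth_le _ _ _ (fun v => 1 + mdot v v)).
- exact: measurable_mnorm.
- by apply: poly_growthD; [exact: poly_growth_cst|exact: poly_growth_sqnorm].
- move=> v; rewrite ger0_norm ?mnorm_ge0// -sqr_mnorm.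
  by have := sqr_ge0 (mnorm v - 1); have := mnorm_ge0 v; nra.
Qed.

Lemma gauss_mean_coord i : gauss_mean (fun v : 'cV[R]_n => v i ord0) = 0.
Proof.
rewrite -[RHS](gauss_mean_cst (n := n)).
rewrite -(gauss_stein (poly_growth_cst (1 : R)) (poly_growth_cst (0 : R)) (pderive_cst i 1)).
  by apply: eq_gauss_mean => v; rewrite mul1r.
by move=> v; exact: cst_continuous.
Qed.

Lemma gauss_mean_coordM i j :
  gauss_mean (fun v : 'cV[R]_n => v j ord0 * v i ord0) = (j == i)%:R.
Proof.
rewrite (gauss_stein (poly_growth_coord j) (poly_growth_cst _) (pderive_coord i j)).
  exact: gauss_mean_cst.
by move=> v; exact: cst_continuous.
Qed.

Lemma gauss_mean_mdot a : gauss_mean (mdot a) = 0.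
Proof.
have -> : mdot a = (fun v : 'cV[R]_n => \sum_j (a j ord0 * v j ord0)).
  by apply/funext => v; rewrite -dotcvE.
rewrite gauss_mean_sum => [|j _]; last by apply: poly_growthZ; exact: poly_growth_coord.
apply: big1 => j _; rewrite gauss_meanZ ?gauss_mean_coord ?mulr0//.
exact: poly_growth_coord.
Qed.

(** Stein's identity for each [F v_i], summed over [i]. When [F] is homogeneous, Euler's relation
    makes the last term a multiple of the mean of [F], which yields the moment formulas below. *)
Lemma gauss_stein_sum (F : 'cV[R]_n -> R) (G : 'I_n -> 'cV[R]_n -> R) :
  poly_growth F -> (forall i, poly_growth (G i)) ->
  (forall i, pderive i F (G i)) ->
  (forall i v, continuous (fun t : R => G i (v + t *: delta_mx i ord0))) ->
  gauss_mean (fun v => F v * mdot v v) =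
  n%:R * gauss_mean F + gauss_mean (fun v => \sum_i v i ord0 * G i v).
Proof.
move=> pF pG dF cG.
have pv i : poly_growth (fun v : 'cV[R]_n => v i ord0) by exact: poly_growth_coord.
have -> : (fun v => F v * mdot v v) =
    (fun v => \sum_i (F v * v i ord0) * v i ord0).
  apply/funext => v; rewrite -dotcvE /dotcv mulr_sumr.
  by apply: eq_bigr => i _; rewrite mulrA.
rewrite gauss_mean_sum => [|i _]; last by do 2 apply: poly_growthM => //.
rewrite gauss_mean_sum => [|i _]; last by apply: poly_growthM.
rewrite -[n in n%:R]card_ord mulr_natl -sumr_const -big_split/=.
apply: eq_bigr => i _.
have pFv : poly_growth (fun v : 'cV[R]_n => F v * v i ord0) by exact: poly_growthM.
have H := pderiveM (dF i) (pderive_coord i i).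
rewrite (gauss_stein pFv _ H).
- rewrite -gauss_meanD//; last exact: poly_growthM.
  by apply: eq_gauss_mean => v; rewrite eqxx mulr1.
- rewrite eqxx; apply: poly_growthD; apply: poly_growthM => //.
  exact: poly_growth_cst.
- move=> v t; apply: cvgD; apply: cvgM.
  + exact: pderive_continuous (dF i) t.
  + exact: cvg_cst.
  + exact: pderive_continuous (pderive_coord i i) t.
  + exact: cG.
Qed.

Lemma gauss_mean_sqmdot a : gauss_mean (fun v => mdot a v ^+ 2) = mdot a a.
Proof.
have pv i : poly_growth (fun v : 'cV[R]_n => v i ord0) by exact: poly_growth_coord.
have -> : (fun v => mdot a v ^+ 2) =
    (fun v : 'cV[R]_n => \sum_i a i ord0 * (mdot a v * v i ord0)).
  apply/funext => v; rewrite expr2 -[X in _ * X]dotcvE /dotcv mulr_sumr.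
  by apply: eq_bigr => i _; ring.
have pM i : poly_growth (fun v : 'cV[R]_n => mdot a v * v i ord0).
  by apply: poly_growthM => //; exact: poly_growth_mdot.
rewrite gauss_mean_sum => [|i _]; last exact: poly_growthZ.
rewrite -dotcvE; apply: eq_bigr => i _; rewrite gauss_meanZ//; congr (_ * _).
rewrite (gauss_stein (poly_growth_mdot a) (poly_growth_cst _) (pderive_mdot i a)).
  exact: gauss_mean_cst.
by move=> v; exact: cst_continuous.
Qed.

(** [gauss_stein_sum] for [<a, v>^2], whose degree of homogeneity is the 2 in [n + 2]. *)
Lemma gauss_mean_sqmdot_sqnorm a :
  gauss_mean (fun v => mdot a v ^+ 2 * mdot v v) = (n%:R + 2) * mdot a a.
Proof.
rewrite (@gauss_stein_sum _ (fun i v => 2%:R * mdot a v ^+ 1 * a i ord0)).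
- rewrite gauss_mean_sqmdot mulrDl; congr (_ + _).
  rewrite -gauss_mean_sqmdot -gauss_meanZ; last by apply: poly_growthX; exact: poly_growth_mdot.
  apply: eq_gauss_mean => v; rewrite expr2 -[X in _ = 2 * (_ * X)]dotcvE /dotcv.
  by rewrite [in RHS]mulr_sumr [in RHS]mulr_sumr; apply: eq_bigr => i _; rewrite expr1; ring.
- by apply: poly_growthX; exact: poly_growth_mdot.
- move=> i; apply: poly_growthM; last exact: poly_growth_cst.
  by apply: poly_growthZ; apply: poly_growthX; exact: poly_growth_mdot.
- by move=> i; apply: pderiveX; exact: pderive_mdot.
- move=> i v t; apply: cvgM; last exact: cvg_cst.
  by apply: cvgM; [exact: cvg_cst|exact: pderive_continuous (pderive_mdot i a) t].
Qed.

(** [|v|^(2m)] is homogeneous of degree [2m], hence the factor [n + 2m]. *)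
Lemma gauss_mean_sqnormS m :
  gauss_mean (fun v : 'cV[R]_n => mdot v v ^+ m.+1) =
  (n + 2 * m)%:R * gauss_mean (fun v : 'cV[R]_n => mdot v v ^+ m).
Proof.
have pm k : poly_growth (fun v : 'cV[R]_n => mdot v v ^+ k).
  by apply: poly_growthX; exact: poly_growth_sqnorm.
have dm k i := pderiveX k (pderive_sqnorm i).
under eq_gauss_mean do rewrite exprSr.
rewrite (gauss_stein_sum (pm m) _ (dm m)).
- rewrite natrD mulrDl; congr (_ + _); rewrite -gauss_meanZ//.
  apply: eq_gauss_mean => v; case: m => [|m].
    by rewrite muln0 mul0r big1// => i _; rewrite !mul0r mulr0.
  rewrite exprS -[X in _ = _ * (X * _)]dotcvE /dotcv mulr_suml mulr_sumr.
  by apply: eq_bigr => i _; rewrite natrM /=; ring.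
- move=> i; apply: poly_growthM; first exact: poly_growthZ.
  by apply: poly_growthZ; exact: poly_growth_coord.
- move=> i v t; apply: cvgM; apply: cvgM.
  + exact: cvg_cst.
  + exact: pderive_continuous (dm _ i) t.
  + exact: cvg_cst.
  + exact: pderive_continuous (pderive_coord i i) t.
Qed.

(** The moment is the product of [n + 2j] over [j < m], and its largest factor has [j = m - 1]. *)
Lemma gauss_mean_sqnorm_le m k : (2 * m.-1 <= k)%N ->
  gauss_mean (fun v : 'cV[R]_n => mdot v v ^+ m) <= (n + k)%:R ^+ m.
Proof.
elim: m => [|m IH] /= mk.
  by under eq_gauss_mean do rewrite expr0; rewrite gauss_mean_cst.
rewrite gauss_mean_sqnormS exprS ler_pM//.
- by apply: gauss_mean_ge0 => v; rewrite exprn_ge0// mdot_ge0.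
- by rewrite ler_nat leq_add2l.
- by apply: IH; apply: leq_trans mk; rewrite leq_mul2l leq_pred.
Qed.

End moments.

(** * Measurability of continuous functions and symmetry of the Gaussian *)

Section continuous_measurable.
Context {R : realType} {n : nat}.

(** The sigma-algebra is generated by the entries, so an open set is exhibited as the countable
    union of the rational boxes that it contains. *)
Lemma open_matrix_measurable (U : set 'cV[R]_n) : open U -> measurable U.
Proof.
move=> oU.
pose c (z : 'cV[rat]_n) : 'cV[R]_n := map_mx ratr z.
pose B (z : 'cV[rat]_n * nat) : set 'cV[R]_n :=
  [set v | forall i, ball (c z.1 i ord0) z.2.+1%:R^-1 (v i ord0)].
(* Boxes that do not fit in [U] are replaced by the empty set, so that the union runs over a fixed
   countable type. *)
pose F z : set 'cV[R]_n := if pselect (B z `<=` U) then B z else set0.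
have mB z : measurable (B z).
  rewrite (_ : B z = \bigcap_(i in [set: 'I_n])
      ((fun v : 'cV[R]_n => v i ord0) @^-1` ball (c z.1 i ord0) z.2.+1%:R^-1)); last first.
    apply/seteqP; split=> [v Bv i _|v Bv i]; [exact: Bv|exact: (Bv i)].
  apply: fin_bigcap_measurable => // i _.
  rewrite -[X in measurable X]setTI.
  by apply: measurable_matrix_entry => //; exact: measurable_ball.
have -> : U = \bigcup_z F z.
  apply/seteqP; split=> [v Uv|v [z _]]; last first.
    by rewrite /F; case: pselect => [BU /BU|_ []].
  have : nbhs v U by exact: open_nbhs_nbhs.
  move=> /nbhs_ballP[e /= e0 eU].
  (* Below [e / 2] because the box is centred at a rational point near [v], not at [v] itself: the
     triangle inequality adds two radii. *)
  have [N hN] : exists N : nat, N.+1%:R^-1 < e / 2.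
    have e20 : 0 < e / 2 by rewrite divr_gt0.
    exists (Num.truncn (e / 2)^-1); rewrite invf_plt ?posrE//.
    exact: truncnS_gt.
  have q i : {q : rat | ball (v i ord0) N.+1%:R^-1 (ratr q)}.
    apply: cid; have lt : v i ord0 - N.+1%:R^-1 < v i ord0 + N.+1%:R^-1.
      by rewrite ltrD2l (@lt_trans _ _ 0)// ?oppr_lt0 invr_gt0.
    have [q hq] := rat_in_itvoo lt; exists q.
    by rewrite ball_itv.
  exists (\col_i sval (q i), N) => //; rewrite /F; case: pselect => [BU|nBU].
    move=> i; rewrite /c !mxE; apply: ball_sym; exact: svalP (q i).
  exfalso; apply: nBU => w Bw; apply: eU; split=> // i j; rewrite (ord1 j).
  have := Bw i; rewrite /= /c !mxE => bw.
  have := svalP (q i) => bv.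
  by apply: le_ball (ball_triangle bv bw); move: hN; set r := _^-1 => hN; lra.
apply: countable_bigcupT_measurable; first exact: countableP.
move=> z.
by rewrite /F; case: pselect => ?; [exact: mB|exact: measurable0].
Qed.

Lemma continuous_matrix_measurable (F : 'cV[R]_n -> R) :
  continuous F -> measurable_fun setT F.
Proof.
move=> /continuousP cF; apply: (measurability _ (RGenOpens.measurableE R)).
move=> _ [_ [a [b ->] <-]]; rewrite setTI; apply: open_matrix_measurable.
exact/cF/interval_open.
Qed.

Lemma mnorm_le_entries (x : 'cV[R]_n) (e : R) : 0 <= e ->
  (forall i, `|x i ord0| <= e) -> mnorm x <= n%:R * e.
Proof.
move=> e0 h; rewrite -[leRHS]ger0_norm ?mulr_ge0// -sqrtr_sqr ler_sqrt ?sqr_ge0//.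
rewrite -dotcvE /dotcv; apply: (@le_trans _ _ (\sum_(i < n) e ^+ 2)).
  apply: ler_sum => i _; rewrite -expr2 -real_normK ?num_real//.
  by rewrite lerXn2r// nnegrE.
rewrite sumr_const card_ord -[_ *+ n]mulr_natl exprMn ler_wpM2r ?sqr_ge0//.
by rewrite -natrX ler_nat; case: (n) => // m; rewrite leq_pmulr.
Qed.

Lemma lipschitz_continuous (F : 'cV[R]_n -> R) (K : R) :
  (forall y z, `|F y - F z| <= K * mnorm (y - z)) -> continuous F.
Proof.
move=> h x; apply/(@cvgrPdist_le _ _ _ (nbhs x) (nbhs_filter x)) => e e0.
have K1 : 0 < `|K| * n%:R + 1 by rewrite ltr_wpDl// mulr_ge0.
apply/nbhs_ballP; exists (e / (`|K| * n%:R + 1)); first by rewrite /= divr_gt0.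
move=> y [r0 hy]; apply: le_trans (h _ _) _.
apply: (@le_trans _ _ (`|K| * (n%:R * (e / (`|K| * n%:R + 1))))).
  apply: le_trans (ler_wpM2r (mnorm_ge0 _) (ler_norm K)) _.
  apply: ler_wpM2l => //; apply: mnorm_le_entries; first exact: ltW.
  by move=> i; rewrite !mxE; have := hy i ord0; rewrite /ball/= => /ltW.
by rewrite !mulrA ler_pdivrMr//; nra.
Qed.

(** Induction on the dimension: the tail is negated by the induction hypothesis with the leading
    coordinate fixed, then the leading coordinate, integrated innermost, by
    [integral_normal_prob_sym]. *)
Lemma gauss_mean_sym (F : 'cV[R]_n -> R) : poly_growth F ->
  (forall i v, continuous (fun t : R => F (v + t *: delta_mx i ord0))) ->
  gauss_mean (fun v => F (- v)) = gauss_mean F.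
Proof.
have negE m (G : 'cV[R]_m -> R) : poly_growth G -> poly_growth (fun v => G (- v)).
  move=> /(poly_growth_affine 0 (-1)) pG.
  by under eq_fun do rewrite -scaleN1r -[_ *: _]add0r.
move=> pF cF; apply: EFin_inj; rewrite -!gauss_meanE//; last exact: negE.
elim: n F pF cF => [|m IH] F pF cF.
  by apply: eq_integral => v _; congr (F _)%:E; apply/matrixP => -[].
rewrite integral_std_gaussianS; last exact: negE.
have NE a (v : 'cV[R]_m) : - cons_cV (a, v) = cons_cV (- a, - v).
  apply/matrixP => i j; rewrite (ord1 j) [LHS]mxE; case: (unliftP ord0 i) => [k|] ->.
    by rewrite !cons_cVS/= mxE.
  by rewrite !cons_cV0.
(* Reflection of the leading coordinate alone, the halfway stage between [F (- w)] and [F w]. *)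
pose flip (w : 'cV[R]_m.+1) := w - (2 * w ord0 ord0) *: delta_mx ord0 ord0.
have flipE a (v : 'cV[R]_m) : flip (cons_cV (a, v)) = cons_cV (- a, v).
  rewrite /flip cons_cV0 (cons_cV_shift0 a) (cons_cV_shift0 (- a)) -addrA -scalerBl /=.
  by congr (_ + _ *: _); lra.
have pG : poly_growth (fun w => F (flip w)).
  have [mF [C [k hF]]] := pF; split.
    apply: measurableT_comp => //; apply/measurable_fun_matrixP => i j; rewrite (ord1 j).
    under eq_fun do rewrite /flip !mxE; apply: measurable_funB.
      exact: measurable_matrix_entry.
    by do 2 (apply: measurable_funM => //); exact: measurable_matrix_entry.
  exists C, k => w; apply: le_trans (hF _) _; rewrite le_eqVlt; apply/orP; left; apply/eqP.
  congr (_ * _ ^+ _); apply: eq_bigr => i _; congr (1 + _).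
  rewrite !mxE eqxx andbT; case: eqP => [->|_]; last by rewrite mulr0 subr0.
  by rewrite mulr1 (_ : _ - _ = - w ord0 ord0) ?normrN//; lra.
transitivity (\int[std_gaussian m.+1]_w (F (flip w))%:E)%E.
  rewrite integral_std_gaussianS//; apply: eq_integral => a _.
  under eq_integral do rewrite NE.
  under [RHS]eq_integral do rewrite flipE.
  apply: (IH (fun v => F (cons_cV (- a, v)))); first exact: poly_growth_tail.
  move=> i v; have := cF (lift ord0 i) (cons_cV (- a, v)).
  by under eq_fun do rewrite -cons_cV_shiftS.
rewrite !integral_std_gaussianS_swap//; apply: eq_integral => v _.
under eq_integral do rewrite flipE.
have [_ [C [k [C0 hF]]]] := poly_growthW pF.
apply: (@integral_normal_prob_sym _ (fun a => F (cons_cV (a, v))) (C * weight v ^+ k) k).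
  by have := cF ord0 (cons_cV (0, v)); under eq_fun do rewrite -cons_cV_shift0.
move=> a; apply: le_trans (hF _ k (leqnn _)) _.
by rewrite weight_cons exprMn/= [X in _ * X]mulrC mulrA.
Qed.

End continuous_measurable.

(** * Calculus in one real variable *)

Section real_calculus.
Context {R : realType}.
Implicit Types phi dphi : R -> R.

(** A quadratic remainder bound survives averaging, so this criterion gives derivatives of Gaussian
    means without a passage to the limit under the integral. *)
Lemma is_derive_quadratic_remainder phi (t g C : R) :
  (forall h, `|phi (t + h) - phi t - h * g| <= C * h ^+ 2) ->
  is_derive t (1 : R) phi g.
Proof.
move=> H.
have cv : (fun h : R => h^-1 *: ((phi \o shift t) (h *: (1 : R)) - phi t)) @ 0^' --> g.
  apply/cvgrPdist_le => e e0.
  have C1 : 0 < `|C| + 1 by rewrite ltr_wpDl.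
  near=> h.
  have h0 : h != 0 by near: h; exact: nbhs_dnbhs_neq.
  have he : `|h| <= e / (`|C| + 1).
    near: h; apply: dnbhs0_le; exact: divr_gt0.
  rewrite distrC /GRing.scale/= mulr1 (addrC h).
  have -> : h^-1 * (phi (t + h) - phi t) - g = h^-1 * (phi (t + h) - phi t - h * g).
    by field.
  rewrite normrM normfV ler_pdivrMl ?normr_gt0//.
  apply: le_trans (H h) _; rewrite -(real_normK (num_real h)) expr2 mulrCA.
  rewrite ler_wpM2l//; apply: le_trans (ler_wpM2r (normr_ge0 h) (ler_norm C)) _.
  move: he; rewrite ler_pdivlMr//.
  by have := normr_ge0 h; nra.
apply: DeriveDef; first by apply/cvg_ex; exists g.
exact/cvg_lim.
Unshelve. all: by end_near. Qed.

(** Mean value theorem for [phi - q], where [q] is a primitive of the quadratic bound; it takes the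
    place of integrating [dphi]. *)
Lemma derive_le_increment phi dphi (c0 c1 c2 : R) :
  (forall t, is_derive t (1 : R) phi (dphi t)) ->
  (forall t, 0 < t < 1 -> dphi t <= c0 + c1 * t + c2 * t ^+ 2) ->
  phi 1 - phi 0 <= c0 + c1 / 2 + c2 / 3.
Proof.
move=> dphiE dphi_le.
pose q (t : R) := c0 * t + (c1 / 2) * t ^+ 2 + (c2 / 3) * t ^+ 3.
have dq (t : R) : is_derive t (1 : R) q (c0 + c1 * t + c2 * t ^+ 2).
  have e1 := is_deriveZ c0 (is_derive_id t (1 : R)).
  have e2 := is_deriveZ (c1 / 2) (is_deriveX 2 (is_derive_id t (1 : R))).
  have e3 := is_deriveZ (c2 / 3) (is_deriveX 3 (is_derive_id t (1 : R))).
  apply: (is_derive_eq (is_deriveD (is_deriveD e1 e2) e3)).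
  rewrite /GRing.scale/= !mulr1 expr1; lra.
have dpsi (t : R) : is_derive t (1 : R) (phi - q) (dphi t - (c0 + c1 * t + c2 * t ^+ 2)).
  exact: is_deriveB.
have [t] := @MVT _ (phi - q) (fun t => dphi t - (c0 + c1 * t + c2 * t ^+ 2)) 0 1
  ltr01 (fun t _ => dpsi t) (derivable_within_continuous (fun t _ => @ex_derive _ _ _ _ _ _ _ (dpsi t))).
rewrite in_itv/= subr0 mulr1 => /dphi_le.
rewrite !fctE /q; lra.
Qed.

End real_calculus.

(** * Gaussian smoothing *)

Section lipschitz_gradient.
Context {R : realType} {d : nat}.
Variables (f : 'cV[R]_d -> R) (L : R).
Hypothesis df : forall y, differentiable f y.
Hypothesis gradL : forall y z, mnorm (gradient f y - gradient f z) <= L * mnorm (y - z).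
Implicit Types x y z h s : 'cV[R]_d.

Lemma derive_gradient y h : 'D_h f y = mdot (gradient f y) h.
Proof.
rewrite deriveE// [in LHS](_ : h = \sum_i h i ord0 *: delta_mx i ord0); last first.
  apply/matrixP => i j; rewrite (ord1 j) summxE (bigD1 i)//= big1 ?addr0.
    by rewrite !mxE !eqxx mulr1.
  by move=> k ki; rewrite !mxE eq_sym (negbTE ki) mulr0.
rewrite linear_sum -dotcvE; apply: eq_bigr => i _.
by rewrite linearZ /= mxE deriveE// mulrC.
Qed.

Lemma is_derive_line y h (t : R) :
  is_derive t (1 : R) (fun s : R => f (y + s *: h)) (mdot (gradient f (y + t *: h)) h).
Proof.
have E : (fun k : R => k^-1 *: (((fun s : R => f (y + s *: h)) \o shift t) (k *: (1 : R)) -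
      f (y + t *: h))) =
    (fun k : R => k^-1 *: ((f \o shift (y + t *: h)) (k *: h) - f (y + t *: h))).
  apply/funext => k /=; congr (_ *: (f _ - _)).
  by rewrite [k *: (1 : R)](mulr1 k) scalerDl addrCA addrC.
apply: DeriveDef.
- by rewrite /derivable E; exact: diff_derivable.
- by rewrite /derive E -/(derive f (y + t *: h) h) derive_gradient.
Qed.

(** Along the segment the slope departs from its initial value by at most [L |h|^2 t], and [t]
    integrates to 1/2. [derive_le_increment] is applied to the function and to its negative. *)
Lemma descent y h :
  `|f (y + h) - f y - mdot (gradient f y) h| <= L / 2 * mnorm h ^+ 2.
Proof.
have D t := is_derive_line y h t.
have grad_le (t : R) : 0 < t < 1 ->
    `|mdot (gradient f (y + t *: h)) h - mdot (gradient f y) h| <= L * mnorm h ^+ 2 * t.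
  move=> /andP[t0 _]; rewrite -mdotNl -mdotDl.
  apply: le_trans (normr_mdot_le _ _) _.
  apply: le_trans (ler_wpM2r (mnorm_ge0 _) (gradL _ _)) _.
  rewrite addrAC subrr add0r mnormZ gtr0_norm// le_eqVlt; apply/orP; left.
  by apply/eqP; ring.
have up := @derive_le_increment _ _ _ (mdot (gradient f y) h) (L * mnorm h ^+ 2) 0 D.
have dn := @derive_le_increment _ _ _ (- mdot (gradient f y) h) (L * mnorm h ^+ 2) 0
   (fun t => is_deriveN (D t)).
rewrite ler_norml; apply/andP; split.
  have {dn} : - f (y + h) - - f y <= - mdot (gradient f y) h + L * mnorm h ^+ 2 / 2 + 0 / 3.
    have := dn; rewrite /= !fctE scale1r scale0r addr0; apply => t /grad_le.
    by rewrite ler_norml => /andP[+ _]; lra.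
  lra.
have {up} : f (y + h) - f y <= mdot (gradient f y) h + L * mnorm h ^+ 2 / 2 + 0 / 3.
  have := up; rewrite /= scale1r scale0r addr0; apply => t /grad_le.
  by rewrite ler_norml => /andP[_]; lra.
lra.
Qed.

Lemma gradient_entry_lipschitz i y z :
  `|gradient f y i ord0 - gradient f z i ord0| <= L * mnorm (y - z).
Proof.
apply: le_trans (gradL y z).
by have := normr_entry_le_mnorm (gradient f y - gradient f z) i ord0; rewrite !mxE.
Qed.

Lemma gradient_entry_continuous i : continuous (fun y => gradient f y i ord0).
Proof. by apply: lipschitz_continuous => y z; exact: gradient_entry_lipschitz. Qed.

Lemma poly_growth_gradient_entry i : poly_growth (fun y => gradient f y i ord0).
Proof.
apply: (@poly_growth_le _ _ _ (fun y => `|gradient f 0 i ord0| + L * mnorm y)).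
- by apply: continuous_matrix_measurable; exact: gradient_entry_continuous.
- apply: poly_growthD; first exact: poly_growth_cst.
  by apply: poly_growthZ; exact: poly_growth_mnorm.
- move=> y; have := gradient_entry_lipschitz i y 0; rewrite subr0.
  have := ler_normD (gradient f y i ord0 - gradient f 0 i ord0) (gradient f 0 i ord0).
  by rewrite subrK; lra.
Qed.

Lemma continuous_f : continuous f.
Proof. by move=> y; exact: differentiable_continuous. Qed.

Lemma poly_growth_f : poly_growth f.
Proof.
apply: (@poly_growth_le _ _ _
  (fun y => `|f 0| + (`|mdot (gradient f 0) y| + L / 2 * mdot y y))).
- by apply: continuous_matrix_measurable; exact: continuous_f.
- apply: poly_growthD; first exact: poly_growth_cst.
  apply: poly_growthD.
    by apply: poly_growth_norm; exact: poly_growth_mdot.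
  by apply: poly_growthZ; exact: poly_growth_sqnorm.
- move=> y; have := descent 0 y; rewrite add0r sqr_mnorm => H.
  have := ler_normD (f y - f 0 - mdot (gradient f 0) y) (mdot (gradient f 0) y).
  have := ler_normD (f y - f 0) (f 0).
  by rewrite !subrK; lra.
Qed.

Lemma continuous_line (F : 'cV[R]_d -> R) y h :
  continuous F -> continuous (fun t : R => F (y + t *: h)).
Proof.
move=> cF t; apply: continuous_comp; last exact: cF.
apply: cvgD; first exact: cvg_cst.
by apply: cvgZl; exact: cvg_id.
Qed.

Section smoothing.
Variables (x : 'cV[R]_d) (sigma : R).

Notation gradi i := (fun u => gradient f (x + sigma *: u) i ord0).

Lemma pderive_smooth i :
  pderive i (fun u => f (x + sigma *: u)) (fun u => sigma * gradi i u).
Proof.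
move=> v t.
have := is_derive_line (x + sigma *: v) (sigma *: delta_mx i ord0) t.
rewrite mdotZr mdot_delta.
have E (s : R) : x + sigma *: v + s *: (sigma *: delta_mx i ord0) =
    x + sigma *: (v + s *: delta_mx i ord0).
  by rewrite scalerDr !scalerA addrA (mulrC s).
by under eq_fun do rewrite E; rewrite E.
Qed.

Lemma continuous_smooth i v :
  continuous (fun t : R => gradi i (v + t *: delta_mx i ord0)).
Proof.
have E (s : R) : x + sigma *: (v + s *: delta_mx i ord0) =
    x + sigma *: v + s *: (sigma *: delta_mx i ord0).
  by rewrite scalerDr !scalerA addrA (mulrC s).
under eq_fun do rewrite E.
apply: (continuous_line (F := fun y => gradient f y i ord0)).
exact: gradient_entry_continuous.
Qed.

Lemma poly_growth_smooth : poly_growth (fun u => f (x + sigma *: u)).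
Proof. exact: (poly_growth_affine _ _ poly_growth_f). Qed.

Lemma poly_growth_gradi i : poly_growth (gradi i).
Proof. exact: (poly_growth_affine _ _ (poly_growth_gradient_entry i)). Qed.

Lemma stein_gradient i :
  gauss_mean (fun u => f (x + sigma *: u) * u i ord0) = sigma * gauss_mean (gradi i).
Proof.
rewrite -gauss_meanZ; last exact: poly_growth_gradi.
apply: gauss_stein (pderive_smooth i) _.
- exact: poly_growth_smooth.
- by apply: poly_growthZ; exact: poly_growth_gradi.
- by move=> v t; apply: cvgM; [exact: cvg_cst|exact: continuous_smooth].
Qed.

(** Stein's identity in coordinate [i] for [f (x + sigma u) u_j]: differentiating [u_j] produces
    exactly the Kronecker term subtracted on the left. *)
Lemma stein_hessian i j :
  gauss_mean (fun u => f (x + sigma *: u) * (u i ord0 * u j ord0 - (i == j)%:R)) =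
  sigma * gauss_mean (fun u => gradi i u * u j ord0).
Proof.
have pf := poly_growth_smooth; have pg := poly_growth_gradi i.
have pu k : poly_growth (fun u : 'cV[R]_d => u k ord0) by exact: poly_growth_coord.
have H := pderiveM (pderive_smooth i) (pderive_coord i j).
have -> : gauss_mean (fun u => f (x + sigma *: u) * (u i ord0 * u j ord0 - (i == j)%:R)) =
  gauss_mean (fun u => (f (x + sigma *: u) * u j ord0) * u i ord0) -
  gauss_mean (fun u => f (x + sigma *: u) * (j == i)%:R).
  rewrite -gauss_meanB.
  - by apply: eq_gauss_mean => u; rewrite (eq_sym j); ring.
  - by do 2 apply: poly_growthM => //.
  - by apply: poly_growthM => //; exact: poly_growth_cst.
have pcst : poly_growth (fun u => f (x + sigma *: u) * (j == i)%:R).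
  by apply: poly_growthM => //; exact: poly_growth_cst.
have pgu : poly_growth (fun u => u j ord0 * (sigma * gradi i u)).
  by apply: poly_growthM => //; exact: poly_growthZ.
rewrite (gauss_stein _ _ H).
- rewrite gauss_meanD// addrAC subrr add0r -gauss_meanZ; last exact: poly_growthM.
  by apply: eq_gauss_mean => u; ring.
- exact: poly_growthM.
- exact: poly_growthD.
- move=> v t; apply: cvgD; apply: cvgM.
  + exact: pderive_continuous (pderive_smooth i) t.
  + exact: cvg_cst.
  + exact: pderive_continuous (pderive_coord i j) t.
  + by apply: cvgM; [exact: cvg_cst|exact: continuous_smooth].
Qed.

End smoothing.

End lipschitz_gradient.

Section gaussian_smoothing.
Context {R : realType} {d : nat}.
Variables (f : 'cV[R]_d -> R) (L : R).
Hypothesis L0 : 0 <= L.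
Hypothesis df : forall y, differentiable f y.
Hypothesis gradL : forall y z, mnorm (gradient f y - gradient f z) <= L * mnorm (y - z).
Implicit Types x y z h s u : 'cV[R]_d.

Definition smooth (sigma : R) x : R := gauss_mean (fun u => f (x + sigma *: u)).

Definition smooth_grad (sigma : R) x : 'cV[R]_d :=
  \col_i gauss_mean (fun u => gradient f (x + sigma *: u) i ord0).

(** The Hessian of [smooth sigma], although [f] may have no second derivatives: integration by parts
    has traded one derivative for the factor [u_j / sigma]. *)
Definition smooth_hess (sigma : R) x : 'M[R]_d :=
  \matrix_(i, j) (sigma^-1 * gauss_mean (fun u => gradient f (x + sigma *: u) i ord0 * u j ord0)).

Definition grad_sample (sigma : R) x u : 'cV[R]_d :=
  ((f (x + sigma *: u) - f x) / sigma) *: u.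

Definition hess_sample (sigma : R) x u : 'M[R]_d :=
  ((f (x + sigma *: u) + f (x - sigma *: u) - 2 * f x) / (2 * sigma ^+ 2))
    *: (u *m u^T - 1%:M).

Let pf x (c : R) : poly_growth (fun u => f (x + c *: u)) := poly_growth_smooth df gradL x c.
Let pg x (c : R) i : poly_growth (fun u => gradient f (x + c *: u) i ord0) :=
  poly_growth_gradi gradL x c i.
Let pu i : poly_growth (fun u => u i ord0) := poly_growth_coord i.
Let psq : poly_growth (fun u => mdot u u) := @poly_growth_sqnorm R d.
Let pcst (c : R) : poly_growth (fun _ : 'cV[R]_d => c) := poly_growth_cst c.

Lemma poly_growth_mdot_gradient x (c b : R) s :
  poly_growth (fun u => mdot (gradient f (x + c *: u)) (s + b *: u)).
Proof.
have -> : (fun u => mdot (gradient f (x + c *: u)) (s + b *: u)) =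
    (fun u => \sum_i (gradient f (x + c *: u) i ord0 * (s i ord0 + b * u i ord0))).
  apply/funext => u; rewrite -dotcvE; apply: eq_bigr => i _.
  by rewrite !mxE.
apply: poly_growth_sum => i _; apply: poly_growthM => //.
by apply: poly_growthD => //; exact: poly_growthZ.
Qed.

Lemma poly_growth_sqnorm_affine (b : R) s :
  poly_growth (fun u => mdot (s + b *: u) (s + b *: u)).
Proof. exact: (poly_growth_affine s b psq). Qed.

Lemma lineE x s u (a b t : R) :
  x + a *: u + t *: (s + b *: u) = (x + t *: s) + (a + t * b) *: u.
Proof. by rewrite scalerDr scalerA scalerDl addrACA. Qed.

(** The centre moves along [s] while the radius moves at rate [b]: [s = 0] serves [smooth_decr] and
    [b = 0] serves [smooth_taylor]. The quadratic remainder is the average of [descent]. *)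
Lemma is_derive_smooth_line x s (a b t : R) :
  is_derive t (1 : R) (fun t => smooth (a + t * b) (x + t *: s))
   (gauss_mean (fun u => mdot (gradient f (x + t *: s + (a + t * b) *: u)) (s + b *: u))).
Proof.
have psb := poly_growth_sqnorm_affine b s.
apply: (@is_derive_quadratic_remainder _ _ _ _
  (L / 2 * gauss_mean (fun u => mdot (s + b *: u) (s + b *: u)))) => h.
rewrite /smooth -gauss_meanZ; last exact: poly_growth_mdot_gradient.
rewrite -!gauss_meanB//; last 2 first.
- exact: poly_growthB.
- by apply: poly_growthZ; exact: poly_growth_mdot_gradient.
apply: le_trans (normr_gauss_mean _) _.
  apply: poly_growthB; first exact: poly_growthB.
  by apply: poly_growthZ; exact: poly_growth_mdot_gradient.
rewrite mulrAC -gauss_meanZ//; apply: le_gauss_mean.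
- apply: poly_growth_norm; apply: poly_growthB; first exact: poly_growthB.
  by apply: poly_growthZ; exact: poly_growth_mdot_gradient.
- exact: poly_growthZ.
- move=> u; rewrite -!lineE (scalerDl _ t h) addrA.
  have := descent df gradL (x + a *: u + t *: (s + b *: u)) (h *: (s + b *: u)).
  by rewrite mdotZr mnormZ exprMn real_normK ?num_real// sqr_mnorm mulrA.
Qed.

(** Average [|t| <= t^2 / (2 |s|) + |s| / 2] at [t = <s, u>], whose second moment is [|s|^2]; the
    division sets [s = 0] apart. *)
Lemma gauss_mean_normr_mdot s : gauss_mean (fun u => `|mdot s u|) <= mnorm s.
Proof.
have ps := poly_growth_mdot s.
have [s0|s0] := leP (mnorm s) 0.
  have -> : s = 0.
    have s00 : mnorm s = 0 by apply/eqP; rewrite eq_le s0 mnorm_ge0.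
    apply/matrixP => i j; rewrite mxE; apply/eqP; rewrite -normr_eq0.
    by have := normr_entry_le_mnorm s i j; rewrite s00 eq_le normr_ge0 => ->.
  by rewrite mnorm0; under eq_gauss_mean do rewrite mdot0l normr0; rewrite gauss_mean_cst.
apply: (@le_trans _ _ (gauss_mean (fun u => (2 * mnorm s)^-1 * mdot s u ^+ 2 + mnorm s / 2))).
  apply: le_gauss_mean; first exact: poly_growth_norm.
    by apply: poly_growthD => //; apply: poly_growthZ; exact: poly_growthX.
  move=> u; rewrite -[mdot s u ^+ 2]real_normK ?num_real//.
  rewrite -subr_ge0 (_ : _ - _ = (2 * mnorm s)^-1 * (`|mdot s u| - mnorm s) ^+ 2).
    by rewrite mulr_ge0 ?sqr_ge0// invr_ge0 mulr_ge0// ltW.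
  by field; rewrite gt_eqF.
rewrite gauss_meanD//; last by apply: poly_growthZ; exact: poly_growthX.
rewrite gauss_mean_cst gauss_meanZ; last exact: poly_growthX.
rewrite gauss_mean_sqmdot -sqr_mnorm le_eqVlt; apply/orP; left; apply/eqP.
by field; rewrite gt_eqF.
Qed.

Lemma gauss_mean_sqnorm : gauss_mean (fun u => mdot u u) = d%:R :> R.
Proof.
under eq_gauss_mean do rewrite -[mdot _ _]expr1.
rewrite gauss_mean_sqnormS muln0 addn0.
by under eq_gauss_mean do rewrite expr0; rewrite gauss_mean_cst mulr1.
Qed.

(* Differentiating in sigma, with [E <grad f y, u> = 0]. *)
Lemma smooth_decr (a c : R) y : 0 <= a -> a <= c ->
  smooth a y <= smooth c y + L * d%:R / 2 * (c ^+ 2 - a ^+ 2).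
Proof.
move=> a0 ac; pose b := c - a; have b0 : 0 <= b by rewrite subr_ge0.
have D t := is_deriveN (is_derive_smooth_line y 0 a b t).
have := @derive_le_increment _ _ _ (b * L * a * d%:R) (b ^+ 2 * L * d%:R) 0 D.
rewrite !fctE !scaler0 !addr0 mul0r mul1r (addr0 a) (_ : a + b = c); last by rewrite /b; ring.
have H : (forall t : R, 0 < t < 1 -> - gauss_mean (fun u =>
    mdot (gradient f (y + t *: 0 + (a + t * b) *: u)) (0 + b *: u)) <=
      b * L * a * d%:R + b ^+ 2 * L * d%:R * t + 0 * t ^+ 2).
  move=> t /andP[t0 _]; rewrite mul0r addr0 scaler0 addr0.
  set e := a + t * b; have e0 : 0 <= e by rewrite addr_ge0// mulr_ge0// ltW.
  have pmg : poly_growth (fun u => mdot (gradient f (y + e *: u)) (0 + b *: u)).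
    exact: poly_growth_mdot_gradient.
  have pmy : poly_growth (fun u => b * mdot (gradient f y) u).
    by apply: poly_growthZ; exact: poly_growth_mdot.
  have -> : b * L * a * d%:R + b ^+ 2 * L * d%:R * t =
      gauss_mean (fun u => (b * L * e) * mdot u u - b * mdot (gradient f y) u).
    rewrite gauss_meanB//; last exact: poly_growthZ.
    rewrite !gauss_meanZ//; last exact: poly_growth_mdot.
    by rewrite gauss_mean_mdot gauss_mean_sqnorm /e; ring.
  rewrite -[X in X <= _]mulN1r -gauss_meanZ//; apply: le_gauss_mean.
  - exact: poly_growthZ.
  - by apply: poly_growthB => //; exact: poly_growthZ.
  move=> u; rewrite add0r mdotZr mulN1r -mulrN.
  rewrite [leRHS](_ : _ = b * (L * e * mdot u u - mdot (gradient f y) u)); last by ring.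
  apply: ler_wpM2l => //.
  have := normr_mdot_le (gradient f (y + e *: u) - gradient f y) u.
  have := ler_wpM2r (mnorm_ge0 u) (gradL (y + e *: u) y).
  rewrite addrAC subrr add0r mnormZ ger0_norm// mdotDl mdotNl -sqr_mnorm.
  by rewrite ler_norml => h1 /andP[h2 _]; lra.
by move=> /(_ H); rewrite /b; lra.
Qed.

Lemma smooth_grad_mdot (c : R) x s :
  gauss_mean (fun u => mdot (gradient f (x + c *: u)) s) = mdot (smooth_grad c x) s.
Proof.
have -> : (fun u => mdot (gradient f (x + c *: u)) s) =
    (fun u => \sum_i s i ord0 * gradient f (x + c *: u) i ord0).
  by apply/funext => u; rewrite mdotC -dotcvE.
rewrite gauss_mean_sum => [|i _]; last exact: poly_growthZ.
rewrite mdotC -dotcvE; apply: eq_bigr => i _.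
by rewrite gauss_meanZ// [smooth_grad _ _ _ _]mxE.
Qed.

Lemma stein_smooth_grad (c : R) x s :
  gauss_mean (fun u => f (x + c *: u) * mdot s u) = c * mdot (smooth_grad c x) s.
Proof.
have -> : (fun u => f (x + c *: u) * mdot s u) =
    (fun u => \sum_i s i ord0 * (f (x + c *: u) * u i ord0)).
  apply/funext => u; rewrite -dotcvE mulr_sumr.
  by apply: eq_bigr => i _; rewrite mulrCA.
rewrite gauss_mean_sum => [|i _]; last by apply: poly_growthZ; exact: poly_growthM.
rewrite mdotC -dotcvE mulr_sumr; apply: eq_bigr => i _.
rewrite gauss_meanZ; last exact: poly_growthM.
by rewrite (stein_gradient df gradL) [smooth_grad _ _ _ _]mxE; ring.
Qed.

Lemma smooth_hess_mdot (c : R) x s : c != 0 ->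
  gauss_mean (fun u => mdot (gradient f (x + c *: u)) s * mdot s u) =
  c * mdot (smooth_hess c x *m s) s.
Proof.
move=> c0.
have -> : (fun u => mdot (gradient f (x + c *: u)) s * mdot s u) =
    (fun u => \sum_i \sum_j (s i ord0 * s j ord0) *
      (gradient f (x + c *: u) i ord0 * u j ord0)).
  apply/funext => u; rewrite -!dotcvE mulr_suml; apply: eq_bigr => i _.
  by rewrite mulr_sumr; apply: eq_bigr => j _; ring.
have pgu i j : poly_growth (fun u => gradient f (x + c *: u) i ord0 * u j ord0).
  exact: poly_growthM.
rewrite gauss_mean_sum => [|i _]; last first.
  by apply: poly_growth_sum => j _; exact: poly_growthZ.
rewrite -dotcvE mulr_sumr; apply: eq_bigr => i _.
rewrite gauss_mean_sum => [|j _]; last exact: poly_growthZ.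
rewrite [(_ *m _) _ _]mxE mulr_suml mulr_sumr; apply: eq_bigr => j _.
by rewrite gauss_meanZ// [smooth_hess _ _ _ _]mxE; field.
Qed.

(** Stein's identity writes [c] times the deviation of the slope at [x + t s] from its linear part
    as the mean of a first-order remainder of [f] times [<s, u>]. The remainder is at most
    [L t^2 |s|^2 / 2] by [descent], and [|<s, u>|] has mean at most [|s|], so no dimension appears;
    the 6 comes from integrating [t^2 / 2]. *)
Lemma smooth_taylor (c : R) x s : 0 < c ->
  smooth c (x + s) <= smooth c x + mdot (smooth_grad c x) s +
    1 / 2 * mdot (smooth_hess c x *m s) s + L / (6 * c) * mnorm s ^+ 3.
Proof.
move=> c0; have cn0 : c != 0 by rewrite gt_eqF.
have D t := is_derive_smooth_line x s c 0 t.
have := @derive_le_increment _ _ _ (mdot (smooth_grad c x) s)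
  (mdot (smooth_hess c x *m s) s) (L / (2 * c) * mnorm s ^+ 3) D.
rewrite !mulr0 !addr0 scale1r scale0r addr0.
have H : (forall t : R, 0 < t < 1 -> gauss_mean (fun u =>
   mdot (gradient f (x + t *: s + (c + t * 0) *: u)) (s + 0 *: u)) <=
   mdot (smooth_grad c x) s + mdot (smooth_hess c x *m s) s * t +
   L / (2 * c) * mnorm s ^+ 3 * t ^+ 2).
  move=> t t01; under eq_gauss_mean do rewrite scale0r addr0 mulr0 addr0.
  rewrite smooth_grad_mdot.
  have pm : poly_growth (mdot s) by exact: poly_growth_mdot.
  have pgm : poly_growth (fun u => mdot (gradient f (x + c *: u)) s * mdot s u).
    apply: poly_growthM => //.
    have := poly_growth_mdot_gradient x c 0 s.
    by under eq_fun do rewrite scale0r addr0.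
  have pfm y : poly_growth (fun u => f (y + c *: u) * mdot s u) by exact: poly_growthM.
  have rearrange (p q r w : R) : p - q - t * r <= w -> p <= q + r * t + w by lra.
  have E : c * (mdot (smooth_grad c (x + t *: s)) s - mdot (smooth_grad c x) s -
       t * mdot (smooth_hess c x *m s) s) =
     gauss_mean (fun u => (f (x + t *: s + c *: u) * mdot s u - f (x + c *: u) * mdot s u)
       - t * (mdot (gradient f (x + c *: u)) s * mdot s u)).
    rewrite gauss_meanB; [|exact: poly_growthB|exact: poly_growthZ].
    rewrite gauss_meanB// gauss_meanZ// (stein_smooth_grad c (x + t *: s) s)
      (stein_smooth_grad c x s) smooth_hess_mdot//.
    by rewrite !mulrBr (mulrCA c t).
  have B : gauss_mean (fun u => (f (x + t *: s + c *: u) * mdot s u - f (x + c *: u) * mdot s u)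
       - t * (mdot (gradient f (x + c *: u)) s * mdot s u)) <=
      L / 2 * (t ^+ 2 * mnorm s ^+ 2) * mnorm s.
    apply: (@le_trans _ _ (gauss_mean (fun u => L / 2 * (t ^+ 2 * mnorm s ^+ 2) * `|mdot s u|))).
      apply: le_gauss_mean.
      - apply: poly_growthB; first exact: poly_growthB.
        exact: poly_growthZ.
      - by apply: poly_growthZ; exact: poly_growth_norm.
      - move=> u; apply: le_trans (ler_norm _) _.
        rewrite [X in `|X|](_ : _ = (f (x + t *: s + c *: u) - f (x + c *: u) -
          t * mdot (gradient f (x + c *: u)) s) * mdot s u); last by ring.
        rewrite normrM ler_wpM2r//.
        have := descent df gradL (x + c *: u) (t *: s).
        by rewrite (addrAC x (c *: u)) mdotZr mnormZ exprMn real_normK ?num_real.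
    rewrite gauss_meanZ; last exact: poly_growth_norm.
    apply: ler_wpM2l; last exact: gauss_mean_normr_mdot.
    by rewrite mulr_ge0 ?divr_ge0// mulr_ge0// sqr_ge0.
  move: B; rewrite -E mulrC -ler_pdivlMr// => B.
  apply: rearrange; apply: le_trans B _.
  move: (mnorm s) => e; rewrite le_eqVlt; apply/orP; left; apply/eqP; by field.
move=> /(_ H).
have rearrange (p q r w e : R) : p - q <= r + w / 2 + e / 3 -> p <= q + r + 1 / 2 * w + e / 3.
  by lra.
move=> /rearrange K; apply: le_trans K _; rewrite lerD2l.
by move: (mnorm s) => e; rewrite le_eqVlt; apply/orP; left; apply/eqP; field.
Qed.

(** Subtracting [f x] does not change the mean, as [u] is centred, and it keeps the second moment
    bounded when [c] tends to 0. *)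
Lemma gauss_mean_grad_sample (c : R) x i : c != 0 ->
  gauss_mean (fun u => grad_sample c x u i ord0) = smooth_grad c x i ord0.
Proof.
move=> c0.
have -> : (fun u => grad_sample c x u i ord0) =
    (fun u => c^-1 * (f (x + c *: u) * u i ord0 - f x * u i ord0)).
  by apply/funext => u; rewrite mxE; ring.
have pfu : poly_growth (fun u => f (x + c *: u) * u i ord0) by exact: poly_growthM.
have pxu : poly_growth (fun u => f x * u i ord0) by exact: poly_growthZ.
rewrite gauss_meanZ; last exact: poly_growthB.
rewrite gauss_meanB// gauss_meanZ// gauss_mean_coord mulr0 subr0.
by rewrite (stein_gradient df gradL) mulKf// [smooth_grad _ _ _ _]mxE.
Qed.

Lemma poly_growth_grad_sample (c : R) x i :
  poly_growth (fun u => grad_sample c x u i ord0).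
Proof.
have -> : (fun u => grad_sample c x u i ord0) =
    (fun u => c^-1 * ((f (x + c *: u) - f x) * u i ord0)).
  by apply/funext => u; rewrite mxE; ring.
by apply: poly_growthZ; apply: poly_growthM => //; exact: poly_growthB.
Qed.

Lemma hess_sampleE (c : R) x u i j : hess_sample c x u i j =
  (2 * c ^+ 2)^-1 * ((f (x + c *: u) + f (x - c *: u) - 2 * f x) *
     (u i ord0 * u j ord0 - (i == j)%:R)).
Proof. by rewrite !mxE big_ord1 mxE; ring. Qed.

Lemma poly_growth_outer i j :
  poly_growth (fun u => u i ord0 * u j ord0 - (i == j)%:R).
Proof. by apply: poly_growthB => //; exact: poly_growthM. Qed.

Lemma poly_growth_hess_sample (c : R) x i j :
  poly_growth (fun u => hess_sample c x u i j).
Proof.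
under eq_fun do rewrite hess_sampleE -scaleNr.
apply: poly_growthZ; apply: poly_growthM; last exact: poly_growth_outer.
by apply: poly_growthB => //; exact: poly_growthD.
Qed.

(** The points [x + c u] and [x - c u] contribute equally because [u u^T - I] is even, and the [f x]
    term drops because [u u^T - I] is centred. *)
Lemma gauss_mean_hess_sample (c : R) x i j : c != 0 ->
  gauss_mean (fun u => hess_sample c x u i j) = smooth_hess c x i j.
Proof.
move=> c0; have po := poly_growth_outer i j.
have pfo (e : R) : poly_growth (fun u => f (x + e *: u) * (u i ord0 * u j ord0 - (i == j)%:R)).
  exact: poly_growthM.
have sym : gauss_mean (fun u => f (x + - c *: u) * (u i ord0 * u j ord0 - (i == j)%:R)) =
    gauss_mean (fun u => f (x + c *: u) * (u i ord0 * u j ord0 - (i == j)%:R)).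
  rewrite -(gauss_mean_sym (pfo c)).
    by apply: eq_gauss_mean => u; rewrite scalerN scaleNr !mxE mulrNN.
  move=> k v t; apply: cvgM; first exact: (pderive_continuous (pderive_smooth df x c k)).
  apply: cvgB; last exact: cvg_cst.
  by apply: cvgM; [exact: (pderive_continuous (pderive_coord k i))|
    exact: (pderive_continuous (pderive_coord k j))].
have -> : (fun u => hess_sample c x u i j) = (fun u => (2 * c ^+ 2)^-1 *
    (f (x + c *: u) * (u i ord0 * u j ord0 - (i == j)%:R) +
     f (x + - c *: u) * (u i ord0 * u j ord0 - (i == j)%:R) -
     2 * f x * (u i ord0 * u j ord0 - (i == j)%:R))).
  by apply/funext => u; rewrite hess_sampleE scaleNr; ring.
have pc : poly_growth (fun u => 2 * f x * (u i ord0 * u j ord0 - (i == j)%:R)).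
  exact: poly_growthZ.
rewrite gauss_meanZ; last by apply: poly_growthB => //; exact: poly_growthD.
rewrite gauss_meanB//; last exact: poly_growthD.
rewrite gauss_meanD// sym (stein_hessian df gradL) gauss_meanZ//.
have -> : gauss_mean (fun u => u i ord0 * u j ord0 - (i == j)%:R) = 0.
  by rewrite gauss_meanB ?gauss_mean_coordM ?gauss_mean_cst ?subrr//; exact: poly_growthM.
by rewrite [smooth_hess _ _ _ _]mxE; field.
Qed.

(** The difference quotient is [<grad f x, u>] up to [L c |u|^2 / 2]. Squared and multiplied by
    [|u|^2], it leads to [gauss_mean_sqmdot_sqnorm] and to the sixth moment of [|u|]. *)
Lemma grad_sample_moment2 (c : R) x : 0 < c ->
  gauss_mean (fun u => mdot (grad_sample c x u) (grad_sample c x u)) <=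
  L ^+ 2 * (d%:R + 6) ^+ 3 / 2 * c ^+ 2 + 2 * (d%:R + 2) * mnorm (gradient f x) ^+ 2.
Proof.
move=> c0.
have pX : poly_growth (fun u => mdot (grad_sample c x u) (grad_sample c x u)).
  apply: poly_growth_sum => i _; apply: poly_growth_sum => j _; rewrite (ord1 j).
  by apply: poly_growthM; exact: poly_growth_grad_sample.
have pq : poly_growth (fun u => mdot (gradient f x) u ^+ 2 * mdot u u).
  by apply: poly_growthM => //; apply: poly_growthX; exact: poly_growth_mdot.
have p3 : poly_growth (fun u => mdot u u ^+ 3) by exact: poly_growthX.
apply: (@le_trans _ _ (gauss_mean (fun u => 2 * (mdot (gradient f x) u ^+ 2 * mdot u u) +
    L ^+ 2 * c ^+ 2 / 2 * mdot u u ^+ 3))).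
  apply: le_gauss_mean => //.
    by apply: poly_growthD; exact: poly_growthZ.
  move=> u; rewrite mdotZl mdotZr.
  have := descent df gradL x (c *: u); rewrite mdotZr mnormZ exprMn real_normK ?num_real//.
  rewrite sqr_mnorm; set D := f (x + c *: u) - f x; set g := mdot _ u; set q := mdot u u.
  have q0 : 0 <= q by exact: mdot_ge0.
  move=> H.
  have {}H : `|D / c - g| <= L / 2 * c * q.
    rewrite (_ : D / c - g = (D - c * g) / c); last by field; rewrite gt_eqF.
    rewrite normrM normfV (gtr0_norm c0) ler_pdivrMr//.
    by apply: le_trans H _; rewrite le_eqVlt; apply/orP; left; apply/eqP; ring.
  have H2 : (D / c - g) ^+ 2 <= (L / 2 * c * q) ^+ 2.
    by rewrite -real_normK ?num_real// lerXn2r// nnegrE !mulr_ge0// ?divr_ge0// ltW.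
  have : (D / c) ^+ 2 <= 2 * g ^+ 2 + L ^+ 2 * c ^+ 2 / 2 * q ^+ 2.
    (* [2 g^2 + 2 (D / c - g)^2 - (D / c)^2] is exactly this square. *)
    have := sqr_ge0 (D / c - 2 * g); nra.
  move=> /(ler_wpM2r q0); lra.
rewrite gauss_meanD; [|exact: poly_growthZ..].
rewrite !gauss_meanZ// gauss_mean_sqmdot_sqnorm -sqr_mnorm addrC lerD//.
  rewrite [leRHS](_ : _ = L ^+ 2 * c ^+ 2 / 2 * (d%:R + 6) ^+ 3); last by ring.
  have cf : 0 <= L ^+ 2 * c ^+ 2 / 2 by rewrite divr_ge0// mulr_ge0// sqr_ge0.
  apply: ler_wpM2l => //.
  by have := @gauss_mean_sqnorm_le R d 3 6 isT; rewrite natrD.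
by rewrite mulrA.
Qed.

(** In the symmetric second difference the gradient terms cancel, so the coefficient is at most
    [L |u|^2 / 2] for all [x] and [c]. Hence the Hessian error, unlike the gradient error, is
    bounded without a factor [1 + |x|]. *)
Lemma hess_sample_moment4 (c : R) x : 0 < c ->
  gauss_mean (fun u => mdot (hess_sample c x u) (hess_sample c x u) ^+ 2) <=
  (L * (d%:R + 14) ^+ 2) ^+ 4.
Proof.
move=> c0.
have pX : poly_growth (fun u => mdot (hess_sample c x u) (hess_sample c x u) ^+ 2).
  apply: poly_growthX; apply: poly_growth_sum => i _; apply: poly_growth_sum => j _.
  by apply: poly_growthM; exact: poly_growth_hess_sample.
have pk k : poly_growth (fun u => mdot u u ^+ k) by exact: poly_growthX.
apply: (@le_trans _ _ (gauss_mean (fun u => L ^+ 4 / 8 *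
    (mdot u u ^+ 8 + d%:R ^+ 2 * mdot u u ^+ 4)))).
  apply: le_gauss_mean => //.
    by apply: poly_growthZ; apply: poly_growthD => //; exact: poly_growthZ.
  move=> u; rewrite mdotZl mdotZr.
  have := descent df gradL x (c *: u); have := descent df gradL x (- (c *: u)).
  rewrite mdotNr mnormN mnormZ exprMn real_normK ?num_real// sqr_mnorm opprK.
  set D1 := f (x + c *: u); set D2 := f (x - c *: u); set g := mdot _ (c *: u).
  set q := mdot u u => h2 h1.
  have q0 : 0 <= q by exact: mdot_ge0.
  have -> : mdot (u *m u^T - 1%:M) (u *m u^T - 1%:M) = q ^+ 2 - 2 * q + d%:R.
    have e1 : mdot (u *m u^T) 1%:M = q.
      rewrite /q -dotcvE; apply: eq_bigr => i _; rewrite (bigD1 i)//= big1 ?addr0.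
        by rewrite !mxE eqxx big_ord1 mxE mulr1.
      by move=> j ji; rewrite [1%:M _ _]mxE eq_sym (negbTE ji) mulr0.
    have e2 : mdot 1%:M (1%:M : 'M[R]_d) = d%:R.
      rewrite -[d in RHS]card_ord -sumr_const; apply: eq_bigr => i _.
      rewrite (bigD1 i)//= big1 ?addr0; first by rewrite !mxE eqxx mulr1.
      by move=> j ji; rewrite [1%:M _ _]mxE eq_sym (negbTE ji) mulr0.
    rewrite mdotDl !mdotDr !mdotNl !mdotNr mdot_outer -/q e1 e2 (mdotC 1%:M) e1; ring.
  have : `|(D1 + D2 - 2 * f x) / (2 * c ^+ 2)| <= L / 2 * q.
    rewrite normrM normfV [X in _ / X]gtr0_norm ?mulr_gt0 ?exprn_gt0//.
    rewrite ler_pdivrMr ?mulr_gt0 ?exprn_gt0//.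
    move: h1 h2; rewrite !ler_norml => /andP[? ?] /andP[? ?].
    by apply/andP; split; lra.
  set k := _ / (2 * c ^+ 2) => hk.
  have k2 : k ^+ 2 <= L ^+ 2 / 4 * q ^+ 2.
    apply: (@le_trans _ _ ((L / 2 * q) ^+ 2)); last by rewrite le_eqVlt; apply/orP; left; apply/eqP; field.
    by rewrite -real_normK ?num_real// lerXn2r// nnegrE mulr_ge0// divr_ge0.
  (* For [d >= 1] this is at least [(q - 1)^2]; for [d = 0] the vector is empty and [q = 0]. *)
  have w0 : 0 <= q ^+ 2 - 2 * q + d%:R.
    have [d0|d0] := posnP d; last first.
      have : (1 : R) <= d%:R by rewrite ler1n.
      by have := sqr_ge0 (q - 1); lra.
    have -> : q = 0.
      by rewrite /q -dotcvE /dotcv big1// => i; move: (ltn_ord i); rewrite [X in (_ < X)%N]d0.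
    by rewrite expr0n/= mulr0 subr0 add0r.
  apply: (@le_trans _ _ ((L ^+ 2 / 4 * q ^+ 2 * (q ^+ 2 + d%:R)) ^+ 2)).
    have B0 : 0 <= k * (k * (q ^+ 2 - 2 * q + d%:R)) by rewrite mulrA -expr2 mulr_ge0// sqr_ge0.
    have B1 : k * (k * (q ^+ 2 - 2 * q + d%:R)) <= L ^+ 2 / 4 * q ^+ 2 * (q ^+ 2 + d%:R).
      by rewrite mulrA -expr2; apply: ler_pM; rewrite ?sqr_ge0//; lra.
    by rewrite lerXn2r// nnegrE (le_trans B0 B1).
  rewrite [leLHS](_ : _ = L ^+ 4 / 8 * (q ^+ 4 * ((q ^+ 2 + d%:R) ^+ 2 / 2))); last by field.
  have L4 : 0 <= L ^+ 4 / 8 by rewrite divr_ge0// exprn_ge0.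
  apply: ler_wpM2l => //.
  rewrite [leRHS](_ : _ = q ^+ 4 * (q ^+ 4 + d%:R ^+ 2)); last by ring.
  apply: ler_wpM2l; first exact: exprn_ge0.
  have := sqr_ge0 (q ^+ 2 - d%:R); nra.
rewrite gauss_meanZ; last by apply: poly_growthD => //; exact: poly_growthZ.
rewrite gauss_meanD//; last exact: poly_growthZ.
rewrite gauss_meanZ//.
(* The largest factor of the sixteenth moment of [|u|] is [d + 14]; the eighth moment is bounded
   with the same number to obtain one power of [w]. *)
have m8 := @gauss_mean_sqnorm_le R d 8 14 isT.
have m4 := @gauss_mean_sqnorm_le R d 4 14 isT.
rewrite natrD in m8 m4; set w := d%:R + 14 in m8 m4 *.
have dw : d%:R ^+ 2 <= w ^+ 4.
  apply: (@le_trans _ _ (w ^+ 2)).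
    by rewrite lerXn2r ?nnegrE ?addr_ge0// lerDl.
  by apply: ler_weXn2l => //; rewrite /w; have : (0 : R) <= d%:R by []; lra.
apply: (@le_trans _ _ (L ^+ 4 / 8 * (w ^+ 8 + w ^+ 4 * w ^+ 4))).
  have L4 : 0 <= L ^+ 4 / 8 by rewrite divr_ge0// exprn_ge0.
  apply: ler_wpM2l => //; apply: lerD => //; apply: ler_pM => //.
  by apply: gauss_mean_ge0 => u; rewrite exprn_ge0// mdot_ge0.
rewrite [leRHS](_ : _ = L ^+ 4 * w ^+ 8); last by ring.
rewrite [leLHS](_ : _ = L ^+ 4 * w ^+ 8 / 4); last by field.
by rewrite ler_pdivrMr// ler_peMr ?mulr_ge0 ?exprn_ge0 ?addr_ge0// ler1n.
Qed.

End gaussian_smoothing.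

Section gauss_increment.
Context {R : realType} {d m n : nat}.
Variable X : 'cV[R]_d -> 'M[R]_(m, n).
Hypothesis pX : forall i j, poly_growth (fun v => X v i j).
Hypothesis X0 : forall i j, gauss_mean (fun v => X v i j) = 0.

Lemma poly_growth_mdotl (S : 'M[R]_(m, n)) : poly_growth (fun v => mdot S (X v)).
Proof.
apply: poly_growth_sum => i _; apply: poly_growth_sum => j _.
by apply: poly_growthZ; exact: pX.
Qed.

Lemma poly_growth_mdot_self : poly_growth (fun v => mdot (X v) (X v)).
Proof.
apply: poly_growth_sum => i _; apply: poly_growth_sum => j _.
by apply: poly_growthM; exact: pX.
Qed.

Lemma gauss_mean_mdotl (S : 'M[R]_(m, n)) : gauss_mean (fun v => mdot S (X v)) = 0.
Proof.
have pZ i j : poly_growth (fun v => S i j * X v i j) by exact: poly_growthZ.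
rewrite gauss_mean_sum => [|i _]; last by apply: poly_growth_sum => j _; exact: pZ.
apply: big1 => i _; rewrite gauss_mean_sum => [|j _]; last exact: pZ.
by apply: big1 => j _; rewrite gauss_meanZ// X0 mulr0.
Qed.

Lemma mdot_sqrD (S T : 'M[R]_(m, n)) :
  mdot (S + T) (S + T) = mdot S S + 2 * mdot S T + mdot T T.
Proof. by rewrite mdotDl !mdotDr (mdotC T S); ring. Qed.

Lemma poly_growth_mdotD (S : 'M[R]_(m, n)) :
  poly_growth (fun v => mdot (S + X v) (S + X v)).
Proof.
under eq_fun do rewrite mdot_sqrD.
apply: poly_growthD; last exact: poly_growth_mdot_self.
apply: poly_growthD; first exact: poly_growth_cst.
by apply: poly_growthZ; exact: poly_growth_mdotl.
Qed.

Lemma gauss_mean_increment2 (S : 'M[R]_(m, n)) :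
  gauss_mean (fun v => mdot (S + X v) (S + X v)) =
  mdot S S + gauss_mean (fun v => mdot (X v) (X v)).
Proof.
have pl := poly_growth_mdotl S; have ps := poly_growth_mdot_self.
have p2 : poly_growth (fun v => 2 * mdot S (X v)) by exact: poly_growthZ.
have pc := poly_growth_cst (n := d) (mdot S S).
under eq_gauss_mean do rewrite mdot_sqrD.
rewrite gauss_meanD//; last exact: poly_growthD.
by rewrite gauss_meanD// gauss_mean_cst gauss_meanZ// gauss_mean_mdotl mulr0 addr0.
Qed.

(** Expand [(a + 2 b + c)^2] with [a = |S|^2], [b = <S, X>], [c = |X|^2]. The term [4 a b] is
    centred; the others are reduced by [b^2 <= a c] and [4 b c <= 2 b^2 + 2 c^2]. *)
Lemma gauss_mean_increment4 (S : 'M[R]_(m, n)) :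
  gauss_mean (fun v => mdot (S + X v) (S + X v) ^+ 2) <=
  mdot S S ^+ 2 + 8 * mdot S S * gauss_mean (fun v => mdot (X v) (X v)) +
  3 * gauss_mean (fun v => mdot (X v) (X v) ^+ 2).
Proof.
have pl := poly_growth_mdotl S; have ps := poly_growth_mdot_self.
set a := mdot S S.
have p1 : poly_growth (fun v => 4 * a * mdot S (X v)) by exact: poly_growthZ.
have p2 : poly_growth (fun v => 8 * a * mdot (X v) (X v)) by exact: poly_growthZ.
have p3 : poly_growth (fun v => mdot (X v) (X v) ^+ 2) by exact: poly_growthX.
have p3' : poly_growth (fun v => 3 * mdot (X v) (X v) ^+ 2) by exact: poly_growthZ.
have pc := poly_growth_cst (n := d) (a ^+ 2).
apply: (@le_trans _ _ (gauss_mean (fun v => a ^+ 2 + 4 * a * mdot S (X v) +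
   8 * a * mdot (X v) (X v) + 3 * mdot (X v) (X v) ^+ 2))).
  apply: le_gauss_mean.
  - by apply: poly_growthX; exact: poly_growth_mdotD.
  - by do 3 apply: poly_growthD => //.
  move=> v; rewrite mdot_sqrD -/a.
  have : mdot S (X v) ^+ 2 <= a * mdot (X v) (X v).
    rewrite /a -!sqr_mnorm -exprMn -real_normK ?num_real//.
    by rewrite lerXn2r ?nnegrE ?mulr_ge0 ?mnorm_ge0// normr_mdot_le.
  move: (mdot S (X v)) (mdot (X v) (X v)) => b c.
  have := sqr_ge0 (b - c); nra.
rewrite gauss_meanD//; last by do 2 apply: poly_growthD => //.
rewrite gauss_meanD//; last exact: poly_growthD.
rewrite gauss_meanD// gauss_mean_cst !gauss_meanZ// gauss_mean_mdotl.
by rewrite mulr0 addr0.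
Qed.

End gauss_increment.

(** * Averages of independent samples *)

Section independence_lemmas.
Context {R : realType} {disp : measure_display} {Omega : measurableType disp}.
Variable P : probability Omega R.
Local Open Scope ereal_scope.

(** Dynkin's argument: the events that satisfy the product rule against [B] are closed under
    complements and countable disjoint unions. *)
Lemma indep_g_sigma_algebra (G : set_system Omega) (B : set Omega) :
  measurable B -> G `<=` measurable -> setI_closed G -> 
  (forall A, G A -> P (A `&` B) = P A * P B) ->
  forall A, <<s G >> A -> P (A `&` B) = P A * P B.
Proof.
move=> mB Gm GI GB.
have sGm : <<s G >> `<=` (measurable : set_system Omega).
  apply: smallest_sub => //; exact: sigma_algebra_measurable.
have PC (S : set Omega) : measurable S -> P (S `&` B) = P S * P B ->
    P (~` S `&` B) = P (~` S) * P B.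
  move=> mS PS; have -> : ~` S `&` B = B `\` (S `&` B).
    by rewrite setDIr setDv setU0 setDE setIC.
  rewrite measureD//; last 2 first.
  - exact: measurableI.
  - by rewrite -ge0_fin_numE// fin_num_measure.
  have -> : B `&` (S `&` B) = S `&` B by rewrite setICA setIid.
  rewrite [X in _ - X]PS probability_setC// muleBl ?mul1e//.
  by rewrite fin_num_measure.
have PU (F : (set Omega)^nat) : (forall k, measurable (F k)) -> trivIset setT F ->
    (forall k, P (F k `&` B) = P (F k) * P B) ->
    P (\bigcup_k F k `&` B) = P (\bigcup_k F k) * P B.
  move=> mF tF PF; rewrite setI_bigcupl measure_bigcup//; last 2 first.
  - by move=> k _; exact: measurableI.
  - by apply: trivIset_setIr.
  rewrite measure_bigcup// (_ : P B = (fine (P B))%:E); last first.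
    by rewrite fineK// fin_num_measure.
  rewrite muleC -nneseriesZl//; apply: eq_eseriesr => k _.
  by rewrite [LHS]PF muleC fineK// fin_num_measure.
apply: (@dynkin_induction _ (g_sigma_algebraType G) G) => //.
- by rewrite setTI probability_setT mul1e.
- by move=> S mS; apply: PC; exact: sGm mS.
- by move=> F mF tF; apply: PU => // k; exact: sGm (mF k).
Qed.

(** The joint law is the product of the marginals, then Tonelli. Averaging [U] with [Z] frozen plays
    the part of conditional expectation. *)
Lemma ge0_integral_indep d1 d2 (T1 : measurableType d1) (T2 : measurableType d2)
    (Z : {RV P >-> T1}) (U : {RV P >-> T2}) (Phi : T1 * T2 -> \bar R) :
  (forall A B, measurable A -> measurable B ->
     P (Z @^-1` A `&` U @^-1` B) = P (Z @^-1` A) * P (U @^-1` B)) ->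
  measurable_fun setT Phi -> (forall p, 0 <= Phi p) ->
  \int[P]_w Phi (Z w, U w) = \int[P]_w \int[distribution P U]_v Phi (Z w, v).
Proof.
move=> ind mPhi Phi0.
have mZU : measurable_fun setT (fun w => (Z w, U w)) by exact: measurable_fun_pair.
pose ZU : {RV P >-> (T1 * T2)%type} := 
  HB.pack (fun w => (Z w, U w)) (isMeasurableFun.Build _ _ _ _ _ mZU).
transitivity (\int[distribution P ZU]_p Phi p).
  by rewrite ge0_integral_distribution.
rewrite (eq_measure_integral (distribution P Z \x distribution P U)); last first.
  move=> A mA _; apply/esym.
  apply: product_measure_unique => // B C mB mC.
rewrite fubini_tonelli1// ge0_integral_distribution//.
- exact: measurable_fun_fubini_tonelli_F.
- by move=> y; exact: integral_ge0.
Qed.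

End independence_lemmas.

Lemma measurable_mx_entry {R : realType} m n d (T : measurableType d)
    (F : T -> 'M[R]_(m, n)) i j :
  measurable_fun setT F -> measurable_fun setT (fun t => F t i j).
Proof. by move=> /measurable_fun_matrixP. Qed.

Lemma measurable_mdot_fun {R : realType} m n d (T : measurableType d)
    (F G : T -> 'M[R]_(m, n)) :
  measurable_fun setT F -> measurable_fun setT G ->
  measurable_fun setT (fun t => mdot (F t) (G t)).
Proof.
move=> mF mG; apply: measurable_sum => i; apply: measurable_sum => j.
by apply: measurable_funM; exact: measurable_mx_entry.
Qed.

Lemma measurable_mxD {R : realType} m n d (T : measurableType d)
    (F G : T -> 'M[R]_(m, n)) :
  measurable_fun setT F -> measurable_fun setT G ->
  measurable_fun setT (fun t => F t + G t).
Proof.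
move=> mF mG; apply/measurable_fun_matrixP => i j; under eq_fun do rewrite mxE.
by apply: measurable_funD; exact: measurable_mx_entry.
Qed.

Lemma integral_probability_cst {R : realType} d (T : measurableType d)
  (P : probability T R) (r : R) : (\int[P]_w r%:E = r%:E)%E.
Proof.
rewrite integral_cst// -[RHS]mule1; congr (_ * _)%E.
exact: (@probability_setT _ _ _ P).
Qed.

Section sampling.
Context {R : realType} {disp : measure_display} {Omega : measurableType disp}.
Variable P : probability Omega R.
Context {d p q : nat}.
Variables (X : {RV P >-> 'cV[R]_d}) (U : nat -> {RV P >-> 'cV[R]_d}) (N : nat).
Hypothesis indXU : forall (A : set 'cV[R]_d) (B : nat -> set 'cV[R]_d),
  measurable A -> (forall i, measurable (B i)) ->
  P (X @^-1` A `&` \bigcap_(i in [set i | (i < N)%N]) (U i @^-1` B i))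
  = (P (X @^-1` A) * \prod_(i < N) P (U i @^-1` B i))%E.
Hypothesis lawU : forall i, (i < N)%N -> forall A : set 'cV[R]_d, measurable A ->
  distribution P (U i) A = std_gaussian d A.
Variable F : 'cV[R]_d -> 'cV[R]_d -> 'M[R]_(p, q).
Hypothesis mF : measurable_fun setT (fun z => F z.1 z.2).

Let mFc d' (T : measurableType d') (g h : T -> 'cV[R]_d) :
  measurable_fun setT g -> measurable_fun setT h ->
  measurable_fun setT (fun t => F (g t) (h t)).
Proof. by move=> mg mh; exact: (measurableT_comp mF (measurable_fun_pair mg mh)). Qed.

Definition sample_sum n w : 'M[R]_(p, q) := \sum_(i < n) F (X w) (U i w).

(** A pi-system that generates the sigma-algebra of [X] and the first [n] samples. *)
Let cylinder n : set_system Omega := [set E | exists A (B : nat -> set 'cV[R]_d),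
  [/\ measurable A, forall i, measurable (B i) &
      E = X @^-1` A `&` \bigcap_(i in [set i | (i < n)%N]) (U i @^-1` B i)]].

Let measurable_cylinder n : cylinder n `<=` measurable.
Proof.
move=> _ [A [B [mA mB ->]]]; apply: measurableI; first exact: measurable_funPTI.
apply: fin_bigcap_measurable; first exact: finite_II.
move=> i _; exact: measurable_funPTI.
Qed.

Let setI_closed_cylinder n : setI_closed (cylinder n).
Proof.
move=> _ _ [A [B [mA mB ->]]] [A' [B' [mA' mB' ->]]].
exists (A `&` A'), (fun i => B i `&` B' i); split.
- exact: measurableI.
- by move=> i; exact: measurableI.
- apply/seteqP; split=> w /=.
    move=> [[Aw Bw] [A'w B'w]]; split=> // i ni.
    by split; [exact: Bw|exact: B'w].
  by move=> [[Aw A'w] BBw]; split; split=> // i ni; have [] := BBw i ni.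
Qed.

Let indep_cylinder n (C : set 'cV[R]_d) : (n < N)%N -> measurable C ->
  forall E, cylinder n E -> P (E `&` U n @^-1` C) = (P E * P (U n @^-1` C))%E.
Proof.
move=> nN mC _ [A [B [mA mB ->]]].
(* [indXU] speaks of all [N] samples at once: coordinates after [n] are padded with [setT], and
   coordinate [n] receives [D], either [C] or [setT]. *)
pose B' (D : set 'cV[R]_d) i := if (i < n)%N then B i else if i == n then D else setT.
have mB' D : measurable D -> forall i, measurable (B' D i).
  by move=> mD i; rewrite /B'; case: ifP => // _; case: ifP.
have E D : X @^-1` A `&` \bigcap_(i in [set i | (i < n)%N]) (U i @^-1` B i) `&`
    U n @^-1` D =
    X @^-1` A `&` \bigcap_(i in [set i | (i < N)%N]) (U i @^-1` B' D i).
  apply/seteqP; split=> w /=.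
    move=> [[Aw Bw] Dw]; split=> // i /= iN; rewrite /B'.
    case: ifPn => [ni|_]; first exact: Bw.
    by case: eqP => // ->.
  move=> [Aw Bw]; split; first split=> //.
    by move=> i /= ni; have := Bw i (ltn_trans ni nN); rewrite /= /B' ni.
  by have := Bw n nN; rewrite /= /B' ltnn eqxx.
rewrite E indXU//; last exact: mB'.
have -> : P (X @^-1` A `&` \bigcap_(i in [set i | (i < n)%N]) (U i @^-1` B i)) =
    (P (X @^-1` A) * \prod_(i < N) P (U i @^-1` B' setT i))%E.
  by rewrite -indXU//; [rewrite -E preimage_setT setIT|exact: mB'].
rewrite (bigD1 (Ordinal nN))//= [in RHS](bigD1 (Ordinal nN))//=.
rewrite {1 3}/B' ltnn eqxx preimage_setT probability_setT mul1e -muleA.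
congr (_ * _)%E; rewrite muleC; congr (_ * _)%E.
apply: eq_bigr => i /negP ni; rewrite /B'; case: ifP => // _; case: eqP => // ne.
by exfalso; apply: ni; apply/eqP/val_inj.
Qed.

Lemma measurable_sample_sum n : measurable_fun setT (sample_sum n).
Proof.
apply/measurable_fun_matrixP => i j; under eq_fun do rewrite summxE.
apply: measurable_sum => k; apply: measurable_mx_entry.
exact: mFc.
Qed.

Lemma indep_sample_sum n A C : (n < N)%N -> measurable A -> measurable C ->
  P ((fun w => (X w, sample_sum n w)) @^-1` A `&` U n @^-1` C) =
  (P ((fun w => (X w, sample_sum n w)) @^-1` A) * P (U n @^-1` C))%E.
Proof.
move=> nN mA mC.
apply: (indep_g_sigma_algebra _ (@measurable_cylinder n) (@setI_closed_cylinder n)).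
- exact: measurable_funPTI.
- exact: indep_cylinder.
(* The same space with the smaller sigma-algebra: measurability of [X] and of the partial sum on [T]
   places their joint events in [<<s cylinder n >>]. *)
pose T := g_sigma_algebraType (cylinder n).
have mX : measurable_fun (setT : set T) (X : T -> 'cV[R]_d).
  move=> _ B mB; rewrite setTI; apply: sub_sigma_algebra.
  exists B, (fun=> setT); split=> //.
  by apply/seteqP; split=> w //= [].
have mU i : (i < n)%N -> measurable_fun (setT : set T) (U i : T -> 'cV[R]_d).
  move=> ni _ B mB; rewrite setTI; apply: sub_sigma_algebra.
  exists setT, (fun j => if j == i then B else setT); split=> //.
    by move=> j; case: ifP.
  apply/seteqP; split=> w /=.
    by move=> Bw; split=> // j nj; case: eqP => // ->.
  by move=> [_ /(_ i ni)]; rewrite eqxx.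
have mS : measurable_fun (setT : set T) (sample_sum n : T -> 'M[R]_(p, q)).
  apply/measurable_fun_matrixP => i j; under eq_fun do rewrite summxE.
  apply: measurable_sum => k; apply: measurable_mx_entry.
  by apply: mFc => //; exact: mU.
have := measurable_fun_pair mX mS.
by move=> /(_ measurableT A mA); rewrite setTI.
Qed.

Let measurable_incr n :
  measurable_fun setT (fun z : Omega * 'cV[R]_d => sample_sum n z.1 + F (X z.1) z.2).
Proof.
apply: measurable_mxD.
  exact: (measurableT_comp (measurable_sample_sum n) measurable_fst).
apply: mFc; last exact: measurable_snd.
exact: (measurableT_comp (measurable_funPT X) measurable_fst).
Qed.

(** Peels off the last sample, which is independent of [X] and the partial sum jointly; this is the
    induction step for both moment bounds. *)
Lemma integral_sample_sumS n (Phi : 'cV[R]_d -> 'M[R]_(p, q) -> \bar R) : (n < N)%N ->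
  measurable_fun setT (fun z => Phi z.1 z.2) -> (forall x s, (0 <= Phi x s)%E) ->
  (\int[P]_w Phi (X w) (sample_sum n.+1 w) =
   \int[P]_w \int[std_gaussian d]_v Phi (X w) (sample_sum n w + F (X w) v)%R)%E.
Proof.
move=> nN mPhi Phi0.
have mZ : measurable_fun setT (fun w => (X w, sample_sum n w)).
  by apply: measurable_fun_pair => //; exact: measurable_sample_sum.
pose Z : {RV P >-> ('cV[R]_d * 'M[R]_(p, q))%type} := 
  HB.pack (fun w => (X w, sample_sum n w)) (isMeasurableFun.Build _ _ _ _ _ mZ).
pose Psi (z : ('cV[R]_d * 'M[R]_(p, q)) * 'cV[R]_d) := Phi z.1.1 (z.1.2 + F z.1.1 z.2).
have mPsi : measurable_fun setT Psi.
  have m11 : measurable_fun setT (fun z : ('cV[R]_d * 'M[R]_(p, q)) * 'cV[R]_d => z.1.1).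
    exact: (measurableT_comp measurable_fst measurable_fst).
  have m12 : measurable_fun setT (fun z : ('cV[R]_d * 'M[R]_(p, q)) * 'cV[R]_d => z.1.2).
    exact: (measurableT_comp measurable_snd measurable_fst).
  apply: (measurableT_comp mPhi (measurable_fun_pair m11 (measurable_mxD m12 _))).
  by apply: mFc => //; exact: measurable_snd.
transitivity (\int[P]_w Psi (Z w, U n w))%E.
  by apply: eq_integral => w _; rewrite /Psi /= /sample_sum big_ord_recr.
rewrite (ge0_integral_indep (Z := Z) (U := U n) (Phi := Psi))//.
- apply: eq_integral => w _; apply: eq_measure_integral => A mA _.
  exact: lawU.
- by move=> A B mA mB; exact: indep_sample_sum.
- by move=> z; exact: Phi0.
Qed.

Variables m2 m4 : R.
Hypothesis pF : forall x i j, poly_growth (fun v => F x v i j).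
Hypothesis F0 : forall x i j, gauss_mean (fun v => F x v i j) = 0.
Hypothesis F2 : forall x, gauss_mean (fun v => mdot (F x v) (F x v)) <= m2.

Let measurable_sqsum n : measurable_fun setT (fun w => mdot (sample_sum n w) (sample_sum n w)).
Proof. by apply: measurable_mdot_fun; exact: measurable_sample_sum. Qed.

Let mdot2 : measurable_fun setT (fun s : 'M[R]_(p, q) => mdot s s).
Proof. exact: measurable_mdot_fun. Qed.

(** With [X] and the partial sum frozen the cross term is centred, so every sample adds at most
    [m2]. *)
Lemma sample_sum_moment2 n : (n <= N)%N ->
  (\int[P]_w (mdot (sample_sum n w) (sample_sum n w))%:E <= (n%:R * m2)%:E)%E.
Proof.
elim: n => [|n IH] nN.
  under eq_integral do rewrite /sample_sum big_ord0 mdot0l.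
  by rewrite integral0 mul0r.
rewrite (integral_sample_sumS (Phi := fun _ s => (mdot s s)%:E))//; last 2 first.
- by apply/measurable_EFinP; exact: (measurableT_comp mdot2 measurable_snd).
- by move=> _ s; rewrite lee_fin mdot_ge0.
have m20 : 0 <= m2.
  by apply: le_trans (F2 0); apply: gauss_mean_ge0 => v; exact: mdot_ge0.
apply: (@le_trans _ _ (\int[P]_w ((mdot (sample_sum n w) (sample_sum n w))%:E + m2%:E))%E).
  apply: ge0_le_integral => //.
  - by move=> w _; apply: integral_ge0 => v _; rewrite lee_fin mdot_ge0.
  - apply: (@measurable_fun_fubini_tonelli_F _ _ _ _ _ (std_gaussian d)
      (fun z => (mdot (sample_sum n z.1 + F (X z.1) z.2) (sample_sum n z.1 + F (X z.1) z.2))%:E)) => //.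
    + apply/measurable_EFinP; exact: measurable_mdot_fun.
    + by move=> z; rewrite lee_fin mdot_ge0.
  - by apply: emeasurable_funD => //; apply/measurable_EFinP.
  - move=> w _; rewrite gauss_meanE; last exact: poly_growth_mdotD.
    by rewrite gauss_mean_increment2// -EFinD lee_fin lerD2l.
rewrite ge0_integralD//; last 2 first.
- by move=> w _; rewrite lee_fin mdot_ge0.
- by apply/measurable_EFinP.
rewrite integral_probability_cst -natr1 mulrDl mul1r EFinD leeD2r//.
exact/IH/ltnW.
Qed.

Hypothesis F4 : forall x, gauss_mean (fun v => mdot (F x v) (F x v) ^+ 2) <= m4.
Hypothesis m24 : m2 ^+ 2 <= m4.

(** The induction closes because [4 n^2 + 8 n + 3 <= 4 (n + 1)^2]; the [8 n] comes from
    [sample_sum_moment2] and [m2^2 <= m4]. *)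
Lemma sample_sum_moment4 n : (n <= N)%N ->
  (\int[P]_w (mdot (sample_sum n w) (sample_sum n w) ^+ 2)%:E <= (4 * n%:R ^+ 2 * m4)%:E)%E.
Proof.
elim: n => [|n IH] nN.
  under eq_integral do rewrite /sample_sum big_ord0 mdot0l expr0n.
  by rewrite integral0 expr0n/= mulr0 mul0r.
rewrite (integral_sample_sumS (Phi := fun _ s => (mdot s s ^+ 2)%:E))//; last 2 first.
- apply/measurable_EFinP; apply: measurable_funX.
  by exact: (measurableT_comp mdot2 measurable_snd).
- by move=> _ s; rewrite lee_fin sqr_ge0.
have m20 : 0 <= m2.
  by apply: le_trans (F2 0); apply: gauss_mean_ge0 => v; exact: mdot_ge0.
have m40 : 0 <= m4 by apply: le_trans m24; exact: sqr_ge0.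
set Q := fun w => mdot (sample_sum n w) (sample_sum n w).
have Q0 w : 0 <= Q w by exact: mdot_ge0.
have mQ : measurable_fun setT Q by exact: measurable_sqsum.
apply: (@le_trans _ _ (\int[P]_w ((Q w ^+ 2)%:E + ((8 * m2)%:E * (Q w)%:E + (3 * m4)%:E)))%E).
  apply: ge0_le_integral => //.
  - by move=> w _; apply: integral_ge0 => v _; rewrite lee_fin sqr_ge0.
  - apply: (@measurable_fun_fubini_tonelli_F _ _ _ _ _ (std_gaussian d)
      (fun z => (mdot (sample_sum n z.1 + F (X z.1) z.2) (sample_sum n z.1 + F (X z.1) z.2) ^+ 2)%:E)) => //.
    + apply/measurable_EFinP; apply: measurable_funX.
      exact: measurable_mdot_fun.
    + by move=> z; rewrite lee_fin sqr_ge0.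
  - apply: emeasurable_funD; first by apply/measurable_EFinP; exact: measurable_funX.
    by apply: emeasurable_funD => //; apply/measurable_EFinP; exact: measurable_funM.
  - move=> w _; rewrite gauss_meanE; last by apply: poly_growthX; exact: poly_growth_mdotD.
    rewrite -EFinM -!EFinD lee_fin; apply: le_trans (gauss_mean_increment4 _ _ _) _ => //.
    rewrite -/(Q w) -addrA lerD2l lerD ?ler_wpM2l//.
    by rewrite mulrAC ler_wpM2r// ler_wpM2l.
have mQ2 : measurable_fun setT (fun w => (Q w ^+ 2)%:E).
  by apply/measurable_EFinP; exact: measurable_funX.
have mQE : measurable_fun setT (fun w => (Q w)%:E) by apply/measurable_EFinP.
have mQZ : measurable_fun setT (fun w => (8 * m2)%:E * (Q w)%:E)%E.
  by apply/measurable_EFinP; exact: measurable_funM.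
rewrite ge0_integralD//; last 3 first.
- by move=> w _; rewrite lee_fin sqr_ge0.
- by move=> w _; rewrite -EFinM -EFinD lee_fin addr_ge0 ?mulr_ge0.
- by apply: emeasurable_funD.
rewrite ge0_integralD//; last 2 first.
- by move=> w _; rewrite -EFinM lee_fin !mulr_ge0.
- by move=> w _; rewrite lee_fin mulr_ge0.
rewrite integral_probability_cst ge0_integralZl//; last 2 first.
- by move=> w _; rewrite lee_fin.
- by rewrite lee_fin mulr_ge0.
have I4 := IH (ltnW nN); have I2 := sample_sum_moment2 (ltnW nN).
apply: (@le_trans _ _ ((4 * n%:R ^+ 2 * m4)%:E + ((8 * m2)%:E * (n%:R * m2)%:E + (3 * m4)%:E))%E).
  apply: leeD => //; apply: leeD => //; apply: lee_wpmul2l => //.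
  by rewrite lee_fin mulr_ge0.
rewrite -EFinM -!EFinD lee_fin -natr1.
have n0 : 0 <= n%:R :> R by [].
have := ler_wpM2l n0 m24; nra.
Qed.

End sampling.

(** * Elementary inequalities *)

Section inequalities.
Context {R : realType}.
Implicit Types a b c e r t y z : R.

(* Minimality along the line through the origin: [t = -1] gives [a <= 0] and
   [t -> 1-] gives [a + b + 3c <= 0]. *)
Lemma cubic_min_le a b c : 0 <= c ->
  (forall t, a + b / 2 + c <= t * a + t ^+ 2 * b / 2 + `|t| ^+ 3 * c) ->
  a + b / 2 + c <= - c / 2.
Proof.
move=> c0 H.
have a0 : a <= 0 by have := H (-1); rewrite normrN normr1 sqrrN expr1n expr1n; lra.
suff : a + b + 3 * c <= 0 by lra.
rewrite leNgt; apply/negP => pos.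
pose g := a + b + 3 * c.
(* At [t = 1 - h] the gain is [h g] and the loss at most [h^2 K]; with [h = g / (2 K)] the loss is
   half the gain. Including [g] in [K] keeps [h <= 1 / 2]. *)
pose K := `|b| / 2 + 3 * c + g.
have g0 : 0 < g by [].
have K0 : 0 < K by rewrite /K; have := normr_ge0 b; lra.
pose h := g / (2 * K).
have h0 : 0 < h by rewrite divr_gt0// mulr_gt0.
have hK : h * K = g / 2 by rewrite /h; field; rewrite gt_eqF.
have h1 : h <= 1 / 2.
  by rewrite /h ler_pdivrMr ?mulr_gt0//; rewrite /K; have := normr_ge0 b; lra.
have := H (1 - h); rewrite ger0_norm; last by lra.
have -> : (1 - h) * a + (1 - h) ^+ 2 * b / 2 + (1 - h) ^+ 3 * c =
   (a + b / 2 + c) - h * (g - h * (b / 2 + 3 * c - h * c)) by rewrite /g; field.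
rewrite lerDl oppr_ge0 pmulr_rle0// subr_le0 => gle.
have : h * (b / 2 + 3 * c - h * c) <= h * K.
  rewrite ler_wpM2l ?(ltW h0)// /K; have := ler_norm b; nra.
lra.
Qed.

(** With [r = sqrt y], a first inequality, sharp at [e b = 3 r], separates [b] from [r^3]; a second,
    sharp at [r = a], bounds [r^3] by an affine function of [y^2]. The coefficient 1/27 is relaxed
    to 1/24, one of the two equal shares available in [smooth_step]. *)
Lemma young_grad e a b y : 0 < e -> 0 < a -> 0 <= b -> 0 <= y ->
  y * b <= e ^+ 2 * b ^+ 3 / 24 + 2 * a ^+ 3 / e * (3 / 4 * (y ^+ 2 / a ^+ 4) + 1 / 4).
Proof.
move=> e0 a0 b0 y0.
set r := Num.sqrt y; have r0 : 0 <= r by exact: sqrtr_ge0.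
have yr : y = r ^+ 2 by rewrite sqr_sqrtr.
rewrite yr.
have B0 : 0 <= e * b by rewrite mulr_ge0// ltW.
have i1 : e * (r ^+ 2 * b) <= (e * b) ^+ 3 / 27 + 2 * r ^+ 3.
  rewrite -subr_ge0.
  have -> : (e * b) ^+ 3 / 27 + 2 * r ^+ 3 - e * (r ^+ 2 * b) =
    (e * b - 3 * r) ^+ 2 * (e * b + 6 * r) / 27 by field.
  by rewrite divr_ge0// mulr_ge0 ?sqr_ge0// addr_ge0// mulr_ge0.
have i2 : r ^+ 3 <= a ^+ 3 * (3 / 4 * ((r ^+ 2) ^+ 2 / a ^+ 4) + 1 / 4).
  rewrite -subr_ge0.
  have -> : a ^+ 3 * (3 / 4 * ((r ^+ 2) ^+ 2 / a ^+ 4) + 1 / 4) - r ^+ 3 =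
    (r - a) ^+ 2 * (3 * r ^+ 2 + 2 * r * a + a ^+ 2) / (4 * a) by field; rewrite gt_eqF.
  have q0 : 0 <= 3 * r ^+ 2 + 2 * r * a + a ^+ 2.
    by have := mulr_ge0 r0 (ltW a0); have := sqr_ge0 r; have := sqr_ge0 a; lra.
  apply: divr_ge0; first by apply: mulr_ge0 => //; exact: sqr_ge0.
  by rewrite mulr_ge0// ltW.
rewrite -(ler_pM2l e0).
have -> : e * (e ^+ 2 * b ^+ 3 / 24 + 2 * a ^+ 3 / e * (3 / 4 * ((r ^+ 2) ^+ 2 / a ^+ 4) + 1 / 4)) =
  (e * b) ^+ 3 / 24 + 2 * (a ^+ 3 * (3 / 4 * ((r ^+ 2) ^+ 2 / a ^+ 4) + 1 / 4)).
  by field; rewrite !gt_eqF.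
have : 0 <= (e * b) ^+ 3 by rewrite exprn_ge0.
lra.
Qed.

(** As in [young_grad]: sharp at [b = 8 z / e^2], which fixes 32/3, and then at [z = c]. *)
Lemma young_hess e c b z : 0 < e -> 0 < c -> 0 <= b -> 0 <= z ->
  z * b ^+ 2 / 2 <= e ^+ 2 * b ^+ 3 / 24 +
    32 / 3 * c ^+ 3 / e ^+ 4 * (3 / 4 * (z ^+ 4 / c ^+ 4) + 1 / 4).
Proof.
move=> e0 c0 b0 z0.
have i2 : z ^+ 3 <= c ^+ 3 * (3 / 4 * (z ^+ 4 / c ^+ 4) + 1 / 4).
  rewrite -subr_ge0.
  have -> : c ^+ 3 * (3 / 4 * (z ^+ 4 / c ^+ 4) + 1 / 4) - z ^+ 3 =
    (z - c) ^+ 2 * (3 * z ^+ 2 + 2 * z * c + c ^+ 2) / (4 * c) by field; rewrite gt_eqF.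
  have q0 : 0 <= 3 * z ^+ 2 + 2 * z * c + c ^+ 2.
    by have := mulr_ge0 z0 (ltW c0); have := sqr_ge0 z; have := sqr_ge0 c; lra.
  apply: divr_ge0; first by apply: mulr_ge0 => //; exact: sqr_ge0.
  by rewrite mulr_ge0// ltW.
have i1 : z * b ^+ 2 / 2 <= e ^+ 2 * b ^+ 3 / 24 + 32 / 3 / e ^+ 4 * z ^+ 3.
  rewrite -subr_ge0.
  have -> : e ^+ 2 * b ^+ 3 / 24 + 32 / 3 / e ^+ 4 * z ^+ 3 - z * b ^+ 2 / 2 =
    e ^+ 2 / 24 * ((b - 8 * (z / e ^+ 2)) ^+ 2 * (b + 4 * (z / e ^+ 2))).
    by field; rewrite gt_eqF.
  rewrite mulr_ge0 ?divr_ge0 ?sqr_ge0// mulr_ge0 ?sqr_ge0//.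
  by rewrite addr_ge0// mulr_ge0// divr_ge0// sqr_ge0.
apply: le_trans i1 _; rewrite lerD2l.
have -> : 32 / 3 * c ^+ 3 / e ^+ 4 * (3 / 4 * (z ^+ 4 / c ^+ 4) + 1 / 4) =
  32 / 3 / e ^+ 4 * (c ^+ 3 * (3 / 4 * (z ^+ 4 / c ^+ 4) + 1 / 4)) by ring.
by rewrite ler_wpM2l// !divr_ge0// exprn_ge0// ltW.
Qed.

(** The tangent at 1 of a concave power, obtained from Young's inequality against the constant 1. *)
Lemma powR_tangent t q : 0 <= t -> 0 < q < 1 -> t `^ q <= q * t + (1 - q).
Proof.
move=> t0 /andP[q0 q1].
have := @conjugate_powR R (t `^ q) 1 q^-1 (1 - q)^-1 (powR_ge0 _ _) ler01.
rewrite !invr_gt0 subr_gt0 !invrK mulr1 powR1 mul1r -powRrM mulfV ?gt_eqF// powRr1//.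
by rewrite (mulrC q) => -> //; rewrite addrC subrK.
Qed.

Lemma powR_add_le t y z : 0 < t -> 0 <= y -> 0 <= z ->
  (y + z) `^ t <= Num.max (2 `^ (t - 1)) 1 * (y `^ t + z `^ t).
Proof.
move=> t0 y0 z0.
have yz0 : 0 <= y + z by exact: addr_ge0.
have [t1|t1] := leP 1 t.
  have m1 : 1 <= Num.max (2 `^ (t - 1)) (1 : R) by rewrite le_max lexx orbT.
  have [s0|s0] := eqVneq (y + z) 0.
    by rewrite s0 powR0 ?gt_eqF// mulr_ge0 ?addr_ge0 ?powR_ge0//.
  apply: (@le_trans _ _ (2 `^ (t - 1) * (y `^ t + z `^ t))); last first.
    by rewrite ler_wpM2r ?addr_ge0 ?powR_ge0// le_max lexx.
  have [->|tn1] := eqVneq t 1.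
    by rewrite subrr powRr0 mul1r !powRr1.
  have {}t1 : 1 < t by rewrite lt_neqAle eq_sym tn1.
  (* tangent of [u |-> u^(1/t)] at the mean of [y^t] and [z^t] *)
  set S := y `^ t + z `^ t.
  have S0 : 0 < S.
    rewrite /S lt_neqAle addr_ge0 ?powR_ge0// andbT eq_sym paddr_eq0 ?powR_ge0//.
    rewrite !powR_eq0 (gt_eqF t0) !andbT; apply/negP => /andP[/eqP yy /eqP zz].
    by move: s0; rewrite yy zz addr0 eqxx.
  have q01 : 0 < t^-1 < 1 by rewrite invr_gt0 t0 invf_lt1.
  have T w : 0 <= w -> w <= (S / 2) `^ t^-1 * (t^-1 * (w `^ t / (S / 2)) + (1 - t^-1)).
    move=> w0; have S20 : 0 < S / 2 by rewrite divr_gt0.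
    have S20' := ltW S20.
    have wS : 0 <= w `^ t / (S / 2) by rewrite divr_ge0 ?powR_ge0.
    have := ler_wpM2l (powR_ge0 (S / 2) t^-1) (powR_tangent wS q01).
    rewrite -powRM// [X in X `^ _](_ : _ = w `^ t); last by field; rewrite gt_eqF.
    by rewrite -powRrM mulfV ?gt_eqF// powRr1.
  have := lerD (T y y0) (T z z0).
  rewrite -mulrDr addrACA -mulrDr -mulrDl -/S.
  have -> : t^-1 * (S / (S / 2)) + (1 - t^-1 + (1 - t^-1)) = 2.
    by field; rewrite !gt_eqF.
  move=> K.
  have : (y + z) `^ t <= ((S / 2) `^ t^-1 * 2) `^ t.
    by apply: ge0_ler_powR => //; rewrite ?nnegrE ?mulr_ge0 ?powR_ge0// ltW.
  rewrite powRM ?powR_ge0// -powRrM mulVf ?gt_eqF// powRr1 ?divr_ge0 ?(ltW S0)//.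
  move=> /le_trans; apply.
  rewrite powRB ?powRr1// ?pnatr_eq0 ?implybT//.
  by rewrite le_eqVlt; apply/orP; left; apply/eqP; field.
(* For [t < 1] the power is subadditive: the ratios [w / (y + z)] lie in [0, 1], so they are at most
   their [t]-th powers, and they sum to 1. *)
apply: (@le_trans _ _ (y `^ t + z `^ t)); last first.
  by rewrite ler_peMl ?addr_ge0 ?powR_ge0// le_max lexx orbT.
have [s0|s0] := eqVneq (y + z) 0.
  by rewrite s0 powR0 ?gt_eqF// addr_ge0 ?powR_ge0.
have sp : 0 < y + z by rewrite lt_neqAle eq_sym s0.
have T w : 0 <= w -> w <= y + z -> w / (y + z) * (y + z) `^ t <= w `^ t.
  move=> w0 wle; have [->|wn0] := eqVneq w 0.
    by rewrite mul0r mul0r powR_ge0.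
  have wp : 0 < w by rewrite lt_neqAle eq_sym wn0.
  have : w / (y + z) <= (w / (y + z)) `^ t.
    by apply: ger1_powR; rewrite ?divr_gt0 ?ler_pdivrMr ?mul1r// ltW.
  move=> /(ler_wpM2r (powR_ge0 (y + z) t)) /le_trans; apply.
  by rewrite -powRM ?divr_ge0// divfK.
have := lerD (T y y0 _) (T z z0 _); rewrite lerDl lerDr => /(_ z0 y0).
by rewrite -mulrDl -mulrDl divff// mul1r.
Qed.

(** Integral comparison in telescoping form; the origin of the ratios [s / (s - 1)] in [D4] and
    [D5]. *)
Lemma sum_powR_le (s : R) (n : nat) : 1 < s ->
  \sum_(j < n) (j.+1%:R : R) `^ (- s) <= s / (s - 1).
Proof.
move=> s1; have s10 : 0 < s - 1 by rewrite subr_gt0.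
case: n => [|n].
  by rewrite big_ord0 divr_ge0// ?(ltW s10)// ltW// (lt_trans ltr01).
suff : \sum_(j < n.+1) (j.+1%:R : R) `^ (- s) <= s / (s - 1) - n.+1%:R `^ (1 - s) / (s - 1).
  move=> /le_trans; apply; rewrite gerBl divr_ge0 ?powR_ge0// ltW//.
elim: n => [|n IH].
  rewrite big_ord1 !powR1 -mulrBl divff// gt_eqF//.
rewrite big_ord_recr/=; apply: le_trans (lerD IH (lexx _)) _.
set k : R := n.+1%:R; have k0 : 0 < k by [].
have -> : n.+2%:R = k + 1 :> R by rewrite /k natr1.
have k10 : 0 < k + 1 by rewrite addr_gt0.
(* Compares [(k + 1)^(- s)] with the integral of [t^(- s)] over [k, k + 1]; it reduces to
   [ln (1 - 1 / (k + 1)) <= - 1 / (k + 1)]. *)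
have key : (k + 1) `^ (1 - s) + (s - 1) * (k + 1) `^ (- s) <= k `^ (1 - s).
  have E w : 0 < w -> w `^ (1 - s) = w * w `^ (- s).
    by move=> w0; rewrite powRD ?powRr1 ?(ltW w0)//; apply/implyP => _; rewrite gt_eqF.
  have P1 : (k + 1) `^ (1 - s) * (1 + (s - 1) / (k + 1)) <= k `^ (1 - s).
    have kk : k / (k + 1) = 1 - (k + 1)^-1 by field; rewrite gt_eqF.
    have -> : k `^ (1 - s) = (k + 1) `^ (1 - s) * (k / (k + 1)) `^ (1 - s).
      by rewrite -powRM ?ltW// ?divr_gt0// mulrC divfK// gt_eqF.
    rewrite ler_wpM2l ?powR_ge0// /powR gt_eqF ?divr_gt0//.
    apply: le_trans (expR_ge1Dx _); rewrite lerD2l.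
    rewrite -(opprB s 1) mulNr -mulrN ler_wpM2l ?(ltW s10)//.
    have kd : 0 < k / (k + 1) by rewrite divr_gt0.
    by rewrite lerNr -ler_expR lnK ?posrE// kk expR_ge1Dx.
  apply: le_trans P1; rewrite mulrDr mulr1 lerD2l (E (k + 1))//.
  by rewrite le_eqVlt; apply/orP; left; apply/eqP; field; rewrite gt_eqF.
move: key; move: (k `^ (1 - s)) ((k + 1) `^ (1 - s)) ((k + 1) `^ (- s)) => A B C key.
rewrite -subr_ge0.
have -> : s / (s - 1) - B / (s - 1) - (s / (s - 1) - A / (s - 1) + C) =
   (A - (B + (s - 1) * C)) / (s - 1) by field; rewrite gt_eqF.
by rewrite divr_ge0 ?subr_ge0// ltW.
Qed.

End inequalities.

(** * Gaussian moments of arbitrary positive order *)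

Section power_moments.
Context {R : realType} {d : nat}.
Implicit Types (theta : R) (v : 'cV[R]_d).

Let mnorm_powR theta (p : nat) v : (0 < p)%N ->
  mnorm v `^ theta = (mdot v v ^+ p) `^ (theta / (2 * p%:R)).
Proof.
move=> p0; rewrite -sqr_mnorm -exprM -powR_mulrn ?mnorm_ge0// -powRrM natrM.
by congr (_ `^ _); field; rewrite pnatr_eq0 -lt0n.
Qed.

Let powR_exponent theta (p : nat) : 0 < theta -> theta < 2 * p%:R ->
  0 < theta / (2 * p%:R) < 1.
Proof.
move=> t0 tp; have p20 : 0 < 2 * p%:R :> R by exact: lt_trans tp.
by rewrite divr_gt0//= ltr_pdivrMr// mul1r.
Qed.

(** For [2 p > theta], [|v|^theta] is a power with exponent below 1 of the polynomial [|v|^(2p)],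
    hence lies below a tangent line. *)
Lemma poly_growth_mnorm_powR theta : 0 < theta ->
  poly_growth (fun v => mnorm v `^ theta).
Proof.
move=> t0; pose p := (Num.truncn (theta / 2)).+1.
have tp : theta < 2 * p%:R by rewrite mulrC -ltr_pdivrMr// truncnS_gt.
apply: (@poly_growth_le _ _ _ (fun v => theta / (2 * p%:R) * mdot v v ^+ p +
   (1 - theta / (2 * p%:R)))).
- by apply: (measurableT_comp (measurable_powR theta)); exact: measurable_mnorm.
- apply: poly_growthD; last exact: poly_growth_cst.
  by apply: poly_growthZ; apply: poly_growthX; exact: poly_growth_sqnorm.
- move=> v; rewrite ger0_norm ?powR_ge0// (mnorm_powR theta v (ltn0Sn _ : (0 < p)%N)).
  by apply: powR_tangent (powR_exponent t0 tp); rewrite exprn_ge0// mdot_ge0.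
Qed.

(* Lyapunov's inequality with the even exponent [2 * p] just above [theta]. *)
Lemma gauss_mean_mnorm_powR theta : 0 < theta ->
  gauss_mean (fun v => mnorm v `^ theta) <= (theta + d%:R) `^ (theta / 2).
Proof.
move=> t0; pose p := (Num.truncn (theta / 2)).+1.
have p0 : (0 < p)%N by [].
have tp : theta < 2 * p%:R by rewrite mulrC -ltr_pdivrMr// truncnS_gt.
have pt : 2 * p.-1%:R <= theta.
  by rewrite mulrC -ler_pdivlMr//; rewrite truncn_le divr_ge0// ltW.
have td0 : 0 < theta + d%:R by rewrite ltr_wpDr.
set q := theta / (2 * p%:R); have q01 : 0 < q < 1 := powR_exponent t0 tp.
pose A := (theta + d%:R) ^+ p; have A0 : 0 < A by rewrite exprn_gt0.
have pp : poly_growth (fun v => mdot v v ^+ p) by apply: poly_growthX; exact: poly_growth_sqnorm.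
have -> : (theta + d%:R) `^ (theta / 2) = A `^ q.
  rewrite /A -powR_mulrn ?(ltW td0)// -powRrM /q; congr (_ `^ _).
  by field; rewrite pnatr_eq0.
(* The tangent is taken at [A], so that inserting the moment bound [A] returns exactly [A^q]. *)
apply: (@le_trans _ _ (gauss_mean (fun v => A `^ q * (q / A) * mdot v v ^+ p + A `^ q * (1 - q)))).
  apply: le_gauss_mean; first exact: poly_growth_mnorm_powR.
    by apply: poly_growthD; [exact: poly_growthZ|exact: poly_growth_cst].
  move=> v; rewrite (mnorm_powR theta v p0) -/q.
  have m0 : 0 <= mdot v v ^+ p by rewrite exprn_ge0// mdot_ge0.
  have mA : 0 <= mdot v v ^+ p / A by rewrite divr_ge0// ltW.
  have := ler_wpM2l (powR_ge0 A q) (powR_tangent mA q01).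
  rewrite -powRM ?(ltW A0)// mulrC divfK ?gt_eqF// => /le_trans; apply.
  by rewrite le_eqVlt; apply/orP; left; apply/eqP; field; rewrite gt_eqF.
rewrite gauss_meanD; [|exact: poly_growthZ|exact: poly_growth_cst].
rewrite gauss_mean_cst gauss_meanZ//.
(* The moment is the product of [d + 2 j] over [j < p], and [2 (p - 1) <= theta] bounds each factor
   by [d + theta]. *)
have mom : gauss_mean (fun v => mdot v v ^+ p) <= A.
  have -> : gauss_mean (fun v : 'cV[R]_d => mdot v v ^+ p) = 
      \prod_(j < p) (d%:R + 2 * j%:R).
    elim: (p) => [|k IH].
      by rewrite big_ord0; under eq_gauss_mean do rewrite expr0; rewrite gauss_mean_cst.
    by rewrite gauss_mean_sqnormS IH big_ord_recr/= natrD natrM mulrC.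
  rewrite /A -[X in _ ^+ X]card_ord -prodr_const; apply: ler_prod => j _.
  rewrite addr_ge0 ?mulr_ge0//= addrC lerD2r; apply: le_trans pt.
  by rewrite ler_wpM2l// ler_nat -ltnS prednK.
have AqA : 0 <= A `^ q * (q / A).
  by rewrite mulr_ge0 ?powR_ge0// divr_ge0 ?(ltW A0)//; case/andP: q01 => /ltW.
apply: le_trans (lerD (ler_wpM2l AqA mom) (lexx _)) _.
by rewrite le_eqVlt; apply/orP; left; apply/eqP; field; rewrite gt_eqF.
Qed.

End power_moments.

Section gauss_mean_measurable.
Context {R : realType} {d : nat} {disp : measure_display} {T : measurableType disp}.

(** Positive and negative parts are treated separately, each by the measurability half of Tonelli's
    theorem. *)
Lemma measurable_gauss_mean (h : T -> 'cV[R]_d -> R) :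
  measurable_fun setT (fun z => h z.1 z.2) ->
  measurable_fun setT (fun t => gauss_mean (h t)).
Proof.
move=> mh; apply: (measurableT_comp (fine_measurable measurableT)).
have mhE : measurable_fun setT (fun z : T * 'cV[R]_d => (h z.1 z.2)%:E).
  exact/measurable_EFinP.
have -> : (fun t => \int[std_gaussian d]_v (h t v)%:E)%E =
  (fun t => \int[std_gaussian d]_v (fun z : T * 'cV[R]_d => (h z.1 z.2)%:E)^\+ (t, v) -
    \int[std_gaussian d]_v (fun z : T * 'cV[R]_d => (h z.1 z.2)%:E)^\- (t, v))%E.
  by apply/funext => t; rewrite integralE; congr (_ - _)%E; apply: eq_integral => v _; rewrite ?funeposE ?funenegE.
apply: emeasurable_funB.
- apply: (@measurable_fun_fubini_tonelli_F _ _ _ _ _ (std_gaussian d)) => //.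
  exact: measurable_funepos.
- apply: (@measurable_fun_fubini_tonelli_F _ _ _ _ _ (std_gaussian d)) => //.
  exact: measurable_funeneg.
Qed.

End gauss_mean_measurable.

Lemma entry_mxB {R : realType} m n (A B : 'M[R]_(m, n)) i j :
  (A - B) i j = A i j - B i j.
Proof. by rewrite !mxE. Qed.

(** * The random estimators *)

Section samples.
Context {R : realType} {d : nat}.
Variables (f : 'cV[R]_d -> R) (L : R).
Hypothesis L0 : 0 < L.
Hypothesis df : forall y, differentiable f y.
Hypothesis gradL : forall y z, mnorm (gradient f y - gradient f z) <= L * mnorm (y - z).
Variable sigma : R.
Hypothesis s0 : 0 < sigma.
Let sn0 : sigma != 0. Proof. by rewrite gt_eqF. Qed.
Implicit Types x y u v : 'cV[R]_d.

Let mf : measurable_fun setT f := (poly_growth_f df gradL).1.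

Let mfc d' (T : measurableType d') (g : T -> 'cV[R]_d) :
  measurable_fun setT g -> measurable_fun setT (fun t => f (g t)).
Proof. by move=> mg; exact: (measurableT_comp mf mg). Qed.

Let mshift (c : R) : measurable_fun setT (fun z : 'cV[R]_d * 'cV[R]_d => z.1 + c *: z.2).
Proof.
apply: measurable_mxD; first exact: measurable_fst.
apply/measurable_fun_matrixP => i j; under eq_fun do rewrite mxE.
by apply: measurable_funM => //; apply: measurable_mx_entry; exact: measurable_snd.
Qed.

(** The gradient of [f] grows at most linearly, so the raw error has a second moment of order
    [(1 + |x|)^2]; dividing makes the bound uniform in [x]. *)
Definition normalized_grad_sample x v : 'cV[R]_d :=
  (1 + mnorm x)^-1 *: (grad_sample f sigma x v - smooth_grad f sigma x).

Definition centered_hess_sample x v : 'M[R]_d :=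
  hess_sample f sigma x v - smooth_hess f sigma x.

Lemma measurable_smooth (c : R) : measurable_fun setT (smooth f c).
Proof.
by apply: measurable_gauss_mean; apply: mfc; exact: mshift.
Qed.

Lemma measurable_normalized_grad_sample :
  measurable_fun setT (fun z => normalized_grad_sample z.1 z.2).
Proof.
apply/measurable_fun_matrixP => i j; rewrite (ord1 j).
(* [smooth_grad] is rewritten as the mean of the samples, so that [measurable_gauss_mean] gives its
   measurability in [x]. *)
have E z : normalized_grad_sample z.1 z.2 i ord0 =
  (1 + mnorm z.1)^-1 * ((f (z.1 + sigma *: z.2) - f z.1) / sigma * z.2 i ord0 -
    gauss_mean (fun u => grad_sample f sigma z.1 u i ord0)).
  by rewrite (gauss_mean_grad_sample df gradL)// !mxE.
under eq_fun do rewrite E.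
have m2 (i' : 'I_d) : measurable_fun setT (fun z : 'cV[R]_d * 'cV[R]_d => z.2 i' ord0).
  by apply: measurable_mx_entry; exact: measurable_snd.
have mg : measurable_fun setT (fun z : 'cV[R]_d * 'cV[R]_d =>
    (f (z.1 + sigma *: z.2) - f z.1) / sigma * z.2 i ord0).
  apply: measurable_funM => //; apply: measurable_funM => //.
  apply: measurable_funB; first by apply: mfc; exact: mshift.
  by apply: mfc; exact: measurable_fst.
apply: measurable_funM.
  have mi : measurable_fun setT (fun x : 'cV[R]_d => (1 + mnorm x)^-1).
    have -> : (fun x : 'cV[R]_d => (1 + mnorm x)^-1) = (fun x => (1 + mnorm x) `^ (-1)).
      by apply/funext => x; rewrite powR_inv1// addr_ge0// mnorm_ge0.
    apply: (measurableT_comp (measurable_powR (-1))).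
    by apply: measurable_funD => //; exact: measurable_mnorm.
  exact: (measurableT_comp mi measurable_fst).
apply: measurable_funB => //.
have mm : measurable_fun setT (fun x => gauss_mean (fun u => grad_sample f sigma x u i ord0)).
  apply: measurable_gauss_mean.
  by under eq_fun do rewrite mxE.
exact: (measurableT_comp mm measurable_fst).
Qed.

Lemma measurable_centered_hess_sample :
  measurable_fun setT (fun z => centered_hess_sample z.1 z.2).
Proof.
apply/measurable_fun_matrixP => i j.
have mh : measurable_fun setT (fun z : 'cV[R]_d * 'cV[R]_d => hess_sample f sigma z.1 z.2 i j).
  under eq_fun do rewrite hess_sampleE -scaleNr.
  have m2 (i' : 'I_d) : measurable_fun setT (fun z : 'cV[R]_d * 'cV[R]_d => z.2 i' ord0).
    by apply: measurable_mx_entry; exact: measurable_snd.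
  apply: measurable_funM => //; apply: measurable_funM; last first.
    by apply: measurable_funB => //; exact: measurable_funM.
  apply: measurable_funB.
    by apply: measurable_funD; apply: mfc; exact: mshift.
  by apply: measurable_funM => //; apply: mfc; exact: measurable_fst.
have E z : centered_hess_sample z.1 z.2 i j = hess_sample f sigma z.1 z.2 i j -
    gauss_mean (fun u => hess_sample f sigma z.1 u i j).
  by rewrite (gauss_mean_hess_sample df gradL)// /centered_hess_sample entry_mxB.
under eq_fun do rewrite E.
apply: measurable_funB => //.
have mm := measurable_gauss_mean (h := fun x u => hess_sample f sigma x u i j) mh.
exact: (measurableT_comp mm measurable_fst).
Qed.

Lemma poly_growth_centered_grad x i j :
  poly_growth (fun v => (grad_sample f sigma x v - smooth_grad f sigma x) i j).
Proof.
rewrite (ord1 j).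
have -> : (fun v => (grad_sample f sigma x v - smooth_grad f sigma x) i ord0) =
    (fun v => grad_sample f sigma x v i ord0 - smooth_grad f sigma x i ord0).
  by apply/funext => v; rewrite entry_mxB.
by apply: poly_growthB; [exact: (poly_growth_grad_sample df gradL)|exact: poly_growth_cst].
Qed.

Lemma gauss_mean_centered_grad x i j :
  gauss_mean (fun v => (grad_sample f sigma x v - smooth_grad f sigma x) i j) = 0.
Proof.
rewrite (ord1 j).
have -> : (fun v => (grad_sample f sigma x v - smooth_grad f sigma x) i ord0) =
    (fun v => grad_sample f sigma x v i ord0 - smooth_grad f sigma x i ord0).
  by apply/funext => v; rewrite entry_mxB.
rewrite gauss_meanB; [|exact: (poly_growth_grad_sample df gradL)|exact: poly_growth_cst].
by rewrite (gauss_mean_grad_sample df gradL)// gauss_mean_cst subrr.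
Qed.

Lemma poly_growth_centered_hess x i j : poly_growth (fun v => centered_hess_sample x v i j).
Proof.
have -> : (fun v => centered_hess_sample x v i j) =
    (fun v => hess_sample f sigma x v i j - smooth_hess f sigma x i j).
  by apply/funext => v; rewrite /centered_hess_sample entry_mxB.
by apply: poly_growthB; [exact: (poly_growth_hess_sample df gradL)|exact: poly_growth_cst].
Qed.

Lemma gauss_mean_centered_hess x i j : gauss_mean (fun v => centered_hess_sample x v i j) = 0.
Proof.
have -> : (fun v => centered_hess_sample x v i j) =
    (fun v => hess_sample f sigma x v i j - smooth_hess f sigma x i j).
  by apply/funext => v; rewrite /centered_hess_sample entry_mxB.
rewrite gauss_meanB; [|exact: (poly_growth_hess_sample df gradL)|exact: poly_growth_cst].
by rewrite (gauss_mean_hess_sample df gradL)// gauss_mean_cst subrr.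
Qed.

Lemma poly_growth_normalized_grad x i j :
  poly_growth (fun v => normalized_grad_sample x v i j).
Proof.
have -> : (fun v => normalized_grad_sample x v i j) = (fun v => (1 + mnorm x)^-1 *
    (grad_sample f sigma x v - smooth_grad f sigma x) i j).
  by apply/funext => v; rewrite [LHS]mxE.
by apply: poly_growthZ; exact: poly_growth_centered_grad.
Qed.

Lemma gauss_mean_normalized_grad x i j :
  gauss_mean (fun v => normalized_grad_sample x v i j) = 0.
Proof.
rewrite (@eq_gauss_mean _ _ _ (fun v => (1 + mnorm x)^-1 *
    (grad_sample f sigma x v - smooth_grad f sigma x) i j)); last by move=> v; rewrite [LHS]mxE.
by rewrite gauss_meanZ ?gauss_mean_centered_grad ?mulr0//; exact: poly_growth_centered_grad.
Qed.

(** The variance is at most the second moment. [D0] dominates [|grad f 0|^2] and [L^2], whence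
    [|grad f x| <= sqrt D0 (1 + |x|)]. *)
Lemma normalized_grad_moment2 gamma x : sigma <= gamma ->
  gauss_mean (fun v => mdot (normalized_grad_sample x v) (normalized_grad_sample x v)) <=
  D1 f L gamma.
Proof.
move=> sg; set q := 1 + mnorm x.
have q1 : 1 <= q by rewrite lerDl mnorm_ge0.
have q0 : 0 < q by exact: lt_le_trans q1.
have inc := gauss_mean_increment2 (poly_growth_centered_grad x) (gauss_mean_centered_grad x)
  (smooth_grad f sigma x).
have pcc := poly_growth_mdot_self (poly_growth_centered_grad x).
have v2 : gauss_mean (fun v => mdot (grad_sample f sigma x v - smooth_grad f sigma x)
      (grad_sample f sigma x v - smooth_grad f sigma x)) <=
    L ^+ 2 * (d%:R + 6) ^+ 3 / 2 * sigma ^+ 2 + 2 * (d%:R + 2) * mnorm (gradient f x) ^+ 2.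
  apply: le_trans (grad_sample_moment2 (ltW L0) df gradL x s0).
  move: inc; under eq_gauss_mean do rewrite addrC subrK.
  by move=> ->; rewrite lerDr mdot_ge0.
have -> : gauss_mean (fun v => mdot (normalized_grad_sample x v) (normalized_grad_sample x v)) =
    q ^- 2 * gauss_mean (fun v => mdot (grad_sample f sigma x v - smooth_grad f sigma x)
      (grad_sample f sigma x v - smooth_grad f sigma x)).
  rewrite -gauss_meanZ//; apply: eq_gauss_mean => v.
  by rewrite mdotZl mdotZr mulrA -/q -expr2 exprVn.
rewrite mulrC ler_pdivrMr ?exprn_gt0//; apply: le_trans v2 _.
rewrite /D1; set D := D0 f L.
have D0L : L ^+ 2 <= D by rewrite le_max lexx orbT.
have D0g : mnorm (gradient f 0) ^+ 2 <= D by rewrite /D /D0 enormE le_max lexx.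
have gx : mnorm (gradient f x) ^+ 2 <= D * q ^+ 2.
  have Dp : 0 <= D by apply: le_trans D0L; exact: sqr_ge0.
  have b1 : mnorm (gradient f 0) <= Num.sqrt D.
    by rewrite -(ger0_norm (mnorm_ge0 _)) -sqrtr_sqr ler_sqrt.
  have b2 : L <= Num.sqrt D by rewrite -(gtr0_norm L0) -sqrtr_sqr ler_sqrt.
  have b3 : mnorm (gradient f x) <= Num.sqrt D * q.
    have := mnormD (gradient f x - gradient f 0) (gradient f 0); rewrite subrK.
    have := gradL x 0; rewrite subr0; have := ler_wpM2r (mnorm_ge0 x) b2.
    by rewrite /q mulrDr mulr1; lra.
  rewrite -[D in D * _]sqr_sqrtr// -exprMn lerXn2r// nnegrE ?mnorm_ge0//.
  by rewrite mulr_ge0 ?sqrtr_ge0// ltW.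
have dn : 0 <= d%:R :> R by [].
have q2 : 1 <= q ^+ 2 by rewrite exprn_ege1.
have Dq : 0 <= D * q ^+ 2 by apply: le_trans gx; exact: sqr_ge0.
have t1 : L ^+ 2 * (d%:R + 6) ^+ 3 / 2 * sigma ^+ 2 <= L ^+ 2 * (d%:R + 6) ^+ 3 / 2 * gamma ^+ 2 * q ^+ 2.
  have c0 : 0 <= L ^+ 2 * (d%:R + 6) ^+ 3 / 2.
    by rewrite divr_ge0// mulr_ge0 ?sqr_ge0// exprn_ge0// addr_ge0.
  rewrite -[X in _ <= X]mulrA; apply: ler_wpM2l => //.
  apply: (@le_trans _ _ (gamma ^+ 2)).
    by rewrite lerXn2r// nnegrE ltW// (lt_le_trans s0).
  by rewrite ler_peMr// sqr_ge0.
have t2 : 2 * (d%:R + 2) * mnorm (gradient f x) ^+ 2 <= 4 * (d%:R + 4) * D * q ^+ 2.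
  apply: (@le_trans _ _ (2 * (d%:R + 2) * (D * q ^+ 2))).
    by rewrite ler_wpM2l// mulr_ge0// addr_ge0.
  by rewrite -[X in _ <= X]mulrA; apply: ler_wpM2r => //; lra.
by rewrite [leRHS]mulrDl; apply: lerD.
Qed.

Let c := L * (d%:R + 14) ^+ 2.
Let c0 : 0 < c.
Proof. by rewrite mulr_gt0// exprn_gt0// ltr_wpDl. Qed.

Let phs x : poly_growth (fun v => mdot (hess_sample f sigma x v) (hess_sample f sigma x v)).
Proof.
apply: poly_growth_mdot_self => i j; exact: (poly_growth_hess_sample df gradL).
Qed.

(** Jensen's inequality by way of [t <= t^2 / (2 c^2) + c^2 / 2], from the fourth-moment bound. *)
Let hess_moment2 x :
  gauss_mean (fun v => mdot (hess_sample f sigma x v) (hess_sample f sigma x v)) <= c ^+ 2.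
Proof.
have p2 := poly_growthX 2 (phs x).
apply: (@le_trans _ _ (gauss_mean (fun v => (2 * c ^+ 2)^-1 *
    mdot (hess_sample f sigma x v) (hess_sample f sigma x v) ^+ 2 + c ^+ 2 / 2))).
  apply: le_gauss_mean => //.
    by apply: poly_growthD; [exact: poly_growthZ|exact: poly_growth_cst].
  move=> v; move: (mdot _ _) => t.
  rewrite -subr_ge0 (_ : _ - _ = (2 * c ^+ 2)^-1 * (t - c ^+ 2) ^+ 2).
    by rewrite mulr_ge0 ?sqr_ge0// invr_ge0 mulr_ge0// sqr_ge0.
  by field; rewrite gt_eqF.
rewrite gauss_meanD; [|exact: poly_growthZ|exact: poly_growth_cst].
rewrite gauss_mean_cst gauss_meanZ//.
have m4 := hess_sample_moment4 (ltW L0) df gradL x s0.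
have ci : 0 <= (2 * c ^+ 2)^-1 by rewrite invr_ge0 mulr_ge0// sqr_ge0.
apply: le_trans (lerD (ler_wpM2l ci m4) (lexx _)) _; rewrite -/c.
by rewrite le_eqVlt; apply/orP; left; apply/eqP; field; rewrite gt_eqF.
Qed.

Let hess_variance x :
  gauss_mean (fun v => mdot (hess_sample f sigma x v) (hess_sample f sigma x v)) =
  mdot (smooth_hess f sigma x) (smooth_hess f sigma x) +
  gauss_mean (fun v => mdot (centered_hess_sample x v) (centered_hess_sample x v)).
Proof.
have := gauss_mean_increment2 (poly_growth_centered_hess x) (gauss_mean_centered_hess x)
  (smooth_hess f sigma x).
by move=> <-; apply: eq_gauss_mean => v; rewrite addrC subrK.
Qed.

Lemma centered_hess_moment2 x :
  gauss_mean (fun v => mdot (centered_hess_sample x v) (centered_hess_sample x v)) <=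
  (L * (d%:R + 14) ^+ 2) ^+ 2.
Proof. by apply: le_trans (hess_moment2 x); rewrite hess_variance lerDr mdot_ge0. Qed.

(** [|A - H|^4 <= 8 |A|^4 + 8 |H|^4], and each term has mean at most [8 c^4] because
    [|H|^2 <= E |A|^2 <= c^2]. *)
Lemma centered_hess_moment4 x :
  gauss_mean (fun v => mdot (centered_hess_sample x v) (centered_hess_sample x v) ^+ 2) <=
  16 * (L * (d%:R + 14) ^+ 2) ^+ 4.
Proof.
set H := smooth_hess f sigma x.
have p2 := poly_growthX 2 (phs x).
have H2 : mdot H H <= c ^+ 2.
  apply: le_trans (hess_moment2 x); rewrite hess_variance lerDl.
  by apply: gauss_mean_ge0 => v; exact: mdot_ge0.
have H4 : mdot H H ^+ 2 <= c ^+ 4.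
  by rewrite (exprM c 2 2) lerXn2r// nnegrE ?sqr_ge0// mdot_ge0.
apply: (@le_trans _ _ (gauss_mean (fun v => 8 *
    mdot (hess_sample f sigma x v) (hess_sample f sigma x v) ^+ 2 + 8 * mdot H H ^+ 2))).
  apply: le_gauss_mean.
  - by apply: poly_growthX; apply: poly_growth_mdot_self; exact: poly_growth_centered_hess.
  - by apply: poly_growthD; [exact: poly_growthZ|exact: poly_growth_cst].
  move=> v; rewrite /centered_hess_sample -/H.
  set A := hess_sample f sigma x v.
  have e : mdot (A - H) (A - H) = mdot A A - 2 * mdot A H + mdot H H.
    by rewrite mdotDl !mdotDr !mdotNl !mdotNr (mdotC H A); ring.
  have e' : mdot (A + H) (A + H) = mdot A A + 2 * mdot A H + mdot H H by exact: mdot_sqrD.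
  have := mdot_ge0 (A - H); have := mdot_ge0 (A + H).
  rewrite e e'; have := mdot_ge0 A; have := mdot_ge0 H.
  move: (mdot A A) (mdot A H) (mdot H H) => a b h h0 a0 ab1 ab2.
  apply: (@le_trans _ _ ((2 * a + 2 * h) ^+ 2)).
    by rewrite lerXn2r ?nnegrE//; lra.
  by have := sqr_ge0 (a - h); nra.
rewrite gauss_meanD; [|exact: poly_growthZ|exact: poly_growth_cst].
rewrite gauss_mean_cst gauss_meanZ//.
have := hess_sample_moment4 (ltW L0) df gradL x s0; rewrite -/c; lra.
Qed.

End samples.

Section estimators.
Context {R : realType} {d : nat}.
Variables (f : 'cV[R]_d -> R) (sigma : R).
Hypothesis s0 : sigma != 0.

Lemma grad_estimate_error (n : nat) (u : nat -> 'cV[R]_d) x : (0 < n)%N ->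
  grad_estimate f sigma n u x - smooth_grad f sigma x =
  ((1 + mnorm x) / n%:R) *: \sum_(i < n) normalized_grad_sample f sigma x (u i).
Proof.
move=> n0; have nR : n%:R != 0 :> R by rewrite pnatr_eq0 -lt0n.
have q0 : 1 + mnorm x != 0 by rewrite gt_eqF// ltr_pwDl// mnorm_ge0.
rewrite /normalized_grad_sample -scaler_sumr scalerA.
have -> : (1 + mnorm x) / n%:R * (1 + mnorm x)^-1 = n%:R^-1 by field; rewrite nR q0.
rewrite sumrB scalerBr sumr_const card_ord -[smooth_grad _ _ _ *+ n]scaler_nat scalerA mulVf// scale1r.
congr (_ - _); rewrite /grad_estimate !scaler_sumr; apply: eq_bigr => i _.
by rewrite /grad_sample !scalerA; congr (_ *: _); field; rewrite nR s0.
Qed.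

Lemma hess_estimate_error (n : nat) (u : nat -> 'cV[R]_d) x : (0 < n)%N ->
  hess_estimate f sigma n u x - smooth_hess f sigma x =
  n%:R^-1 *: \sum_(i < n) centered_hess_sample f sigma x (u i).
Proof.
move=> n0; have nR : n%:R != 0 :> R by rewrite pnatr_eq0 -lt0n.
rewrite /centered_hess_sample sumrB scalerBr sumr_const card_ord -[smooth_hess _ _ _ *+ n]scaler_nat scalerA mulVf// scale1r.
congr (_ - _); rewrite /hess_estimate !scaler_sumr; apply: eq_bigr => i _.
by rewrite /hess_sample !scalerA; congr (_ *: _); field; rewrite nR s0.
Qed.

End estimators.

(** * Descent *)

Section deterministic_step.
Context {R : realType} {d : nat}.
Variables (f : 'cV[R]_d -> R) (L : R).
Hypothesis d0 : (0 < d)%N.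
Hypothesis L0 : 0 < L.
Hypothesis df : forall y, differentiable f y.
Hypothesis gradL : forall y z, mnorm (gradient f y - gradient f z) <= L * mnorm (y - z).
Variables (sigma e a c : R).
Hypotheses (s0 : 0 < sigma) (e0 : 0 < e) (a0 : 0 < a) (c0 : 0 < c).
Hypothesis eL : e ^+ 2 <= L * Num.sqrt d%:R / sigma.

(** Budget, with [M = L sqrt d / sigma] and [b = (1 + |x|) |y - x|]: minimality puts the quadratic
    part of the model below [- M b^3 / 6 - M b^3 / 12]. The first part covers the Taylor remainder;
    the second is spent in two shares of [M b^3 / 24] on the gradient and Hessian errors. *)
Lemma smooth_step (x y v : 'cV[R]_d) (H : 'M[R]_d) :
  (forall z, cubic_model L sigma v H x y <= cubic_model L sigma v H x z) ->
  smooth f sigma y <= smooth f sigma x +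
    2 * a ^+ 3 / e *
      (3 / 4 * ((mnorm (v - smooth_grad f sigma x) / (1 + mnorm x)) ^+ 2 / a ^+ 4) + 1 / 4) +
    32 / 3 * c ^+ 3 / e ^+ 4 *
      (3 / 4 * (mnorm (H - smooth_hess f sigma x) ^+ 4 / c ^+ 4) + 1 / 4).
Proof.
move=> Hmin; pose s := y - x.
have ys : y = x + s by rewrite /s addrC subrK.
set q := 1 + mnorm x; have q1 : 1 <= q by rewrite lerDl mnorm_ge0.
have q0 : 0 < q by exact: lt_le_trans q1.
set r := mnorm s; have r0 : 0 <= r by exact: mnorm_ge0.
pose M := L * Num.sqrt d%:R / sigma.
(* A positive dimension makes the coefficient [M] dominate [L / sigma]. *)
have sd : 1 <= Num.sqrt d%:R :> R by rewrite -[leLHS]sqrtr1 ler_sqrt ?ler1n// ltW// ltr0n.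
have M0 : 0 <= M by rewrite divr_ge0 ?(ltW s0)// mulr_ge0 ?(ltW L0)// sqrtr_ge0.
have LM : L / sigma <= M.
  by rewrite ler_wpM2r ?invr_ge0 ?(ltW s0)// ler_peMr// ltW.
(* Minimality is exploited on the line through [x] and [y], where the model has the shape of
   [cubic_min_le]. *)
have model t : cubic_model L sigma v H x (x + t *: s) =
    t * mdot v s + t ^+ 2 * mdot (H *m s) s / 2 + `|t| ^+ 3 * (M / 6 * q ^+ 3 * r ^+ 3).
  have xx : x + t *: s - x = t *: s by rewrite addrAC subrr add0r.
  rewrite /cubic_model xx -scalemxAr !dotcvE !enormE.
  rewrite mdotZr mdotZl mdotZr mnormZ -/q -/r /M.
  by field; rewrite gt_eqF.
have dec : mdot v s + mdot (H *m s) s / 2 + M / 6 * q ^+ 3 * r ^+ 3 <=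
    - (M / 6 * q ^+ 3 * r ^+ 3) / 2.
  apply: cubic_min_le.
    apply: mulr_ge0; last exact: exprn_ge0.
    by apply: mulr_ge0; [exact: divr_ge0|rewrite exprn_ge0// ltW].
  move=> t; rewrite -model; have := model 1; rewrite scale1r -ys.
  by rewrite !expr1n normr1 expr1n !mul1r => <-; exact: Hmin.
have tay := smooth_taylor (ltW L0) df gradL x s s0; rewrite -ys -/r in tay.
set dv := v - smooth_grad f sigma x; set dH := H - smooth_hess f sigma x.
have ev : mdot (smooth_grad f sigma x) s = mdot v s - mdot dv s.
  by rewrite /dv mdotDl mdotNl opprB addrC subrK.
have eH : mdot (smooth_hess f sigma x *m s) s = mdot (H *m s) s - mdot (dH *m s) s.
  by rewrite /dH mulmxBl mdotDl mdotNl opprB addrC subrK.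
have bv : - mdot dv s <= mnorm dv * r by rewrite -mdotNl -[mnorm dv]mnormN; exact: mdot_le.
have bH : - mdot (dH *m s) s <= mnorm dH * r ^+ 2.
  by rewrite -mdotNl -mulNmx -[mnorm dH]mnormN; exact: mdot_mulmx_le.
set b := q * r; have b0 : 0 <= b by rewrite mulr_ge0// ltW.
have rb : r <= b by rewrite ler_peMl.
have yg := young_grad e0 a0 b0 (divr_ge0 (mnorm_ge0 dv) (ltW q0)).
have bb : mnorm dv * r = mnorm dv / q * b by rewrite /b; field; rewrite gt_eqF.
rewrite bb in bv.
have yh := young_hess e0 c0 b0 (mnorm_ge0 dH).
have bH2 : mnorm dH * r ^+ 2 <= mnorm dH * b ^+ 2.
  by rewrite ler_wpM2l ?mnorm_ge0// lerXn2r// nnegrE.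
have eb : e ^+ 2 * b ^+ 3 <= M * b ^+ 3 by rewrite ler_wpM2r// exprn_ge0.
have Lr : L / (6 * sigma) * r ^+ 3 <= M / 6 * b ^+ 3.
  have -> : L / (6 * sigma) = L / sigma / 6 by field; rewrite gt_eqF.
  apply: ler_pM; rewrite ?exprn_ge0 ?divr_ge0 ?(ltW L0) ?(ltW s0)//.
    by rewrite ler_pM2r// invr_gt0.
  by rewrite lerXn2r// nnegrE.
have bq : M / 6 * q ^+ 3 * r ^+ 3 = M * b ^+ 3 / 6 by rewrite /b; field.
rewrite bq in dec.
have Mb : M / 6 * b ^+ 3 = M * b ^+ 3 / 6 by field.
rewrite Mb in Lr.
rewrite ev eH in tay.
move: tay dec bv bH yg yh bH2 eb Lr; clear.
move: (smooth f sigma y) (smooth f sigma x) (mdot v s) (mdot (H *m s) s) (mdot dv s)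
  (mdot (dH *m s) s) (mnorm dv / q * b) (mnorm dH * r ^+ 2) (mnorm dH * b ^+ 2)
  (M * b ^+ 3) (e ^+ 2 * b ^+ 3) (L / (6 * sigma) * r ^+ 3)
  (2 * a ^+ 3 / e * (3 / 4 * ((mnorm dv / q) ^+ 2 / a ^+ 4) + 1 / 4))
  (32 / 3 * c ^+ 3 / e ^+ 4 * (3 / 4 * (mnorm dH ^+ 4 / c ^+ 4) + 1 / 4)).
move=> p1 p2 p3 p4 p5 p6 p7 p8 p9 p10 p11 p12 p13 p14; lra.
Qed.

End deterministic_step.

Section expected_step.
Context {R : realType} {d : nat} {disp : measure_display} {Omega : measurableType disp}.
Variable P : probability Omega R.
Variables (f : 'cV[R]_d -> R) (L gamma mu : R).
Hypothesis d0 : (0 < d)%N.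
Hypothesis L0 : 0 < L.
Hypothesis df : forall y, differentiable f y.
Hypothesis gradL : forall y z, mnorm (gradient f y - gradient f z) <= L * mnorm (y - z).
Hypothesis f_ge : forall y, 0 <= f y + mu.
Variables (sigma e a c : R).
Hypotheses (s0 : 0 < sigma) (sg : sigma <= gamma) (e0 : 0 < e) (a0 : 0 < a) (c0 : 0 < c).
Hypothesis eL : e ^+ 2 <= L * Num.sqrt d%:R / sigma.
Variables (X X' : {RV P >-> 'cV[R]_d}) (U : nat -> {RV P >-> 'cV[R]_d}) (N n J : nat).
Hypotheses (n0 : (0 < n)%N) (J0 : (0 < J)%N) (nN : (n <= N)%N) (JN : (J <= N)%N).
Hypothesis aD : D1 f L gamma <= n%:R * a ^+ 4.
Hypothesis cD : 64 * (L * (d%:R + 14) ^+ 2) ^+ 4 <= J%:R ^+ 2 * c ^+ 4.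
Hypothesis indXU : forall (A : set 'cV[R]_d) (B : nat -> set 'cV[R]_d),
  measurable A -> (forall i, measurable (B i)) ->
  P (X @^-1` A `&` \bigcap_(i in [set i | (i < N)%N]) (U i @^-1` B i))
  = (P (X @^-1` A) * \prod_(i < N) P (U i @^-1` B i))%E.
Hypothesis lawU : forall i, (i < N)%N -> forall A : set 'cV[R]_d, measurable A ->
  distribution P (U i) A = std_gaussian d A.
Hypothesis stepX : forall w y,
  let v := grad_estimate f sigma n (fun i => U i w) (X w) in
  let H := hess_estimate f sigma J (fun i => U i w) (X w) in
  cubic_model L sigma v H (X w) (X' w) <= cubic_model L sigma v H (X w) y.

Lemma smooth_ge (s : R) y : 0 <= smooth f s y + mu.
Proof.
rewrite -[mu](gauss_mean_cst (n := d)) -gauss_meanD; last exact: poly_growth_cst.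
- by apply: gauss_mean_ge0 => u; exact: f_ge.
- exact: (poly_growth_smooth df gradL).
Qed.

(** [aD] and [cD] ensure that the averaged errors satisfy [E[y^2] <= a^4] and [E[z^4] <= c^4], so
    each affine bracket of [smooth_step] has mean at most 3/4 + 1/4. The 64 is the 4 of
    [sample_sum_moment4] times the 16 of [centered_hess_moment4]. *)
Lemma expected_smooth_step :
  (\int[P]_w (smooth f sigma (X' w) + mu)%:E <=
   \int[P]_w (smooth f sigma (X w) + mu)%:E +
     (2 * a ^+ 3 / e + 32 / 3 * c ^+ 3 / e ^+ 4)%:E)%E.
Proof.
have mF := measurable_normalized_grad_sample df gradL s0.
have mG := measurable_centered_hess_sample df gradL s0.
have C0 : 0 <= (L * (d%:R + 14) ^+ 2) by rewrite mulr_ge0 ?(ltW L0)// exprn_ge0// addr_ge0.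
pose C := L * (d%:R + 14) ^+ 2; have cD' : 64 * C ^+ 4 <= J%:R ^+ 2 * c ^+ 4 := cD.
rewrite -/C in C0.
pose S := sample_sum X U (normalized_grad_sample f sigma) n.
pose T := sample_sum X U (centered_hess_sample f sigma) J.
have ES : (\int[P]_w (mdot (S w) (S w))%:E <= (n%:R * D1 f L gamma)%:E)%E.
  apply: (sample_sum_moment2 indXU lawU mF) => //.
  - exact: poly_growth_normalized_grad.
  - exact: gauss_mean_normalized_grad.
  - by move=> x; exact: normalized_grad_moment2.
have ET : (\int[P]_w (mdot (T w) (T w) ^+ 2)%:E <= (4 * J%:R ^+ 2 * (16 * C ^+ 4))%:E)%E.
  apply: (sample_sum_moment4 indXU lawU mG (m2 := C ^+ 2)) => //.
  - exact: poly_growth_centered_hess.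
  - exact: gauss_mean_centered_hess.
  - exact: centered_hess_moment2.
  - exact: centered_hess_moment4.
  - rewrite -exprM; have : 0 <= C ^+ 4 by exact: exprn_ge0.
    lra.
pose K1 := 2 * a ^+ 3 / e; pose K2 := 32 / 3 * c ^+ 3 / e ^+ 4.
have K10 : 0 <= K1 by rewrite /K1 divr_ge0 ?mulr_ge0 ?exprn_ge0// ltW.
have K20 : 0 <= K2 by rewrite /K2 divr_ge0 ?exprn_ge0 ?mulr_ge0 ?exprn_ge0// ltW.
have nR : 0 < n%:R :> R by rewrite ltr0n.
have JR : 0 < J%:R :> R by rewrite ltr0n.
pose k1 := K1 * (3 / 4) / (n%:R ^+ 2 * a ^+ 4).
pose k2 := K2 * (3 / 4) / (J%:R ^+ 4 * c ^+ 4).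
pose k0 := (K1 + K2) / 4.
have na4 : 0 < n%:R ^+ 2 * a ^+ 4 by rewrite mulr_gt0 ?exprn_gt0.
have Jc4 : 0 < J%:R ^+ 4 * c ^+ 4 by rewrite mulr_gt0 ?exprn_gt0.
have k10 : 0 <= k1 by rewrite /k1 divr_ge0 ?(ltW na4)// mulr_ge0.
have k20 : 0 <= k2 by rewrite /k2 divr_ge0 ?(ltW Jc4)// mulr_ge0.
have k00 : 0 <= k0 by rewrite divr_ge0// addr_ge0.
have pw w : smooth f sigma (X' w) + mu <= (smooth f sigma (X w) + mu) +
    (k1 * mdot (S w) (S w) + (k2 * mdot (T w) (T w) ^+ 2 + k0)).
  have st := smooth_step d0 L0 df gradL s0 e0 a0 c0 eL (stepX w).
  rewrite (grad_estimate_error _ (lt0r_neq0 s0) _ _ n0) in st.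
  rewrite (hess_estimate_error _ (lt0r_neq0 s0) _ _ J0) in st.
  have q0 : 0 < 1 + mnorm (X w) by rewrite ltr_pwDl// mnorm_ge0.
  have e1 : mnorm (((1 + mnorm (X w)) / n%:R) *: S w) / (1 + mnorm (X w)) =
      mnorm (S w) / n%:R.
    rewrite mnormZ ger0_norm; last by rewrite divr_ge0// ltW.
    by field; rewrite !gt_eqF.
  rewrite -/(sample_sum X U (normalized_grad_sample f sigma) n w) in st.
  rewrite -/(sample_sum X U (centered_hess_sample f sigma) J w) in st.
  rewrite -/(S w) -/(T w) e1 in st.
  rewrite mnormZ ger0_norm in st; last by rewrite invr_ge0.
  have e2 : K1 * (3 / 4 * ((mnorm (S w) / n%:R) ^+ 2 / a ^+ 4) + 1 / 4) =
      k1 * mdot (S w) (S w) + K1 / 4.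
    by rewrite /k1 -sqr_mnorm; field; rewrite !gt_eqF.
  have e3 : K2 * (3 / 4 * ((J%:R^-1 * mnorm (T w)) ^+ 4 / c ^+ 4) + 1 / 4) =
      k2 * mdot (T w) (T w) ^+ 2 + K2 / 4.
    by rewrite /k2 -sqr_mnorm; field; rewrite !gt_eqF.
  by move: st; rewrite -/K1 -/K2 e2 e3 /k0; lra.
have msm : measurable_fun setT (smooth f sigma) by exact: measurable_smooth.
have mX (Z : {RV P >-> 'cV[R]_d}) : measurable_fun setT (fun w => (smooth f sigma (Z w) + mu)%:E).
  apply/measurable_EFinP; apply: measurable_funD => //.
  exact: (measurableT_comp msm (measurable_funPT Z)).
have mS : measurable_fun setT (fun w => (mdot (S w) (S w))%:E).
  by apply/measurable_EFinP; apply: measurable_mdot_fun; exact: measurable_sample_sum.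
have mT : measurable_fun setT (fun w => (mdot (T w) (T w) ^+ 2)%:E).
  apply/measurable_EFinP; apply: measurable_funX.
  by apply: measurable_mdot_fun; exact: measurable_sample_sum.
have mkS : measurable_fun setT (fun w => k1%:E * (mdot (S w) (S w))%:E)%E.
  exact: emeasurable_funM.
have mkT : measurable_fun setT (fun w => k2%:E * (mdot (T w) (T w) ^+ 2)%:E)%E.
  exact: emeasurable_funM.
apply: (@le_trans _ _ (\int[P]_w ((smooth f sigma (X w) + mu)%:E +
    (k1%:E * (mdot (S w) (S w))%:E + (k2%:E * (mdot (T w) (T w) ^+ 2)%:E + k0%:E))))%E).
  apply: ge0_le_integral => //.
  - by move=> w _; rewrite lee_fin smooth_ge.
  - by apply: emeasurable_funD => //; apply: emeasurable_funD => //; exact: emeasurable_funD.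
  - by move=> w _; rewrite -!EFinM -!EFinD lee_fin; exact: pw.
have S0 w : (0 <= k1%:E * (mdot (S w) (S w))%:E)%E.
  by rewrite -EFinM lee_fin mulr_ge0// mdot_ge0.
have T0 w : (0 <= k2%:E * (mdot (T w) (T w) ^+ 2)%:E)%E.
  by rewrite -EFinM lee_fin mulr_ge0// sqr_ge0.
have k00E : (0 <= k0%:E)%E by rewrite lee_fin.
rewrite ge0_integralD//; last 3 first.
- by move=> w _; rewrite lee_fin smooth_ge.
- by move=> w _; rewrite !adde_ge0.
- by apply: emeasurable_funD => //; exact: emeasurable_funD.
apply: leeD => //.
rewrite ge0_integralD//; last 2 first.
- by move=> w _; rewrite adde_ge0.
- exact: emeasurable_funD.
rewrite ge0_integralD// integral_probability_cst.
rewrite !ge0_integralZl//; try by [rewrite lee_fin | move=> w _; rewrite lee_fin ?mdot_ge0 ?sqr_ge0].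
have k1E : (0 <= k1%:E)%E by rewrite lee_fin.
have k2E : (0 <= k2%:E)%E by rewrite lee_fin.
apply: (@le_trans _ _ (k1%:E * (n%:R * D1 f L gamma)%:E + (k2%:E * (4 * J%:R ^+ 2 * (16 * C ^+ 4))%:E + k0%:E))%E).
  by apply: leeD; [exact: lee_wpmul2l|apply: leeD => //; exact: lee_wpmul2l].
rewrite -!EFinM -!EFinD lee_fin.
have h1 : k1 * (n%:R * D1 f L gamma) <= 3 / 4 * K1.
  apply: (@le_trans _ _ (k1 * (n%:R * (n%:R * a ^+ 4)))).
    by do 2 (apply: ler_wpM2l => //); exact: ltW.
  by rewrite le_eqVlt; apply/orP; left; apply/eqP; rewrite /k1; field; rewrite !gt_eqF.
have h2 : k2 * (4 * J%:R ^+ 2 * (16 * C ^+ 4)) <= 3 / 4 * K2.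
  have -> : 4 * J%:R ^+ 2 * (16 * C ^+ 4) = J%:R ^+ 2 * (64 * C ^+ 4) by ring.
  apply: (@le_trans _ _ (k2 * (J%:R ^+ 2 * (J%:R ^+ 2 * c ^+ 4)))).
    by do 2 (apply: ler_wpM2l => //); exact: sqr_ge0.
  by rewrite le_eqVlt; apply/orP; left; apply/eqP; rewrite /k2; field; rewrite !gt_eqF.
rewrite -/K1 -/K2; rewrite /k0; lra.
Qed.

End expected_step.

(** * Batch sizes and smoothing radii *)

Section parameters.
Context {R : realType}.
Implicit Types (x r p : R).

Lemma exprn_powR x p n : (x `^ p) ^+ n = x `^ (p * n%:R).
Proof. by rewrite -powR_mulrn ?powR_ge0// -powRrM. Qed.

Lemma powR_mulDr x r p : 0 < x -> x `^ r * x `^ p = x `^ (r + p).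
Proof. by move=> x0; rewrite powRD//; apply/implyP => _; rewrite gt_eqF. Qed.

Lemma le_ceil_absz x : x <= `|Num.ceil x|%N%:R.
Proof.
apply: le_trans (ceil_ge x) _.
by rewrite pmulrn ler_int abszE ler_norm.
Qed.

Lemma n_grad_ge (beta : R) k : k.+1%:R `^ (4 / 3 * beta) <= (n_grad beta k)%:R.
Proof. exact: le_ceil_absz. Qed.

Lemma n_hess_ge (alpha : R) k : k.+1%:R `^ (2 / 3 * alpha) <= (n_hess alpha k)%:R.
Proof. exact: le_ceil_absz. Qed.

Lemma n_grad_gt0 (beta : R) k : (0 < n_grad beta k)%N.
Proof. by rewrite -(ltr0n R); apply: lt_le_trans (n_grad_ge beta k); rewrite powR_gt0. Qed.

Lemma n_hess_gt0 (alpha : R) k : (0 < n_hess alpha k)%N.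
Proof. by rewrite -(ltr0n R); apply: lt_le_trans (n_hess_ge alpha k); rewrite powR_gt0. Qed.

Section smoothing_parameter.
Variables rho gamma : R.
Hypotheses (rho0 : 0 < rho) (gamma0 : 0 < gamma).

Lemma smoothing_gt0 k : 0 < smoothing rho gamma k.
Proof. by rewrite /smoothing; case: k => [|k] //=; rewrite mulr_gt0// powR_gt0. Qed.

Lemma smoothing_decr k : smoothing rho gamma k.+1 <= smoothing rho gamma k.
Proof.
rewrite /smoothing/=; case: k => [|k] /=; first by rewrite powR1 mulr1.
rewrite ler_wpM2l ?(ltW gamma0)// !powRN lef_pV2 ?posrE ?powR_gt0//.
by rewrite ge0_ler_powR ?nnegrE// ?ler_nat// ltW.
Qed.

Lemma smoothing_le k : smoothing rho gamma k <= gamma.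
Proof. by elim: k => [|k IH] //; apply: le_trans (smoothing_decr k) IH. Qed.

(** The shift from [k] to [k + 1] costs [2^rho], as [k + 1 <= 2 k] for [k >= 1]; in return one power
    of [k + 1] covers [k = 0] as well. *)
Lemma smoothing_le_powR k :
  smoothing rho gamma k <= gamma * 2 `^ rho * k.+1%:R `^ (- rho).
Proof.
rewrite -mulrA; case: k => [|k]; rewrite /smoothing/=.
  rewrite powR1 mulr1 ler_peMr ?(ltW gamma0)// -[leLHS](powRr0 2).
  by rewrite ler_powR ?ler1n// ltW.
rewrite ler_wpM2l ?(ltW gamma0)// !powRN ler_pdivlMr ?powR_gt0//.
rewrite ler_pdivrMl ?powR_gt0// -powRM//.
have k2 : k.+2%:R <= 2 * k.+1%:R :> R.
  by rewrite -!natr1; have : 0 <= k%:R :> R by []; lra.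
apply: ge0_ler_powR; rewrite ?nnegrE ?mulr_ge0 ?(ltW rho0)//; lra.
Qed.

End smoothing_parameter.

End parameters.

Section iterates.
Context {R : realType} {d : nat} {disp : measure_display} {Omega : measurableType disp}.
Variable P : probability Omega R.
Variables (f : 'cV[R]_d -> R) (L alpha beta rho gamma : R) (x0 : 'cV[R]_d).
Variables (x : nat -> {RV P >-> 'cV[R]_d}) (u : nat -> nat -> {RV P >-> 'cV[R]_d}).
Hypothesis zo : zo_cubic_newton f L alpha beta rho gamma x0 x u.

(** The iterate belongs to the past and the batch is internally independent; together they give the
    joint product rule [indXU]. *)
Lemma iterate_indep_samples k (A : set 'cV[R]_d) (B : nat -> set 'cV[R]_d) :
  measurable A -> (forall i, measurable (B i)) ->
  P (x k @^-1` A `&`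
     \bigcap_(i in [set i | (i < n_samples alpha beta k)%N]) (u k i @^-1` B i))
  = (P (x k @^-1` A) * \prod_(i < n_samples alpha beta k) P (u k i @^-1` B i))%E.
Proof.
move=> mA mB; rewrite -(zo_iid zo _ mB).
have pA : past_events alpha beta x u k (x k @^-1` A).
  apply: sub_sigma_algebra; left; exists k => //=; exists A => //.
  by rewrite setTI.
pose E := \bigcap_(i in [set i | (i < n_samples alpha beta k)%N]) (u k i @^-1` B i).
have bB : batch_events alpha beta u k E.
  pose G := \bigcup_(i in [set i | (i < n_samples alpha beta k)%N]) rv_events (u k i).
  suff : G.-sigma.-measurable E by [].
  apply: fin_bigcap_measurable; first exact: finite_II.
  move=> i iN; apply: sub_sigma_algebra; exists i => //; exists (B i) => //.
  by rewrite setTI.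
exact: (zo_indep_past zo pA bB).
Qed.

Hypothesis d0 : (0 < d)%N.
Hypothesis L0 : 0 < L.
Hypothesis df : forall y, differentiable f y.
Hypothesis gradL : forall y z, mnorm (gradient f y - gradient f z) <= L * mnorm (y - z).
Hypotheses (gamma0 : 0 < gamma) (rho0 : 0 < rho) (rho12 : rho < 1 / 2).
Variable mu : R.
Hypothesis f_ge : forall y, 0 <= f y + mu.

Notation sg := (smoothing rho gamma).

(** [A4] and [A5] are [D4] and [D5] without the factor that bounds the series. *)
Let A4 := 2 `^ (rho / 2 + 1) * gamma `^ (1 / 2) * D1 f L gamma `^ (3 / 4)
    / (L `^ (1 / 2) * d%:R `^ (1 / 4)).
Let A5 := 384 * gamma ^+ 2 * D3 d L / (L ^+ 2 * d%:R).

Let dR : 0 < d%:R :> R. Proof. by rewrite ltr0n. Qed.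

Let D1_gt0 : 0 < D1 f L gamma.
Proof.
have D00 : 0 < D0 f L by rewrite lt_max (exprn_gt0 2 L0) orbT.
have c1 : 0 <= L ^+ 2 * (d%:R + 6) ^+ 3 / 2.
  by rewrite divr_ge0// mulr_ge0 ?sqr_ge0// exprn_ge0// addr_ge0.
have c2 : 0 < 4 * (d%:R + 4) :> R by rewrite mulr_gt0// addr_gt0.
by rewrite /D1 ltr_wpDl ?mulr_gt0// mulr_ge0// sqr_ge0.
Qed.

(* The Young parameters [a], [c], [e] of [smooth_step] are chosen so that all
   three error terms are pure powers of [k + 1]. *)
Lemma iterate_step k :
  (\int[P]_w (smooth f (sg k) (x k.+1 w) + mu)%:E <=
   \int[P]_w (smooth f (sg k) (x k w) + mu)%:E +
     (A4 * k.+1%:R `^ (- (beta + rho / 2)) + A5 * k.+1%:R `^ (- (alpha + 2 * rho)))%:E)%E.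
Proof.
set K : R := k.+1%:R; have K0 : 0 < K by [].
pose C := L * (d%:R + 14) ^+ 2.
have C0 : 0 < C by rewrite mulr_gt0// exprn_gt0// ltr_wpDl.
(* [a^4] is [D1] over the lower bound for [n_grad]; the 3 in [c] gives [3^4 = 81 >= 64]; [e^2] is
   [L sqrt d / sg k] with [sg k] replaced by the bound of [smoothing_le_powR]. *)
pose a := D1 f L gamma `^ (1 / 4) * K `^ (- (beta / 3)).
pose c := 3 * C * K `^ (- (alpha / 3)).
pose e := L `^ (1 / 2) * d%:R `^ (1 / 4) / (gamma `^ (1 / 2) * 2 `^ (rho / 2) * K `^ (- (rho / 2))).
have a0 : 0 < a by rewrite mulr_gt0 ?powR_gt0.
have c0 : 0 < c by rewrite !mulr_gt0 ?powR_gt0.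
have p20 (p : R) : 0 < (2 : R) `^ p by exact: powR_gt0.
have e0 : 0 < e by rewrite divr_gt0 ?mulr_gt0 ?powR_gt0.
have s0 := smoothing_gt0 rho gamma0 k.
have eL : e ^+ 2 <= L * Num.sqrt d%:R / sg k.
  have -> : e ^+ 2 = L * Num.sqrt d%:R / (gamma * 2 `^ rho * K `^ (- rho)).
    rewrite /e expr_div_n !exprMn !exprn_powR -powR12_sqrt ?(ltW dR)//.
    have E1 (y : R) : 0 <= y -> y `^ (1 / 2 * 2%:R) = y.
      by move=> y0; rewrite (_ : 1 / 2 * 2%:R = 1) ?powRr1//; field.
    rewrite !E1 ?ltW//; congr (_ * _ `^ _ / (_ * _ `^ _ * _ `^ _)); by field.
  rewrite ler_wpM2l ?mulr_ge0 ?sqrtr_ge0 ?(ltW L0)//.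
  rewrite lef_pV2 ?posrE ?mulr_gt0 ?powR_gt0//.
  exact: smoothing_le_powR.
have a4 : a ^+ 4 = D1 f L gamma * K `^ (- (4 / 3 * beta)).
  rewrite /a exprMn !exprn_powR; congr (_ * _ `^ _); last by field.
  by rewrite (_ : 1 / 4 * 4%:R = 1) ?powRr1 ?(ltW D1_gt0)//; field.
have aD : D1 f L gamma <= (n_grad beta k)%:R * a ^+ 4.
  rewrite a4 mulrCA ler_peMr ?(ltW D1_gt0)// powRN.
  by rewrite ler_pdivlMr ?powR_gt0// mul1r n_grad_ge.
have c4 : c ^+ 4 = 81 * C ^+ 4 * K `^ (- (4 / 3 * alpha)).
  rewrite /c !exprMn exprn_powR; congr (_ * _ * _ `^ _); last by field.
  by ring.
have cD : 64 * C ^+ 4 <= (n_hess alpha k)%:R ^+ 2 * c ^+ 4.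
  rewrite c4 mulrCA.
  have : 1 <= (n_hess alpha k)%:R ^+ 2 * K `^ (- (4 / 3 * alpha)).
    rewrite powRN ler_pdivlMr ?powR_gt0// mul1r.
    apply: (@le_trans _ _ ((K `^ (2 / 3 * alpha)) ^+ 2)).
      by rewrite exprn_powR le_eqVlt; apply/orP; left; apply/eqP; congr (_ `^ _); field.
    by rewrite lerXn2r ?nnegrE ?powR_ge0// n_hess_ge.
  have C4 : 0 <= C ^+ 4 by rewrite exprn_ge0// ltW.
  by move=> /(ler_wpM2l C4); lra.
have st := expected_smooth_step d0 L0 df gradL f_ge s0 (smoothing_le rho0 gamma0 k) e0 a0 c0 eL
  (n_grad_gt0 beta k) (n_hess_gt0 alpha k) (leq_maxl _ _) (leq_maxr _ _) aD cD
  (@iterate_indep_samples k) (fun i iN => zo_gaussian zo iN) (zo_step zo k).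
apply: le_trans st _; apply: leeD => //; rewrite lee_fin; apply: lerD.
  rewrite le_eqVlt; apply/orP; left; apply/eqP.
  have -> : a ^+ 3 = D1 f L gamma `^ (3 / 4) * K `^ (- beta).
    by rewrite /a exprMn !exprn_powR; congr (_ `^ _ * _ `^ _); field.
  have -> : - (beta + rho / 2) = - beta + - (rho / 2) by ring.
  rewrite -powR_mulDr// /A4 -(powR_mulDr (rho / 2) 1)// powRr1// /e.
  by field; rewrite !gt_eqF// powR_gt0.
have -> : c ^+ 3 = 27 * C ^+ 3 * K `^ (- alpha).
  rewrite /c !exprMn exprn_powR; congr (_ * _ * _ `^ _); last by field.
  by ring.
have e4 : e ^+ 4 = L ^+ 2 * d%:R / (gamma ^+ 2 * 2 `^ (2 * rho) * K `^ (- (2 * rho))).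
  rewrite /e expr_div_n !exprMn !exprn_powR.
  have -> : 1 / 4 * 4%:R = 1 :> R by field.
  rewrite (powRr1 (ltW dR)) -!powR_mulrn ?(ltW L0) ?(ltW gamma0)//.
  by congr (_ `^ _ * _ / (_ `^ _ * _ `^ _ * _ `^ _)); field.
have -> : - (alpha + 2 * rho) = - alpha + - (2 * rho) by ring.
rewrite -powR_mulDr// e4.
(* Here [rho < 1/2] enters: the factor [2^(2 rho)] turns 288 into at most 576. *)
have r2 : 2 `^ (2 * rho) <= (2 : R).
  rewrite -[leRHS]powRr1//; have h : 2 * rho <= 1 by have := rho12; lra.
  by rewrite ler_powR ?ler1n.
(* Fits the constant obtained here into [D3]: [d >= 1] gives [(d + 14)^2 <= 4 d (d + 9)^2], and 384
   times 3/2 is 576. *)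
have D3C : 576 * C ^+ 3 <= 384 * D3 d L.
  have dn : 1 <= d%:R :> R by rewrite ler1n.
  have L3 : 0 <= L ^+ 3 by rewrite exprn_ge0// ltW.
  have core : (d%:R + 14) ^+ 2 * (d%:R + 14) ^+ 4 <=
      4 * d%:R * (d%:R + 9) ^+ 2 * (d%:R + 16) ^+ 4 :> R.
    apply: ler_pM.
    - exact: sqr_ge0.
    - by rewrite exprn_ge0// addr_ge0.
    - by nra.
    - by rewrite lerXn2r ?nnegrE ?addr_ge0// lerD2l ler_nat.
  have -> : C ^+ 3 = L ^+ 3 * ((d%:R + 14) ^+ 2 * (d%:R + 14) ^+ 4) by rewrite /C; ring.
  have -> : D3 d L = 3 / 2 * (L ^+ 3 * (4 * d%:R * (d%:R + 9) ^+ 2 * (d%:R + 16) ^+ 4)).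
    by rewrite /D3; field.
  move: (ler_wpM2l L3 core); move: (L ^+ 3 * _) (L ^+ 3 * _) => p1 p2; lra.
have W0 : 0 <= gamma ^+ 2 / (L ^+ 2 * d%:R) * (K `^ (- alpha) * K `^ (- (2 * rho))).
  apply: mulr_ge0; last by rewrite mulr_ge0 ?powR_ge0.
  by rewrite divr_ge0 ?sqr_ge0// mulr_ge0 ?sqr_ge0.
have C3 : 0 <= C ^+ 3 by rewrite exprn_ge0// ltW.
have -> : 32 / 3 * (27 * C ^+ 3 * K `^ (- alpha)) /
    (L ^+ 2 * d%:R / (gamma ^+ 2 * 2 `^ (2 * rho) * K `^ (- (2 * rho)))) =
    (288 * C ^+ 3 * 2 `^ (2 * rho)) *
      (gamma ^+ 2 / (L ^+ 2 * d%:R) * (K `^ (- alpha) * K `^ (- (2 * rho)))).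
  by field; rewrite !gt_eqF// powR_gt0.
have -> : A5 * (K `^ (- alpha) * K `^ (- (2 * rho))) = 384 * D3 d L *
      (gamma ^+ 2 / (L ^+ 2 * d%:R) * (K `^ (- alpha) * K `^ (- (2 * rho)))).
  by rewrite /A5; ring.
apply: ler_wpM2r => //; apply: le_trans D3C.
by have := ler_wpM2l C3 r2; lra.
Qed.

(** Each index change has two halves: [iterate_step] moves the point at a fixed radius, then
    [smooth_decr] lowers the radius at a fixed point. *)
Lemma iterate_bound k :
  (\int[P]_w (smooth f (sg k) (x k w) + mu)%:E <=
   (smooth f gamma x0 + mu +
     \sum_(j < k) (A4 * j.+1%:R `^ (- (beta + rho / 2)) + A5 * j.+1%:R `^ (- (alpha + 2 * rho))) +
     L * d%:R / 2 * (gamma ^+ 2 - sg k ^+ 2))%:E)%E.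
Proof.
elim: k => [|k IH].
  under eq_integral do rewrite (zo_init zo).
  by rewrite integral_probability_cst big_ord0 addr0 /smoothing/= subrr mulr0 addr0.
have mX (s : R) (Z : {RV P >-> 'cV[R]_d}) :
    measurable_fun setT (fun w => (smooth f s (Z w) + mu)%:E).
  apply/measurable_EFinP; apply: measurable_funD => //.
  exact: (measurableT_comp (measurable_smooth df gradL s) (measurable_funPT Z)).
have sge s y : 0 <= smooth f s y + mu by exact: smooth_ge df gradL f_ge s y.
set dd := L * d%:R / 2 * (sg k ^+ 2 - sg k.+1 ^+ 2).
have sk0 := ltW (smoothing_gt0 rho gamma0 k.+1).
have sdec := smoothing_decr rho0 gamma0 k.
have dd0 : 0 <= dd.
  rewrite mulr_ge0 ?divr_ge0 ?mulr_ge0 ?(ltW L0)// subr_ge0 lerXn2r// nnegrE.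
  exact: le_trans sdec.
apply: (@le_trans _ _ (\int[P]_w ((smooth f (sg k) (x k.+1 w) + mu)%:E + dd%:E))%E).
  apply: ge0_le_integral => //.
  - by move=> w _; rewrite lee_fin.
  - exact: emeasurable_funD.
  - move=> w _; rewrite -EFinD lee_fin.
    by have := smooth_decr df gradL (x k.+1 w) sk0 sdec; rewrite -/dd; lra.
rewrite ge0_integralD//; last by move=> w _; rewrite lee_fin.
rewrite integral_probability_cst.
apply: le_trans (leeD (iterate_step k) (lexx _)) _.
apply: le_trans (leeD (leeD IH (lexx _)) (lexx _)) _.
rewrite -!EFinD lee_fin big_ord_recr/= /dd.
by rewrite le_eqVlt; apply/orP; left; apply/eqP; ring.
Qed.

End iterates.

(** * From smoothed values to moments of the iterates *)

(** As [s <= 1], [|x| <= |x + s v| + |v|] for every [v]. After taking powers and averaging over [v],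
    the growth of [f] bounds the first term directly by the smoothing, and the second is a Gaussian
    moment; this avoids comparing [f x] with [smooth f s x]. *)
Lemma mnorm_powR_le_smooth (R : realType) (d : nat) (f : 'cV[R]_d -> R) (L theta mu1 mu2 s : R) x :
  (forall y, differentiable f y) ->
  (forall y z, mnorm (gradient f y - gradient f z) <= L * mnorm (y - z)) ->
  0 < theta -> 0 < mu1 -> (forall y, mu1 * mnorm y `^ theta - mu2 <= f y) ->
  0 <= s <= 1 ->
  mnorm x `^ theta <= Num.max (2 `^ (theta - 1)) 1 * mu1^-1 *
    ((smooth f s x + mu2) + mu1 * (theta + d%:R) `^ (theta / 2)).
Proof.
move=> df gradL t0 m10 fge /andP[s0 s1].
set M := Num.max _ _; have M0 : 0 <= M by rewrite le_max ler01 orbT.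
have pt := poly_growth_mnorm_powR (d := d) t0.
have ps := poly_growth_smooth df gradL x s.
have pc (r : R) := poly_growth_cst (n := d) r.
have step1 : gauss_mean (fun _ : 'cV[R]_d => mnorm x `^ theta) <=
    gauss_mean (fun v => M * mu1^-1 * (f (x + s *: v) + mu2) + M * mnorm v `^ theta).
  apply: le_gauss_mean => //.
    by apply: poly_growthD; apply: poly_growthZ => //; exact: poly_growthD.
  move=> v; have := mnormD (x + s *: v) (- (s *: v)); rewrite addrK mnormN mnormZ ger0_norm// => tri.
  have le1 : mnorm x <= mnorm (x + s *: v) + mnorm v.
    by apply: le_trans tri _; rewrite lerD2l ler_piMl// mnorm_ge0.
  apply: (@le_trans _ _ ((mnorm (x + s *: v) + mnorm v) `^ theta)).
    by rewrite ge0_ler_powR ?nnegrE ?addr_ge0 ?mnorm_ge0// ltW.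
  apply: le_trans (powR_add_le t0 (mnorm_ge0 _) (mnorm_ge0 _)) _; rewrite -/M.
  rewrite mulrDr -mulrA lerD2r ler_wpM2l// ler_pdivlMl//.
  by have := fge (x + s *: v); lra.
rewrite gauss_mean_cst gauss_meanD in step1; last 2 first.
- by apply: poly_growthZ; exact: poly_growthD.
- exact: poly_growthZ.
rewrite !gauss_meanZ// in step1; last exact: poly_growthD.
rewrite gauss_meanD// gauss_mean_cst -/(smooth f s x) in step1.
apply: le_trans step1 _; rewrite [leRHS]mulrDr lerD2l -mulrA ler_wpM2l// mulKf ?gt_eqF//.
exact: gauss_mean_mnorm_powR.
Qed.

Theorem proposition4p1 (R : realType) (d : nat)
    (disp : measure_display) (Omega : measurableType disp)
    (P : probability Omega R)
    (f : 'cV[R]_d -> R) (L alpha beta rho gamma theta mu1 mu2 : R)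
    (x0 : 'cV[R]_d)
    (x : nat -> {RV P >-> 'cV[R]_d}) (u : nat -> nat -> {RV P >-> 'cV[R]_d}) :
  (0 < d)%N ->
  0 < L ->
  (forall y, differentiable f y) ->
  (forall y z, enorm (gradient f y - gradient f z) <= L * enorm (y - z)) ->
  (-oo < ereal_inf (range (fun y => (f y)%:E)))%E ->
  0 < alpha -> 0 < beta -> 0 < gamma < 1 ->
  0 < rho < 1 / 2 ->
  1 < 2 * rho + alpha ->
  1 < rho / 2 + beta ->
  0 < theta -> 0 < mu1 -> 0 < mu2 ->
  (forall y, mu1 * enorm y `^ theta - mu2 <= f y) ->
  zo_cubic_newton f L alpha beta rho gamma x0 x u ->
  (MD f L alpha beta rho gamma x0 theta mu1 mu2 < +oo)%E /\
  forall T : nat, (1 <= T)%N ->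
    let kstar := last_argmin (scaled_step rho gamma x) (T %/ 2) T in
    ('E_P[fun w => (enorm (x kstar w) `^ theta)%R]
     <= MD f L alpha beta rho gamma x0 theta mu1 mu2)%E.
Proof.
move=> d0 L0 df gradL _ _ _ /andP[gamma0 gamma1] /andP[rho0 rho12] ra rb t0 m10 m20 fge zo.
have {}gradL y z : mnorm (gradient f y - gradient f z) <= L * mnorm (y - z).
  by have := gradL y z; rewrite !enormE.
have {}fge y : mu1 * mnorm y `^ theta - mu2 <= f y by have := fge y; rewrite enormE.
have f_ge y : 0 <= f y + mu2.
  by have := fge y; have := mulr_ge0 (ltW m10) (powR_ge0 (mnorm y) theta); lra.
(* The extended-real expectation in [MD] is a real number, which settles finiteness. *)
have gsE : gauss_smooth f gamma x0 = (smooth f gamma x0)%:E.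
  rewrite /gauss_smooth unlock gauss_meanE//.
  exact: poly_growth_smooth df gradL _ _.
rewrite /MD gsE -!EFinD -EFinM; split; first exact: ltry.
move=> T _ /=; move: (last_argmin _ _ _) => k.
set M := Num.max _ _ * mu1^-1.
have M0 : 0 <= M by rewrite mulr_ge0 ?invr_ge0 ?(ltW m10)// le_max ler01 orbT.
pose Y w := smooth f (smoothing rho gamma k) (x k w) + mu2.
have Y0 w : 0 <= Y w by exact: smooth_ge df gradL f_ge _ _.
have s0 := smoothing_gt0 rho gamma0 k; have sg := smoothing_le rho0 gamma0 k.
have mY : measurable_fun setT (fun w => (Y w)%:E).
  apply/measurable_EFinP; apply: measurable_funD => //.
  exact: (measurableT_comp (measurable_smooth df gradL _) (measurable_funPT (x k))).
set Z := mu1 * (theta + d%:R) `^ (theta / 2).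
have Z0 : 0 <= Z by rewrite mulr_ge0 ?powR_ge0// ltW.
rewrite unlock.
apply: (@le_trans _ _ (\int[P]_w (M%:E * ((Y w)%:E + Z%:E)))%E).
  apply: ge0_le_integral => //.
  - by move=> w _; rewrite lee_fin powR_ge0.
  - apply/measurable_EFinP; apply: (measurableT_comp (measurable_powR theta)).
    under eq_fun do rewrite enormE.
    have mm : measurable_fun setT (@mnorm R d 1) by exact: measurable_mnorm.
    exact: (measurableT_comp mm (measurable_funPT (x k))).
  - by apply: emeasurable_funM => //; exact: emeasurable_funD.
  - move=> w _; rewrite /= -EFinD -EFinM lee_fin enormE.
    apply: (mnorm_powR_le_smooth _ df gradL t0 m10 fge).
    by rewrite ltW//=; exact: le_trans sg (ltW gamma1).
rewrite ge0_integralZl; [|exact: measurableT|exact: emeasurable_funD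
  |by move=> w _; rewrite -EFinD lee_fin addr_ge0|by rewrite lee_fin].
rewrite ge0_integralD//; last by move=> w _; rewrite lee_fin.
rewrite integral_probability_cst [leRHS]EFinM; apply: lee_wpmul2l; first by rewrite lee_fin.
have bound := iterate_bound zo d0 L0 df gradL gamma0 rho0 rho12 f_ge k.
apply: le_trans (leeD bound (lexx _)) _; rewrite -EFinD lee_fin big_split/= -!mulr_sumr.
have dn : 0 <= d%:R :> R by [].
have s4 : 1 < beta + rho / 2 by rewrite addrC.
have s5 : 1 < alpha + 2 * rho by rewrite addrC.
have := sum_powR_le k s4; have := sum_powR_le k s5.
have A4 : 0 <= 2 `^ (rho / 2 + 1) * gamma `^ (1 / 2) * D1 f L gamma `^ (3 / 4)
    / (L `^ (1 / 2) * d%:R `^ (1 / 4)) by rewrite divr_ge0 ?mulr_ge0 ?powR_ge0.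
have A5 : 0 <= 384 * gamma ^+ 2 * D3 d L / (L ^+ 2 * d%:R).
  have D30 : 0 <= D3 d L.
    rewrite /D3; apply: mulr_ge0; last by rewrite exprn_ge0// addr_ge0.
    apply: mulr_ge0; last by rewrite exprn_ge0// addr_ge0.
    by apply: mulr_ge0; [exact: mulr_ge0|rewrite exprn_ge0// ltW].
  apply: divr_ge0; last by rewrite mulr_ge0 ?sqr_ge0.
  apply: mulr_ge0; last exact: D30.
  by apply: mulr_ge0; [exact: ler0n|exact: sqr_ge0].
move=> /(ler_wpM2l A5) h5 /(ler_wpM2l A4) h4.
(* The telescoped price of lowering the radius, with [sigma_k^2] dropped, is the last summand of
   [D6]. *)
have hs : L * d%:R / 2 * (gamma ^+ 2 - smoothing rho gamma k ^+ 2) <= gamma ^+ 2 * L * d%:R / 2.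
  have : 0 <= L * d%:R / 2 by rewrite divr_ge0// mulr_ge0// ltW.
  by have := sqr_ge0 (smoothing rho gamma k); nra.
rewrite /D6 /D4 /D5; lra.
Qed.
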